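(* Let $n\ge 3$, $m\ge 0$, and consider the two-form $Q=r\,dr\wedge dt$ on the $(n+1)$-dimensional Schwarzschild spacetime of mass $m$. For a closed oriented spacelike codimension-two submanifold $\Sigma$ in the Schwarzschild spacetime and a null normal vector field $\underline{L}$ along $\Sigma$, we have $$-(n-1)\int_\Sigma \Big\langle \frac{\partial}{\partial t},\underline{L}\Big\rangle\,d\mu+\int_\Sigma Q(\vec{H},\underline{L})\,d\mu+\sum_{a=1}^{n-1}\int_\Sigma Q\big(e_a,(D_{e_a}\underline{L})^\perp\big)\,d\mu=0 .$$
   Context: The $(n+1)$-dimensional Schwarzschild spacetime with mass $m\ge0$ is the region $r^{n-2}>2m$ with metric $\bar g=\langle\cdot,\cdot\rangle=-\left(1-\frac{2m}{r^{n-2}}\right)dt^2+\frac{1}{1-\frac{2m}{r^{n-2}}}dr^2+r^2g_{S^{n-1}}$, where $g_{S^{n-1}}$ is the round metric on the unit sphere; $D$ is its Levi-Civita connection. Convention: $(dr\wedge dt)(X,Y)=dr(X)dt(Y)-dt(X)dr(Y)$. $\{e_a\}_{a=1}^{n-1}$ is an oriented local orthonormal frame of $T\Sigma$; $(\cdot)^\perp$ is the component normal to $\Sigma$; $\vec H=\sum_a (D_{e_a}e_a)^\perp$ is the mean curvature vector; $d\mu$ is the induced volume form. The normal bundle of $\Sigma$ is assumed to be oriented. *)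

(* Defs.v *)
From HB Require Import structures.
From mathcomp Require Import all_boot all_order all_algebra.
From mathcomp Require Import all_classical all_reals all_analysis.
Set Implicit Arguments.
Unset Strict Implicit.
Unset Printing Implicit Defensive.
Import Order.TTheory GRing.Theory Num.Theory.
Import numFieldNormedType.Exports.
Local Open Scope classical_set_scope.
Local Open Scope ring_scope.

Fixpoint Ck_on {R : realType} {E F : normedModType R} (U : set E) (k : nat)
    (f : E -> F) : Prop :=
  match k with
  | 0 => forall x, U x -> {for x, continuous f}
  | k'.+1 => (forall x, U x -> differentiable f x) /\
             (forall v, Ck_on U k' (fun x => 'D_v f x))
  end.

(* Only used with U open. *)
Definition smooth_on {R : realType} {E F : normedModType R} (U : set E)
    (f : E -> F) : Prop := forall k, Ck_on U k f.

(* F is a smooth function on a neighbourhood of p that agrees with f on A. *)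
Definition is_local_extension {R : realType} {E F : normedModType R}
    (A : set E) (f : E -> F) (p : E) (f' : E -> F) : Prop :=
  exists U : set E, [/\ open U, U p, smooth_on U f' &
    forall q, A q -> U q -> f' q = f q].

(* Smoothness of a map defined on an arbitrary subset A of a vector space
   (the values of f outside A are irrelevant). *)
Definition smooth_on_subset {R : realType} {E F : normedModType R}
    (A : set E) (f : E -> F) : Prop :=
  forall p, A p -> exists f' : E -> F, is_local_extension A f p f'.

(* Embedded submanifolds S of R^N, through local parametrizations
   phi : U -> S, diffeomorphisms from an open subset U of R^k onto a
   relatively open subset of S. *)

Definition is_parametrization {R : realType} {N k : nat} (S : set 'rV[R]_N)
    (U : set 'rV[R]_k) (phi : 'rV[R]_k -> 'rV[R]_N) : Prop :=
  [/\ open U, smooth_on U phi,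
      exists2 W : set 'rV[R]_N, open W & phi @` U = S `&` W &
      exists2 psi : 'rV[R]_N -> 'rV[R]_k,
        smooth_on_subset (phi @` U) psi & forall u, U u -> psi (phi u) = u].

Definition is_submanifold {R : realType} {N : nat} (k : nat)
    (S : set 'rV[R]_N) : Prop :=
  forall p, S p -> exists (U : set 'rV[R]_k) (phi : 'rV[R]_k -> 'rV[R]_N),
    is_parametrization S U phi /\ (phi @` U) p.

Definition tangent {R : realType} {N : nat} (k : nat) (S : set 'rV[R]_N)
    (p : 'rV[R]_N) : set 'rV[R]_N :=
  [set X | exists (U : set 'rV[R]_k) (phi : 'rV[R]_k -> 'rV[R]_N)
                  (u w : 'rV[R]_k),
     [/\ is_parametrization S U phi, U u, phi u = p & X = 'd phi u w]].

(* An orientation of the rank-k subbundle E of the trivial bundle S x R^N: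
   o p is the set of positively oriented bases of the fibre E p, a basis being
   encoded as the k x N matrix whose rows are its vectors. *)
Definition is_orientation {R : realType} {N : nat} (k : nat)
    (S : set 'rV[R]_N) (E : 'rV[R]_N -> set 'rV[R]_N)
    (o : 'rV[R]_N -> set 'M[R]_(k, N)) : Prop :=
  forall p, S p -> exists (W : set 'rV[R]_N) (B : 'rV[R]_N -> 'M[R]_(k, N)),
    [/\ open W, W p, {within S `&` W, continuous B} &
     forall q, S q -> W q ->
     [/\ row_free (B q), (forall X : 'rV[R]_N, E q X <-> (X <= B q)%MS) &
         forall C : 'M[R]_(k, N),
           o q C <-> exists2 J : 'M[R]_k, 0 < \det J & C = J *m B q]].

(* The Schwarzschild spacetime is R_t x {x in R^n : |x|^(n-2) > 2m}, covered
   by the global coordinates (t, x) in R^(n+1), with x = r omega in polar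
   coordinates (r, omega) in (0, +oo) x S^(n-1). *)

Definition tcoord {R : realType} {n : nat} (p : 'rV[R]_n.+1) : R := p 0 0.

Definition xcoord {R : realType} {n : nat} (p : 'rV[R]_n.+1) : 'rV[R]_n :=
  \row_(i < n) p 0 (lift ord0 i).

Definition dot {R : realType} {n : nat} (x y : 'rV[R]_n) : R :=
  \sum_(i < n) x 0 i * y 0 i.

Definition radius {R : realType} {n : nat} (p : 'rV[R]_n.+1) : R :=
  Num.sqrt (dot (xcoord p) (xcoord p)).

Definition omega {R : realType} {n : nat} (p : 'rV[R]_n.+1) : 'rV[R]_n :=
  (radius p)^-1 *: xcoord p.

Definition schwarzschild {R : realType} {n : nat} (m : R) :
    set 'rV[R]_n.+1 := [set p | 2 * m < radius p ^+ (n - 2)].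

Definition dt {R : realType} {n : nat} (p X : 'rV[R]_n.+1) : R :=
  'd (@tcoord R n) p X.

Definition dr {R : realType} {n : nat} (p X : 'rV[R]_n.+1) : R :=
  'd (@radius R n) p X.

(* Pull-back by omega of the round metric, the restriction to the unit sphere
   of the Euclidean inner product. *)
Definition round_metric {R : realType} {n : nat} (p X Y : 'rV[R]_n.+1) : R :=
  dot ('d (@omega R n) p X) ('d (@omega R n) p Y).

Definition gbar {R : realType} {n : nat} (m : R) (p X Y : 'rV[R]_n.+1) : R :=
  let f := 1 - 2 * m / radius p ^+ (n - 2) in
  - f * (dt p X * dt p Y) + f^-1 * (dr p X * dr p Y)
  + radius p ^+ 2 * round_metric p X Y.

Definition ddt {R : realType} {n : nat} : 'rV[R]_n.+1 := delta_mx 0 0.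

Definition Qform {R : realType} {n : nat} (p X Y : 'rV[R]_n.+1) : R :=
  radius p * (dr p X * dt p Y - dt p X * dr p Y).

Definition gmx {R : realType} {n : nat} (m : R) (p : 'rV[R]_n.+1) :
    'M[R]_n.+1 :=
  \matrix_(i, j) gbar m p (delta_mx 0 i) (delta_mx 0 j).

Definition christoffel {R : realType} {n : nat} (m : R) (p : 'rV[R]_n.+1)
    (k i j : 'I_n.+1) : R :=
  let dg (a b c : 'I_n.+1) :=
    'D_(delta_mx 0 a) (fun q : 'rV[R]_n.+1 => gmx m q b c) p in
  2^-1 * \sum_l invmx (gmx m p) k l * (dg i j l + dg j i l - dg l i j).

Definition levi_civita {R : realType} {n : nat} (m : R)
    (Y : 'rV[R]_n.+1 -> 'rV[R]_n.+1) (p X : 'rV[R]_n.+1) : 'rV[R]_n.+1 :=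
  'D_X Y p
  + \row_k \sum_i \sum_j christoffel m p k i j * X 0 i * Y p 0 j.

(* D_X Y at p for X tangent to S and Y a vector field along S (the values of Y
   outside S are irrelevant); the result does not depend on the extension. *)
Definition cov_along {R : realType} {n : nat} (m : R) (S : set 'rV[R]_n.+1)
    (Y : 'rV[R]_n.+1 -> 'rV[R]_n.+1) (p X : 'rV[R]_n.+1) : 'rV[R]_n.+1 :=
  levi_civita m (xget (fun=> 0) [set Y' | is_local_extension S Y p Y']) p X.

(* Below, S is a codimension-two submanifold, of dimension n - 1. *)

Definition normal {R : realType} {n : nat} (m : R) (S : set 'rV[R]_n.+1)
    (p : 'rV[R]_n.+1) : set 'rV[R]_n.+1 :=
  [set X | forall Y, tangent n.-1 S p Y -> gbar m p X Y = 0].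

Definition perp {R : realType} {n : nat} (m : R) (S : set 'rV[R]_n.+1)
    (p X : 'rV[R]_n.+1) : 'rV[R]_n.+1 :=
  xget 0 [set Z | normal m S p Z /\ tangent n.-1 S p (X - Z)].

Definition is_spacelike {R : realType} {n : nat} (m : R)
    (S : set 'rV[R]_n.+1) : Prop :=
  forall p X, S p -> tangent n.-1 S p X -> X != 0 -> 0 < gbar m p X X.

Definition is_null_normal_field {R : realType} {n : nat} (m : R)
    (S : set 'rV[R]_n.+1) (L : 'rV[R]_n.+1 -> 'rV[R]_n.+1) : Prop :=
  smooth_on_subset S L /\
  forall p, S p -> normal m S p (L p) /\ gbar m p (L p) (L p) = 0.

Definition is_oriented_frame {R : realType} {n : nat} (m : R)
    (S : set 'rV[R]_n.+1) (o : 'rV[R]_n.+1 -> set 'M[R]_(n.-1, n.+1))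
    (p : 'rV[R]_n.+1) (e : 'I_n.-1 -> 'rV[R]_n.+1 -> 'rV[R]_n.+1) : Prop :=
  exists W : set 'rV[R]_n.+1,
    [/\ open W, W p, forall a, smooth_on_subset (S `&` W) (e a) &
     forall q, S q -> W q ->
     [/\ forall a, tangent n.-1 S q (e a q),
         forall a b, gbar m q (e a q) (e b q) = (a == b)%:R &
         o q (\matrix_(a < n.-1) e a q)]].

Definition mean_curvature {R : realType} {n : nat} (m : R)
    (S : set 'rV[R]_n.+1) (e : 'I_n.-1 -> 'rV[R]_n.+1 -> 'rV[R]_n.+1)
    (p : 'rV[R]_n.+1) : 'rV[R]_n.+1 :=
  \sum_(a < n.-1) perp m S p (cov_along m S (e a) p (e a p)).

(* Integral over R^k, one variable at a time.  It is only applied to continuous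
   functions with compact support, for which this is the Lebesgue integral. *)
Fixpoint rV_integral {R : realType} (k : nat) : ('rV[R]_k -> R) -> R :=
  match k return ('rV[R]_k -> R) -> R with
  | 0 => fun f => f 0
  | k'.+1 => fun f =>
      \int[lebesgue_measure]_s rV_integral (fun y : 'rV[R]_k' =>
        f (row_mx (s%:M : 'rV[R]_1) y : 'rV[R]_(1 + k')))
  end.

(* A finite list of positively oriented parametrizations (U, phi), each with
   its function rho in a subordinate partition of unity of S. *)
Definition patch (R : realType) (n : nat) : Type :=
  (set 'rV[R]_n.-1 * ('rV[R]_n.-1 -> 'rV[R]_n.+1) * ('rV[R]_n.+1 -> R))%type.

Definition is_partition_of_unity {R : realType} {n : nat}
    (S : set 'rV[R]_n.+1) (o : 'rV[R]_n.+1 -> set 'M[R]_(n.-1, n.+1))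
    (P : seq (patch R n)) : Prop :=
  (forall U phi rho, (U, phi, rho) \in P ->
    [/\ is_parametrization S U phi,
        forall u, U u -> o (phi u) (jacobian phi u),
        smooth_on_subset S rho,
        forall p, S p -> 0 <= rho p &
        closure (S `&` [set p | rho p != 0]) `<=` phi @` U]) /\
  (forall p, S p -> \sum_(c <- P) c.2 p = 1).

Definition volume_density {R : realType} {n : nat} (m : R)
    (phi : 'rV[R]_n.-1 -> 'rV[R]_n.+1) (u : 'rV[R]_n.-1) : R :=
  Num.sqrt (\det (\matrix_(i < n.-1, j < n.-1)
    gbar m (phi u) ('d phi u (delta_mx 0 i)) ('d phi u (delta_mx 0 j)))).

(* Integral over S against the induced volume form; the result does not depend
   on the partition of unity, which exists when S is a compact spacelike
   submanifold oriented by o. *)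
Definition volume_integral {R : realType} {n : nat} (m : R)
    (S : set 'rV[R]_n.+1) (o : 'rV[R]_n.+1 -> set 'M[R]_(n.-1, n.+1))
    (F : 'rV[R]_n.+1 -> R) : R :=
  \sum_(c <- xget [::] [set P | is_partition_of_unity S o P])
    rV_integral (fun u : 'rV[R]_n.-1 =>
      if u \in c.1.1
      then c.2 (c.1.2 u) * F (c.1.2 u) * volume_density m c.1.2 u
      else 0).

(* Main.v *)
Require Import Defs.
From HB Require Import structures.
From mathcomp Require Import all_boot all_order all_algebra fingroup perm.
From mathcomp Require Import all_classical all_reals all_analysis.
From mathcomp Require Import ring lra.
Set Implicit Arguments.
Unset Strict Implicit.
Unset Printing Implicit Defensive.
Import Order.TTheory GRing.Theory Num.Theory.
Import numFieldNormedType.Exports.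
Local Open Scope classical_set_scope.
Local Open Scope ring_scope.

(** The argument is the divergence theorem for a single tangent field.  Let W be
the tangent field of Sigma with <W, X> = Q(X, L) for X tangent, that is
W = sum_a Q(e_a, L) e_a.  Differentiating with the Leibniz rule gives
  div W = sum_a (D_{e_a} Q)(e_a, L) + Q(H, L) + sum_a Q(e_a, D_{e_a} L).
In the first sum, the symmetric part of D Q is known because Q is a conformal
Killing-Yano form ([conformal_Killing_Yano]):
  (D_X Q)(Y, Z) + (D_Y Q)(X, Z)
    = - 2 <X, Y> <d_t, Z> + <X, Z> <d_t, Y> + <Y, Z> <d_t, X>;
with Z = L normal this makes it - (n-1) <d_t, L> ([trace_DQ]).  In the last sum,
the tangential part of D L has the coefficients - <L, II>, which are symmetric,
whereas Q is antisymmetric, so only the normal part of D L survives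
([trace_cov_L]).  Hence div W is exactly the integrand, and its integral over a
closed manifold vanishes.

In a chart phi with Gram matrix g, the computation reads
  sum_i d_i (sqrt(det g) W^i) = sqrt(det g) (integrand)
([integrand_divergence]); there D and II are expressed through the Christoffel
symbols, the frame disappears because sum_a e_a (x) e_a is the inverse Gram
matrix ([frame_trace]), and the symmetry of II is the symmetry of second
derivatives ([second_cov_sym]).

To globalise, the integrand is multiplied by each function rho_c of the
partition of unity and integrated by parts in the chart of c: what is left is
minus the integral of W(rho_c) over that chart ([chart_divergence]).  As the sum
of the rho_c is constant, the sum of the W(rho_c) vanishes at every point
([sum_slope]), but each of them is integrated in its own chart.  Inserting the
partition of unity once more, W(rho_c) is the sum of the rho_d W(rho_c), each
supported in the charts of both c and d, and the change of variables between
these charts moves it from c to d ([slope_exchange]); summing over c first then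
gives zero.

The integral is the iterated one, used on continuous functions of compact
support, and the theory of this integral is built from its linearity, its
continuity and its translation invariance.  Any two translation-invariant
functionals are proportional ([translation_invariant_unique]), which yields
linear changes of variables through an LU decomposition.  A nonlinear change of
variables chi ([change_of_variables]) follows by mollifying f along chi: the
integral of f(z) eta((y - chi z) / e) / e^k over z and y does not depend on e,
and when e tends to 0 the linear case identifies the inner integral over z. *)

(** * Compactly supported functions on the line *)

(** Continuous functions of compact support, with an explicit radius: all the
bounds below depend on the function only through its sup norm and this radius. *)
Definition cc {R : realType} {V : normedModType R} (M : R) (f : V -> R) : Prop :=
  continuous f /\ forall x, M < `|x| -> f x = 0.

Section OneDim.
Context {R : realType}.
Local Notation mu := (@lebesgue_measure R).
Local Notation I1 f := (\int[mu]_s (f s)).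

Lemma cc_integrable (M : R) (f : R -> R) : cc M f ->
  mu.-integrable setT (EFin \o f).
Proof.
move=> [cf f0].
have -> : EFin \o f = (EFin \o f) \_ `[-M, M].
  apply/funext => x /=; rewrite /patch /=; case: ifPn => // xM.
  rewrite f0//; move: xM; rewrite ltNge; apply: contra => xM.
  by rewrite inE/= in_itv/= -ler_norml.
rewrite -integrable_mkcond//.
apply: continuous_compact_integrable; first exact: segment_compact.
exact: continuous_subspaceT.
Qed.

Lemma int1_itv (M a b : R) (f : R -> R) : cc M f -> a <= - M -> M <= b ->
  I1 f = \int[mu]_(s in `[a, b]) (f s).
Proof.
move=> [cf f0] aM bM; rewrite [RHS]Rintegral_mkcond; apply: eq_Rintegral => x _.
rewrite /patch; case: ifPn => // xab; apply: f0.
rewrite ltNge; apply: contra xab => xM.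
rewrite inE/= in_itv/=; move: xM; rewrite ler_norml => /andP[h1 h2].
by rewrite (le_trans aM h1) (le_trans h2 bM).
Qed.

Lemma int1D (M : R) (f g : R -> R) : cc M f -> cc M g ->
  I1 (fun s => f s + g s) = I1 f + I1 g.
Proof.
move=> cf cg.
by rewrite (RintegralD _ (cc_integrable cf) (cc_integrable cg)).
Qed.

Lemma int1Z (M a : R) (f : R -> R) : cc M f -> I1 (fun s => a * f s) = a * I1 f.
Proof. by move=> cf; rewrite (RintegralZl _ _ (cc_integrable cf)). Qed.

Lemma int1_bound (M b : R) (f : R -> R) : 0 <= M -> cc M f ->
  (forall x, `|f x| <= b) -> `|I1 f| <= 2 * M * b.
Proof.
move=> M0 cf fb.
rewrite (int1_itv cf (lexx _) (lexx _)).
have ci : mu.-integrable `[-M, M] (EFin \o f).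
  by apply: integrableS (cc_integrable cf).
apply: (le_trans (le_normr_Rintegral _ _)) => //.
have -> : 2 * M * b = \int[mu]_(s in `[-M, M]) b.
  rewrite Rintegral_cst//= lebesgue_measure_itv/= lte_fin.
  case: ifPn => [_|]; first by rewrite /= opprK; ring.
  rewrite -leNgt => h; have -> : M = 0 by lra.
  by rewrite mulr0 mul0r mulr0.
apply: le_Rintegral => //.
- apply: integrable_norm => //.
- apply: continuous_compact_integrable; first exact: segment_compact.
  by move=> ?; exact: cst_continuous.
Qed.

(** Dominated convergence, the dominating function being b on the common support. *)
Lemma int1_dominated (M b : R) (f : nat -> R -> R) (g : R -> R) :
  (forall n, cc M (f n)) -> cc M g -> (forall n x, `|f n x| <= b) ->
  (forall x, f n x @[n --> \oo] --> g x) ->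
  I1 (f n) @[n --> \oo] --> I1 g.
Proof.
move=> cf cg fb fg.
have iE (f' : R -> R) : cc M f' -> mu.-integrable `[-M, M] (EFin \o f').
  by move=> cf'; exact: integrableS (cc_integrable cf').
pose mE f' (cf' : cc M f') := measurable_int _ (iE f' cf').
have ig : mu.-integrable `[-M, M] (cst b%:E).
  apply: (@continuous_compact_integrable _ (cst b)); first exact: segment_compact.
  by move=> ?; exact: cst_continuous.
have f_f : {ae mu, forall x, `[-M, M]%classic x ->
    (EFin \o f n) x @[n --> \oo] --> (EFin \o g) x}.
  apply: aeW => x _; apply/fine_cvgP; split; [exact: nearW|exact: fg].
have f_g : {ae mu, forall x n, `[-M, M]%classic x ->
    (`|(EFin \o f n) x| <= cst b%:E x)%E}.
  by apply: aeW => x n _; rewrite /= lee_fin.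
have [//|_ _ h] := @dominated_convergence _ _ R mu `[-M, M]%classic _
   (fun n => EFin \o f n) (EFin \o g) (cst b%:E) (fun n => mE _ (cf n)) (mE _ cg)
   f_f ig f_g.
have -> : I1 g = \int[mu]_(x in `[-M, M]) g x by exact: (int1_itv cg (lexx _) (lexx _)).
under eq_fun do rewrite (int1_itv (cf _) (lexx _) (lexx _)).
apply: fine_cvg; rewrite fineK//.
exact: integrable_fin_num (iE g cg).
Qed.

Lemma cc_affine (M c d : R) (f : R -> R) : cc M f -> 0 < c ->
  cc ((M + `|d|) / c) (fun s => f (c * s + d)).
Proof.
move=> [cf f0] c0; split.
  move=> x; apply: (@continuous_comp _ _ _ (fun s => c * s + d) f); last exact: cf.
  by apply: cvgD; [apply: cvgMr; exact: cvg_id | exact: cvg_cst].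
move=> x; rewrite ltr_pdivrMr// => h; apply: f0.
have := ler_normB (c * x + d) d; rewrite addrK normrM (gtr0_norm c0); lra.
Qed.

Lemma int1_affine (M c d : R) (f : R -> R) : 0 <= M -> cc M f -> 0 < c ->
  c * I1 (fun s => f (c * s + d)) = I1 f.
Proof.
move=> M0 cf c0; have cfa := cc_affine d cf c0.
have [d1 d2] : - `|d| <= d /\ d <= `|d|.
  by split; [rewrite lerNl -normrN ler_norm|exact: ler_norm].
set B := (M + `|d|) / c in cfa *.
have B0 : 0 <= B by rewrite divr_ge0 ?addr_ge0// ltW.
have cB : c * B = M + `|d| by rewrite /B; field; rewrite gt_eqF.
pose F (s : R) := c * s + d.
have dF (x : R) : is_derive x 1 F c.
  by apply: is_derive_eq; rewrite addr0 /GRing.scale/= mulr1.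
have F' : derive1 F = cst c by apply/funext => x; rewrite derive1E derive_val.
have cF : continuous F.
  move=> x; apply: differentiable_continuous; apply/derivable1_diffP.
  exact: (@ex_derive _ _ _ _ _ _ _ (dF x)).
rewrite (@int1_itv M (F (- B)) (F B) f)//; last 2 first.
- rewrite /F; lra.
- rewrite /F; lra.
rewrite [RHS]/Rintegral integration_by_substitution_increasing//; last 7 first.
- lra.
- by move=> x y _ _ xy; rewrite /F ltrD2r ltr_pM2l.
- by rewrite F' => ? ?; exact: cvg_cst.
- by rewrite F'; exact: is_cvg_cst.
- by rewrite F'; exact: is_cvg_cst.
- split => //.
  + by apply: cvg_at_right_filter; exact: cF.
  + by apply: cvg_at_left_filter; exact: cF.
- by apply: continuous_subspaceT; case: cf.
rewrite -(int1Z _ cfa).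
have cfc : cc B (fun s => c * f (c * s + d)).
  split; last by move=> x /cfa.2 ->; rewrite mulr0.
  by move=> x; apply: cvgMr; exact: cfa.1.
rewrite (int1_itv cfc (lexx _) (lexx _)); apply: eq_Rintegral => x _ /=.
by rewrite F' mulrC.
Qed.

Lemma int1N (M : R) (f : R -> R) : 0 <= M -> cc M f -> I1 (fun s => f (- s)) = I1 f.
Proof.
move=> M0 cf.
have cfN : cc M (fun s => f (- s)).
  split; last by move=> x xM; apply: cf.2; rewrite normrN.
  by move=> x; apply: (@continuous_comp _ _ _ -%R f); [exact: oppr_continuous|exact: cf.1].
rewrite (int1_itv cf (lexx _) (lexx _)) (int1_itv cfN (lexx _) (lexx _)).
have := @integration_by_substitution_oppr R f (-M) M.
rewrite opprK /Rintegral => -> //; first lra.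
by apply: continuous_subspaceT; case: cf.
Qed.

(** The error is controlled by the oscillation alone, hence uniformly in any
parameter on which f depends equicontinuously; this is what exchanging an integral
with another functional needs. *)
Lemma int1_riemann (M e : R) (N : nat) (f : R -> R) : (0 < N)%N -> 0 <= M -> cc M f ->
  (forall s s', `|s - s'| <= 2 * M / N%:R -> `|f s - f s'| <= e) ->
  `|I1 f - \sum_(i < N) (2 * M / N%:R) * f (- M + i%:R * (2 * M / N%:R))| <= 2 * M * e.
Proof.
move=> N0 M0 cf.
set h := 2 * M / N%:R => fe.
have h0 : 0 <= h by rewrite divr_ge0// mulr_ge0.
have ii (a b : R) : mu.-integrable `[a, b] (EFin \o f).
  by apply: integrableS (cc_integrable cf).
have step (k : nat) : `|\int[mu]_(s in `[- M, - M + k%:R * h]) (f s) -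
    \sum_(i < k) h * f (- M + i%:R * h)| <= k%:R * h * e.
  elim: k => [|k IH].
    by rewrite big_ord0 !mul0r addr0 subr0 set_itv1 Rintegral_set1 normr0.
  have xk : - M <= - M + k%:R * h by rewrite lerDl mulr_ge0.
  have xk1 : - M + k.+1%:R * h = - M + k%:R * h + h by rewrite -natr1; ring.
  rewrite xk1 big_ord_recr/=; set a := - M + k%:R * h.
  have -> : \int[mu]_(s in `[- M, a + h]) f s = \int[mu]_(s in `[- M, a]) f s +
     \int[mu]_(s in `[a, a + h]) f s.
    apply/eqP; rewrite [eqbRHS]addrC -subr_eq; apply/eqP.
    rewrite Rintegral_itvB ?bnd_simp//; last by rewrite lerDl.
    rewrite Rintegral_itv_obnd_cbnd//; apply: integrableS (ii a (a + h)) => //.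
    by apply: subset_itvr; rewrite bnd_simp.
  have -> : h * f a = \int[mu]_(s in `[a, a + h]) f a.
    rewrite Rintegral_cst//= lebesgue_measure_itv/= lte_fin.
    case: ifPn => [_|]; first by rewrite /=; ring.
    rewrite -leNgt gerDl => hh; have -> : h = 0 by lra.
    by rewrite mul0r mulr0.
  have ic c : mu.-integrable `[a, a + h] (EFin \o cst c).
    apply: continuous_compact_integrable; first exact: segment_compact.
    by move=> ?; exact: cst_continuous.
  have : `|\int[mu]_(s in `[a, a + h]) f s - \int[mu]_(s in `[a, a + h]) f a| <= h * e.
    rewrite -RintegralB//; last exact: ic.
    have iB : mu.-integrable `[a, a + h] (EFin \o (fun s => f s - f a)).
      by apply: (integrableB _ (ii a (a + h)) (ic (f a))).
    apply: (le_trans (le_normr_Rintegral _ _)) => //.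
    have -> : h * e = \int[mu]_(s in `[a, a + h]) e.
      rewrite Rintegral_cst//= lebesgue_measure_itv/= lte_fin.
      case: ifPn => [_|]; first by rewrite /=; ring.
      rewrite -leNgt gerDl => hh; have -> : h = 0 by lra.
      by rewrite mul0r mulr0.
    apply: le_Rintegral => //; [exact: integrable_norm|exact: ic|].
    move=> x; rewrite /= in_itv/= => /andP[ax xh]; apply: fe.
    by rewrite ger0_norm; lra.
  move=> hB; move: IH; rewrite -/a => IH.
  rewrite opprD addrACA (le_trans (ler_normD _ _))//.
  by rewrite -natr1 2!mulrDl mul1r lerD.
have := step N.
have -> : N%:R * h = 2 * M by rewrite /h; field; rewrite pnatr_eq0 -lt0n.
have -> : - M + 2 * M = M by ring.
by rewrite -(int1_itv cf (lexx _) (lexx _)).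
Qed.
End OneDim.

(** * Bounded functionals on compactly supported functions *)

Section Functionals.
Context {R : realType}.

Lemma cc_le {V : normedModType R} (M M' : R) (f : V -> R) :
  M <= M' -> cc M f -> cc M' f.
Proof. by move=> MM' [cf f0]; split=> // x xM; apply: f0; exact: le_lt_trans xM. Qed.

Lemma ccD {V : normedModType R} (M : R) (f g : V -> R) : cc M f -> cc M g ->
  cc M (fun x => f x + g x).
Proof.
move=> [cf f0] [cg g0]; split; first by move=> x; apply: cvgD; [exact: cf|exact: cg].
by move=> x xM; rewrite f0// g0// addr0.
Qed.

Lemma ccM {V : normedModType R} (M : R) (f g : V -> R) : continuous f -> cc M g ->
  cc M (fun x => f x * g x).
Proof.
move=> cf [cg g0]; split; first by move=> x; apply: cvgM; [exact: cf|exact: cg].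
by move=> x xM; rewrite g0// mulr0.
Qed.

Lemma ccZ {V : normedModType R} (M a : R) (f : V -> R) : cc M f ->
  cc M (fun x => a * f x).
Proof. by move=> cf; apply: (@ccM _ _ (fun=> a)) => // x; exact: cvg_cst. Qed.

Lemma ccB {V : normedModType R} (M : R) (f g : V -> R) : cc M f -> cc M g ->
  cc M (fun x => f x - g x).
Proof.
move=> [cf f0] [cg g0]; split; first by move=> x; apply: cvgB; [exact: cf|exact: cg].
by move=> x xM; rewrite f0// g0// subr0.
Qed.

Lemma cc0 {V : normedModType R} (M : R) : cc M (fun _ : V => 0 : R).
Proof. by split=> // x; exact: cvg_cst. Qed.

(** Continuity for the inductive limit topology: the norm of the functional may
depend on the support.  The functionals compared with the integral (translates,
linear changes of variables, slices) are of this kind. *)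
Definition bounded_linear {V : normedModType R} (Lam : (V -> R) -> R) : Prop :=
  [/\ forall M f g, cc M f -> cc M g -> Lam (fun x => f x + g x) = Lam f + Lam g,
      forall M a f, cc M f -> Lam (fun x => a * f x) = a * Lam f &
      forall M, exists2 C : R, 0 <= C & forall f (b : R), cc M f -> (forall x, `|f x| <= b) ->
        `|Lam f| <= C * b].

Section BL.
Context {V : normedModType R} (Lam : (V -> R) -> R) (hL : bounded_linear Lam).

Lemma blB M f g : cc M f -> cc M g -> Lam (fun x => f x - g x) = Lam f - Lam g.
Proof.
have [LD LZ _] := hL; move=> cf cg.
rewrite -[in RHS](mulN1r (Lam g)) -(LZ _ _ _ cg) -(LD _ _ _ cf (ccZ _ cg)).
by congr Lam; apply/funext => x; rewrite mulN1r.
Qed.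

Lemma bl0 : Lam (fun=> 0) = 0.
Proof.
have [_ LZ _] := hL; rewrite -[RHS](mul0r (Lam (fun=> 0))) -(LZ _ _ _ (cc0 0)).
by congr Lam; apply/funext => x; rewrite mul0r.
Qed.

Lemma cc_sum (I : Type) (r : seq I) M (f : I -> V -> R) : (forall i, cc M (f i)) ->
  cc M (fun x => \sum_(i <- r) f i x).
Proof.
move=> cf; elim: r => [|i r IH].
  by under eq_fun do rewrite big_nil; exact: cc0.
by under eq_fun do rewrite big_cons; exact: ccD.
Qed.

Lemma bl_sum (I : Type) (r : seq I) M (f : I -> V -> R) : (forall i, cc M (f i)) ->
  Lam (fun x => \sum_(i <- r) f i x) = \sum_(i <- r) Lam (f i).
Proof.
have [LD _ _] := hL.
move=> cf; elim: r => [|i r IH].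
  by under eq_fun do rewrite big_nil; rewrite big_nil bl0.
under eq_fun do rewrite big_cons; rewrite big_cons -IH.
by apply: LD; [exact: cf|exact: cc_sum].
Qed.
End BL.

Lemma compact_norm_le k (M : R) : compact [set x : 'rV[R]_k | `|x| <= M].
Proof.
apply: bounded_closed_compact.
  exists M; split; first exact: num_real.
  by move=> x Mx y /= yM; rewrite (le_trans yM)// ltW.
apply: (@closed_comp _ _ (fun x : 'rV[R]_k => `|x|) [set y | y <= M]) => //.
by move=> x _; exact: norm_continuous.
Qed.

(** By compactness of the support, F t is uniformly close to F t0 when t is near
t0, so the bound on the functional applies. *)
Lemma bl_continuous {T : topologicalType} k (Lam : ('rV[R]_k -> R) -> R) M
    (F : T -> 'rV[R]_k -> R) : bounded_linear Lam ->
  continuous (fun p : T * 'rV[R]_k => F p.1 p.2) ->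
  (forall t x, M < `|x| -> F t x = 0) ->
  continuous (fun t => Lam (F t)).
Proof.
move=> hL cF F0 t0.
have [_ _ /(_ M)[C C0 LC]] := hL.
have cFt t : cc M (F t).
  split=> [x|]; last exact: F0.
  by apply: (@continuous2_cvg _ T _ _ (nbhs x) _ (fun=> t) id F t x (cF (t, x))); [exact: cvg_cst|exact: cvg_id].
apply/cvgrPdist_le => /= e e0.
pose e' := e / (C + 1).
have e'0 : 0 < e' by rewrite divr_gt0// ltr_wpDl.
have := @compact_norm_le k M; rewrite compact_near_coveringP.
move/(_ T (nbhs t0) (fun t y => `|F t0 y - F t y| <= e') _) => H.
have {H} : \forall t \near t0, [set x : 'rV[R]_k | `|x| <= M] `<=` (fun y => `|F t0 y - F t y| <= e').
  apply: H => x _.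
  have /cvgrPdist_le/(_ (e' / 2)) := cF (t0, x).
  have e2 : 0 < e' / 2 by rewrite divr_gt0.
  move=> /(_ e2)/= [[A B]/= [hA hB] AB].
  exists (B, A) => //= -[y t]/= [By At].
  have h1 := AB (t, y) (conj At By); have h2 := AB (t0, y) (conj (nbhs_singleton hA) By).
  rewrite /= in h1 h2.
  have -> : F t0 y - F t y = (F t0 x - F t y) - (F t0 x - F t0 y) by ring.
  by apply: (le_trans (ler_normB _ _)); rewrite [leRHS](splitr e') lerD.
apply: filterS => t Ht.
rewrite -(blB hL (cFt _) (cFt _)).
apply: (@le_trans _ _ (C * e')).
  apply: LC; first exact: ccB.
  move=> x; case: (leP `|x| M) => [|xM]; first exact: Ht.
  by rewrite !F0// subrr normr0 ltW.
by rewrite /e' mulrCA ger_pMr// ler_pdivrMr ?ltr_wpDl// mul1r lerDl.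
Qed.
End Functionals.

(** * The iterated integral *)

Section ConsRow.
Context {R : realType} {k : nat}.

Definition consrV (s : R) (y : 'rV[R]_k) : 'rV[R]_k.+1 :=
  (row_mx (s%:M : 'rV_1) y : 'rV_(1 + k)).

Definition tailrV (x : 'rV[R]_k.+1) : 'rV[R]_k := \row_j x 0 (lift ord0 j).

Lemma consrV0 s y : consrV s y 0 ord0 = s.
Proof.
have := row_mxEl (s%:M : 'rV_1) y 0 0; rewrite [RHS]mxE eqxx mulr1n => e; apply: etrans e.
by congr (row_mx _ _ _ _); exact: val_inj.
Qed.

Lemma consrVS s y j : consrV s y 0 (lift ord0 j) = y 0 j.
Proof.
rewrite -(row_mxEr (s%:M : 'rV_1) y 0 j).
by congr (row_mx _ _ _ _); exact: val_inj.
Qed.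

Lemma consrV_eta (x : 'rV[R]_k.+1) : x = consrV (x 0 ord0) (tailrV x).
Proof.
apply/rowP => j; case: (unliftP ord0 j) => [i|] ->; first by rewrite consrVS mxE.
by rewrite consrV0.
Qed.

Lemma consrVD s t y z : consrV s y + consrV t z = consrV (s + t) (y + z).
Proof.
apply/rowP => j; rewrite mxE; case: (unliftP ord0 j) => [i|] ->.
  by rewrite !consrVS mxE.
by rewrite !consrV0.
Qed.
End ConsRow.

Lemma entry_le_norm {R : realType} k (x : 'rV[R]_k) j : `|x 0 j| <= `|x|.
Proof.
by rewrite [leRHS]/Num.Def.normr/= mx_normrE; exact: (le_bigmax _ _ (0, j)).
Qed.

Lemma norm_le_entries {R : realType} k (x : 'rV[R]_k) (e : R) : 0 <= e ->
  (forall j, `|x 0 j| <= e) -> `|x| <= e.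
Proof.
move=> e0 h; rewrite /Num.Def.normr/= mx_normrE.
by apply: bigmax_le => // -[i j] _ /=; rewrite ord1.
Qed.

(** Convergence in the sup norm is convergence of the finitely many entries. *)
Lemma cvg_rV {R : realType} {T : Type} {F : set_system T} {FF : Filter F} k
    (f : T -> 'rV[R]_k) (l : 'rV[R]_k) :
  (forall j, f x 0 j @[x --> F] --> l 0 j) -> f x @[x --> F] --> l.
Proof.
move=> h; apply/cvgrPdist_le => /= e e0.
have : \forall x \near F, forall j, `|l 0 j - f x 0 j| <= e.
  apply: filter_forall => j; have /cvgrPdist_le := h j; exact.
apply: filterS => x hx; apply: norm_le_entries; first exact: ltW.
by move=> j; rewrite !mxE.
Qed.

Lemma cvg_entry {R : realType} {T : Type} {F : set_system T} {FF : Filter F} k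
    (f : T -> 'rV[R]_k) (l : 'rV[R]_k) j :
  f x @[x --> F] --> l -> f x 0 j @[x --> F] --> l 0 j.
Proof.
move=> h; apply/cvgrPdist_le => /= e e0.
have /cvgrPdist_le/(_ e e0) := h; apply: filterS => x; apply: le_trans.
by apply: le_trans (entry_le_norm _ j); rewrite !mxE.
Qed.

Section ConsNorm.
Context {R : realType} {k : nat}.
Implicit Types (s : R) (y : 'rV[R]_k).

Lemma consrV_norml s y : `|s| <= `|consrV s y|.
Proof. by rewrite -[in leLHS](consrV0 s y) entry_le_norm. Qed.

Lemma consrV_normr s y : `|y| <= `|consrV s y|.
Proof.
by apply: norm_le_entries => // j; rewrite -(consrVS s y) entry_le_norm.
Qed.

Lemma cvg_consrV {T : Type} {F : set_system T} {FF : Filter F} (f : T -> R)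
    (g : T -> 'rV[R]_k) l m : f x @[x --> F] --> l -> g x @[x --> F] --> m ->
  consrV (f x) (g x) @[x --> F] --> consrV l m.
Proof.
move=> fl gm; apply: cvg_rV => j; case: (unliftP ord0 j) => [i|] ->.
  by rewrite consrVS; under eq_fun do rewrite consrVS; exact: cvg_entry.
by rewrite consrV0; under eq_fun do rewrite consrV0.
Qed.

Lemma cc_slice M (f : 'rV[R]_k.+1 -> R) s : cc M f -> cc M (fun y => f (consrV s y)).
Proof.
move=> [cf f0]; split=> [x|x xM]; last by apply: f0; exact: lt_le_trans (consrV_normr _ _).
apply: (@continuous_comp _ _ _ (consrV s) f); last exact: cf.
exact: (@cvg_consrV _ (nbhs x) _ (fun=> s) id s x (cvg_cst _) cvg_id).
Qed.

Lemma cc_partial (Lam : ('rV[R]_k -> R) -> R) M (f : 'rV[R]_k.+1 -> R) :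
  bounded_linear Lam -> cc M f -> cc M (fun s => Lam (fun y => f (consrV s y))).
Proof.
move=> hL [cf f0]; split.
  apply: (bl_continuous (M := M) hL).
    move=> p; apply: (@continuous_comp _ _ _ (fun p => consrV p.1 p.2) f); last exact: cf.
    exact: (@cvg_consrV _ (nbhs p) _ fst snd p.1 p.2 cvg_fst cvg_snd).
  by move=> s x xM; apply: f0; exact: lt_le_trans (consrV_normr _ _).
move=> s sM; rewrite -[RHS](bl0 hL); congr Lam; apply/funext => y.
by apply: f0; exact: lt_le_trans (consrV_norml _ _).
Qed.
End ConsNorm.

Section MultiInt.
Context {R : realType}.

Lemma rV_integralS k (f : 'rV[R]_k.+1 -> R) :
  rV_integral f = \int[lebesgue_measure]_s rV_integral (fun y => f (consrV s y)).
Proof. by []. Qed.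

Lemma rV_integral_bl k : bounded_linear (@rV_integral R k).
Proof.
elim: k => [|k IH].
  split=> // M; exists 1 => // f b _ fb; rewrite mul1r; exact: fb.
have [ID IZ IB] := IH; split.
- move=> M f g cf cg; rewrite !rV_integralS -(int1D (cc_partial IH cf) (cc_partial IH cg)).
  by apply: eq_Rintegral => s _; exact: (ID _ _ _ (cc_slice s cf) (cc_slice s cg)).
- move=> M a f cf; rewrite !rV_integralS -(int1Z _ (cc_partial IH cf)).
  by apply: eq_Rintegral => s _; exact: (IZ _ _ _ (cc_slice s cf)).
- move=> M; have [C C0 hC] := IB M.
  exists (2 * `|M| * C); first by rewrite mulr_ge0// mulr_ge0.
  move=> f b cf fb; rewrite rV_integralS -[leRHS]mulrA.
  apply: (@int1_bound _ `|M|) => //.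
    by apply: (cc_le (ler_norm M)); exact: cc_partial.
  by move=> s; apply: hC => //; exact: cc_slice.
Qed.

(** Induction on the dimension: the inner integrals converge pointwise and stay
bounded, so the one-dimensional theorem applies to them. *)
Lemma rV_integral_dominated k (M b : R) (f : nat -> 'rV[R]_k -> R) (g : 'rV[R]_k -> R) :
  (forall n, cc M (f n)) -> cc M g -> (forall n x, `|f n x| <= b) ->
  (forall x, f n x @[n --> \oo] --> g x) ->
  rV_integral (f n) @[n --> \oo] --> rV_integral g.
Proof.
elim: k f g => [|k IH] f g cf cg fb fg; first exact: fg.
have [_ _ /(_ M)[C C0 hC]] := rV_integral_bl k.
rewrite rV_integralS; under eq_fun do rewrite rV_integralS.
apply: (@int1_dominated _ M (C * b)).
- by move=> n; apply: cc_partial => //; exact: rV_integral_bl.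
- by apply: cc_partial => //; exact: rV_integral_bl.
- by move=> n s; apply: hC => //; exact: cc_slice.
- move=> s; apply: IH => //; first by move=> n; exact: cc_slice.
  exact: cc_slice.
Qed.

Lemma rV_integral_shift k (M : R) (d : 'rV[R]_k) (f : 'rV[R]_k -> R) : 0 <= M ->
  cc M f -> rV_integral (fun x => f (x + d)) = rV_integral f.
Proof.
move=> M0; elim: k d f => [|k IH] d f cf; first by rewrite /= (thinmx0 (0 + d)).
rewrite !rV_integralS (consrV_eta d); set t := d 0 ord0; set u := tailrV d.
have cp := cc_partial (rV_integral_bl k) cf.
rewrite -(int1_affine t M0 cp ltr01) mul1r; apply: eq_Rintegral => s _.
under eq_fun do rewrite consrVD.
by rewrite (IH u (fun y => f (consrV (s + t) y)) (cc_slice _ cf)) mul1r.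
Qed.


End MultiInt.

(** * Exchanging integrals and bounded functionals *)

Section Fubini.
Context {R : realType}.

Lemma uniform_cont1 k (M e : R) (f : R -> 'rV[R]_k -> R) : 0 <= M -> 0 < e ->
  continuous (fun p : R * 'rV[R]_k => f p.1 p.2) ->
  (forall s y, M < `|s| -> f s y = 0) -> (forall s y, M < `|y| -> f s y = 0) ->
  exists2 N, (0 < N)%N & forall s s' y, `|s - s'| <= 2 * M / N%:R -> `|f s y - f s' y| <= e.
Proof.
move=> M0 e0 cf fs fy.
have lim : (2 * M / N%:R) @[N --> \oo] --> (0 : R).
  rewrite -[0](mulr0 (2 * M)); apply: cvgM; first exact: cvg_cst.
  apply/gtr0_cvgV0; last exact: cvgr_idn.
  by exists 1%N => // n /= n1; rewrite ltr0n.
pose K : set (R * 'rV[R]_k) := `[- (M + 1), M + 1]%classic `*` [set y | `|y| <= M].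
have cK : compact K by apply: compact_setX; [exact: segment_compact|exact: compact_norm_le].
have := cK; rewrite compact_near_coveringP.
move/(_ nat \oo (fun N p => forall s', `|p.1 - s'| <= 2 * M / N%:R ->
   `|f p.1 p.2 - f s' p.2| <= e) _) => H.
have {}H : \forall N \near \oo, K `<=` (fun p => forall s', `|p.1 - s'| <= 2 * M / N%:R ->
   `|f p.1 p.2 - f s' p.2| <= e).
  apply: H => -[s0 y0] _.
  have e2 : 0 < e / 2 by rewrite divr_gt0.
  have /cvgrPdist_le/(_ _ e2) := cf (s0, y0).
  move=> [[A B]/= [/nbhs_ballP[d /= d0 hA] hB] AB].
  have d2 : 0 < d / 2 by rewrite divr_gt0.
  have /cvgrPdist_lt/(_ _ d2) := lim => hN.
  exists (ball s0 (d / 2) `*` B, [set N | `|0 - 2 * M / N%:R| < d / 2]).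
    split => //=; exists (ball s0 (d / 2), B) => //=; split => //.
    exact: nbhsx_ballx.
  move=> [[s y] N]/= [[sd By] Nd] s' ss'.
  have As : A s by apply: hA; move: sd; rewrite /ball/= => h; lra.
  have As' : A s'.
    have hN0 : 0 <= 2 * M / N%:R by rewrite divr_ge0// mulr_ge0.
    apply: hA; move: sd Nd; rewrite /ball/= sub0r normrN (ger0_norm hN0) => h h'.
    have -> : s0 - s' = (s0 - s) + (s - s') by ring.
    by rewrite (le_lt_trans (ler_normD _ _))//; lra.
  have h1 := AB (s, y) (conj As By); have h2 := AB (s', y) (conj As' By).
  rewrite /= in h1 h2.
  have -> : f s y - f s' y = (f s0 y0 - f s' y) - (f s0 y0 - f s y) by ring.
  by apply: (le_trans (ler_normB _ _)); rewrite [leRHS](splitr e) lerD.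
have /cvgrPdist_lt/(_ _ ltr01) hN1 := lim.
have [N [[N0 NK] N1]] : exists N, ((0 < N)%N /\ K `<=` (fun p => forall s', `|p.1 - s'| <= 2 * M / N%:R ->
   `|f p.1 p.2 - f s' p.2| <= e)) /\ `|0 - 2 * M / N%:R| < 1.
  apply: (@filter_ex _ \oo); apply: filterI => //; apply: filterI => //.
  by exists 1%N.
exists N => // s s' y ss'.
case: (leP `|y| M) => yM; last by rewrite !fy// subrr normr0 ltW.
case: (leP `|s| (M + 1)) => sM.
  by apply: (NK (s, y)) => //=; split => //=; rewrite in_itv/= -ler_norml.
rewrite !fs ?subrr ?normr0 ?(ltW e0)//; last lra.
move: N1; rewrite sub0r normrN ger0_norm ?divr_ge0// ?mulr_ge0// => N1.
have := ler_normD (s - s') s'; rewrite subrK; lra.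
Qed.

Lemma rV_integral1 (f : 'rV[R]_1 -> R) :
  rV_integral f = \int[lebesgue_measure]_s f (consrV s 0).
Proof. by []. Qed.

(** Replace the integral by a Riemann sum, which commutes with Lam by linearity;
the error is small uniformly in y, hence remains small after applying Lam. *)
Lemma fubini1 k (Lam : ('rV[R]_k -> R) -> R) (M : R) (f : R -> 'rV[R]_k -> R) : 0 <= M ->
  bounded_linear Lam ->
  continuous (fun p : R * 'rV[R]_k => f p.1 p.2) ->
  (forall s y, M < `|s| -> f s y = 0) -> (forall s y, M < `|y| -> f s y = 0) ->
  Lam (fun y => \int[lebesgue_measure]_s f s y) = \int[lebesgue_measure]_s Lam (f s).
Proof.
move=> M0 hL cf fs fy.
have [_ LZ /(_ M)[C C0 LC]] := hL.
have cfs s : cc M (f s).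
  split; last by move=> y; exact: fy.
  by move=> y; apply: (@continuous2_cvg _ R _ _ (nbhs y) _ (fun=> s) id f s y (cf (s, y))); [exact: cvg_cst|exact: cvg_id].
have cfy y : cc M (f ^~ y).
  split; last by move=> s; exact: fs.
  by move=> s; apply: (@continuous2_cvg _ R _ _ (nbhs s) _ id (fun=> y) f s y (cf (s, y))); [exact: cvg_id|exact: cvg_cst].
have cJ : cc M (fun s => Lam (f s)).
  split; first exact: (bl_continuous hL cf fy).
  by move=> s sM; rewrite -[RHS](bl0 hL); congr Lam; apply/funext => y; exact: fs.
have cI : cc M (fun y => \int[lebesgue_measure]_s f s y).
  split; last first.
    move=> y yM; rewrite -[RHS](@bl0 _ _ _ (rV_integral_bl 1)).
    by rewrite rV_integral1; apply: eq_Rintegral => s _; exact: fy.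
  have -> : (fun y => \int[lebesgue_measure]_s f s y) =
      (fun y => rV_integral (fun x : 'rV[R]_1 => f (x 0 ord0) y)).
    by apply/funext => y; rewrite rV_integral1; apply: eq_Rintegral => s _; rewrite consrV0.
  apply: (bl_continuous (M := M) (rV_integral_bl 1)) => /=.
    move=> p; apply: (@continuous2_cvg _ R _ _ (nbhs p) _ (fun p => p.2 0 ord0) fst f _ _ (cf (p.2 0 ord0, p.1))).
      by apply: cvg_entry; exact: cvg_snd.
    exact: cvg_fst.
  move=> y x xM; apply: fs; apply: lt_le_trans xM _.
  by apply: norm_le_entries => // j; rewrite ord1.
apply/eqP; rewrite -subr_eq0 -normr_le0; apply/ler_addgt0Pl => e e0; rewrite addr0.
(* each of the two Riemann sum errors is 2 M C e' *)
pose e' := e / (4 * M * C + 1).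
have den : 0 < 4 * M * C + 1 by rewrite ltr_wpDl// !mulr_ge0.
have e'0 : 0 < e' by rewrite divr_gt0.
have [N N0 hN] := uniform_cont1 M0 e'0 cf fs fy.
pose h := 2 * M / N%:R; pose t (i : 'I_N) := - M + i%:R * h.
have cS : cc M (fun y => \sum_(i < N) h * f (t i) y).
  by apply: cc_sum => i; apply: ccZ; exact: cfs.
have LS : Lam (fun y => \sum_(i < N) h * f (t i) y) = \sum_(i < N) h * Lam (f (t i)).
  rewrite (bl_sum hL _ (M := M)); last by move=> i; apply: ccZ; exact: cfs.
  by apply: eq_bigr => i _; apply: LZ; exact: cfs.
have h1 : `|Lam (fun y => \int[lebesgue_measure]_s f s y) - \sum_(i < N) h * Lam (f (t i))|
    <= C * (2 * M * e').
  rewrite -LS -(blB hL cI cS); apply: LC; first exact: ccB.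
  move=> y; apply: (int1_riemann N0 M0 (cfy y)) => s s' ss'; exact: hN.
have h2 : `|\int[lebesgue_measure]_s Lam (f s) - \sum_(i < N) h * Lam (f (t i))|
    <= 2 * M * (C * e').
  apply: (int1_riemann N0 M0 cJ) => s s' ss'.
  rewrite -(blB hL (cfs _) (cfs _)); apply: LC; first exact: ccB.
  by move=> y; exact: hN.
have -> : Lam (fun y => \int[lebesgue_measure]_s f s y) - \int[lebesgue_measure]_s Lam (f s) =
  (Lam (fun y => \int[lebesgue_measure]_s f s y) - \sum_(i < N) h * Lam (f (t i))) -
  (\int[lebesgue_measure]_s Lam (f s) - \sum_(i < N) h * Lam (f (t i))) by ring.
apply: (le_trans (ler_normB _ _)); apply: (le_trans (lerD h1 h2)).
have -> : C * (2 * M * e') + 2 * M * (C * e') = (4 * M * C) * e' by ring.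
by rewrite /e' mulrCA ger_pMr// ler_pdivrMr// mul1r lerDl.
Qed.

Lemma fubini j k (Lam : ('rV[R]_k -> R) -> R) (M : R) (f : 'rV[R]_j -> 'rV[R]_k -> R) :
  0 <= M -> bounded_linear Lam ->
  continuous (fun p : 'rV[R]_j * 'rV[R]_k => f p.1 p.2) ->
  (forall x y, M < `|x| -> f x y = 0) -> (forall x y, M < `|y| -> f x y = 0) ->
  Lam (fun y => rV_integral (f ^~ y)) = rV_integral (fun x => Lam (f x)).
Proof.
move=> M0 hL; elim: j f => [|j IH] f cf fx fy //.
rewrite rV_integralS.
pose g (s : R) (y : 'rV[R]_k) := rV_integral (fun x => f (consrV s x) y).
have cg : continuous (fun p : R * 'rV[R]_k => g p.1 p.2).
  apply: (bl_continuous (T := (R * 'rV[R]_k)%type) (M := M) (rV_integral_bl j)).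
    move=> p; apply: (@continuous2_cvg _ _ _ _ (nbhs p) _ (fun p => consrV p.1.1 p.2) (fun p => p.1.2) f _ _ (cf (consrV p.1.1 p.2, p.1.2))).
      apply: cvg_consrV; last exact: cvg_snd.
      by apply: (@cvg_comp _ _ _ fst fst); exact: cvg_fst.
    by apply: (@cvg_comp _ _ _ fst snd); [exact: cvg_fst|exact: cvg_snd].
  by move=> p x xM; apply: fx; apply: lt_le_trans xM (consrV_normr _ _).
have -> : (fun y => rV_integral (f^~ y)) = (fun y => \int[lebesgue_measure]_s g s y).
  by apply/funext => y; rewrite rV_integralS.
rewrite (fubini1 M0 hL cg); first last.
- move=> s y yM; rewrite /g -[RHS](bl0 (rV_integral_bl j)); congr rV_integral.
  by apply/funext => x; exact: fy.
- move=> s y sM; rewrite /g -[RHS](bl0 (rV_integral_bl j)); congr rV_integral.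
  by apply/funext => x; apply: fx; apply: lt_le_trans sM (consrV_norml _ _).
apply: eq_Rintegral => s _; apply: (IH (fun x => f (consrV s x))) => /=.
- move=> p; apply: (@continuous2_cvg _ _ _ _ (nbhs p) _ (fun p => consrV s p.1) snd f _ _ (cf (consrV s p.1, p.2))).
    by apply: cvg_consrV; [exact: cvg_cst|exact: cvg_fst].
  exact: cvg_snd.
- by move=> x y xM; apply: fx; apply: lt_le_trans xM (consrV_normr _ _).
- by move=> x y; exact: fy.
Qed.
End Fubini.

(** * Uniqueness of translation-invariant functionals *)

Lemma cvg_sumr {R : realType} {T : Type} {F : set_system T} {FF : Filter F} {I : Type}
    (r : seq I) (f : I -> T -> R) (l : I -> R) :
  (forall i, f i x @[x --> F] --> l i) ->
  \sum_(i <- r) f i x @[x --> F] --> \sum_(i <- r) l i.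
Proof.
move=> h; elim: r => [|i r IH].
  by rewrite big_nil; under eq_fun do rewrite big_nil; exact: cvg_cst.
by rewrite big_cons; under eq_fun do rewrite big_cons; apply: cvgD.
Qed.

Lemma cvg_prodr {R : realType} {T : Type} {F : set_system T} {FF : Filter F} {I : Type}
    (r : seq I) (f : I -> T -> R) (l : I -> R) :
  (forall i, f i x @[x --> F] --> l i) ->
  \prod_(i <- r) f i x @[x --> F] --> \prod_(i <- r) l i.
Proof.
move=> h; elim: r => [|i r IH].
  by rewrite big_nil; under eq_fun do rewrite big_nil; exact: cvg_cst.
by rewrite big_cons; under eq_fun do rewrite big_cons; apply: cvgM.
Qed.

Lemma cvg_mulmx {R : realType} {T : Type} {F : set_system T} {FF : Filter F} j k
    (f : T -> 'rV[R]_j) (l : 'rV[R]_j) (A : 'M[R]_(j, k)) :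
  f x @[x --> F] --> l -> f x *m A @[x --> F] --> l *m A.
Proof.
move=> h; apply: cvg_rV => i; rewrite mxE; under eq_fun do rewrite mxE.
by apply: cvg_sumr => a; apply: cvgM; [exact: cvg_entry|exact: cvg_cst].
Qed.

Lemma mulmx_bound {R : realType} j k (A : 'M[R]_(j, k)) :
  exists2 C, 0 <= C & forall x : 'rV[R]_j, `|x *m A| <= C * `|x|.
Proof.
exists (\sum_i \sum_j `|A i j|); first by do 2 (apply: sumr_ge0 => ? _).
move=> x; apply: norm_le_entries; first by rewrite mulr_ge0// sumr_ge0// => i _; exact: sumr_ge0.
move=> b; rewrite mxE (le_trans (ler_norm_sum _ _ _))// mulr_suml ler_sum// => i _.
rewrite normrM mulrC ler_pM ?entry_le_norm//.
by rewrite (bigD1 b)//= lerDl sumr_ge0.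
Qed.

Section Haar.
Context {R : realType}.

(** The classical proof of the uniqueness of Haar measure: both sides are the
double functional of f (u + v) g v, once evaluated directly and once after the
translation of v by - u. *)
Lemma translation_invariant_unique k (Lam : ('rV[R]_k -> R) -> R) (M : R) (f g : 'rV[R]_k -> R) :
  0 <= M -> bounded_linear Lam ->
  (forall M f d, 0 <= M -> cc M f -> Lam (fun x => f (x + d)) = Lam f) ->
  cc M f -> cc M g ->
  Lam f * rV_integral g = rV_integral f * Lam (fun x => g (- x)).
Proof.
move=> M0 hL tL cf cg; have [_ LZ _] := hL.
have M20 : 0 <= 2 * M by rewrite mulr_ge0.
have IZ : forall M a h, cc M h -> rV_integral (fun x : 'rV[R]_k => a * h x) = a * rV_integral h.
  by have [] := rV_integral_bl (R := R) k.
have cgN : cc M (fun x => g (- x)).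
  split; last by move=> x xM; apply: cg.2; rewrite normrN.
  move=> x; apply: (@continuous_cvg _ _ _ (nbhs x) _ (fun x => - x) g); first exact: cg.1.
  by apply: cvgN; exact: cvg_id.
have F1 := @fubini _ _ _ Lam (2 * M) (fun v u => f (u + v) * g v) M20 hL.
have F2 := @fubini _ _ _ Lam (2 * M) (fun v u => f v * g (v - u)) M20 hL.
have E1 : rV_integral (fun v => Lam (fun u => f (u + v) * g v)) = Lam f * rV_integral g.
  rewrite -(IZ _ _ _ cg); congr rV_integral; apply/funext => v.
  under eq_fun do rewrite mulrC.
  have cfv : cc (M + `|v|) (fun u => f (u + v)).
    split.
      move=> x; apply: (@continuous_cvg _ _ _ (nbhs x) _ (fun u => u + v) f); first exact: cf.1.
      by apply: cvgD; [exact: cvg_id|exact: cvg_cst].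
    move=> x xM; apply: cf.2; have := ler_normB (x + v) v; rewrite addrK; lra.
  by rewrite (LZ _ _ _ cfv) (tL M)// mulrC.
have E2 : rV_integral (fun v => Lam (fun u => f v * g (v - u))) = rV_integral f * Lam (fun x => g (- x)).
  rewrite mulrC -(IZ _ _ _ cf); congr rV_integral; apply/funext => v.
  have cgv : cc (M + `|v|) (fun u => g (v - u)).
    split.
      move=> x; apply: (@continuous_cvg _ _ _ (nbhs x) _ (fun u => v - u) g); first exact: cg.1.
      by apply: cvgB; [exact: cvg_cst|exact: cvg_id].
    move=> x xM; apply: cg.2; have := ler_normB v (v - x); rewrite subKr; lra.
  rewrite (LZ _ _ _ cgv) mulrC; congr (_ * _).
  rewrite -(tL M (fun x => g (- x)) (- v))//; congr Lam; apply/funext => x.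
  by rewrite opprB.
rewrite -E1 -F1; last 3 first.
- move=> p; apply: cvgM.
    apply: (@continuous_cvg _ _ _ (nbhs p) _ (fun p => p.2 + p.1)); first exact: cf.1.
    by apply: cvgD; [exact: cvg_snd|exact: cvg_fst].
  by apply: (@continuous_cvg _ _ _ (nbhs p) _ fst); [exact: cg.1|exact: cvg_fst].
- by move=> x y xM; rewrite (cg.2 x) ?mulr0//; have := normr_ge0 x; lra.
- move=> x y yM; case: (leP `|x| M) => xM; last by rewrite (cg.2 x) ?mulr0.
  by rewrite cf.2 ?mul0r//; have := ler_normB (y + x) x; rewrite addrK; lra.
rewrite -E2 -F2; last 3 first.
- move=> p; apply: cvgM.
    by apply: (@continuous_cvg _ _ _ (nbhs p) _ fst); [exact: cf.1|exact: cvg_fst].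
  apply: (@continuous_cvg _ _ _ (nbhs p) _ (fun p => p.1 - p.2)); first exact: cg.1.
  by apply: cvgB; [exact: cvg_fst|exact: cvg_snd].
- by move=> x y xM; rewrite (cf.2 x) ?mul0r//; have := normr_ge0 x; lra.
- move=> x y yM; case: (leP `|x| M) => xM; last by rewrite (cf.2 x) ?mul0r.
  by rewrite cg.2 ?mulr0//; have := ler_normB x (x - y); rewrite subKr; lra.
congr Lam; apply/funext => u.
have cF : cc M (fun v => f (u + v) * g v).
  apply: ccM => // x; apply: (@continuous_cvg _ _ _ (nbhs x) _ (fun v => u + v) f); first exact: cf.1.
  by apply: cvgD; [exact: cvg_cst|exact: cvg_id].
rewrite -(rV_integral_shift (- u) M0 cF); congr rV_integral; apply/funext => v.
by rewrite addrC subrK.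
Qed.

(** Products of this function over the coordinates give bumps that are even and
invariant under permutations of the coordinates. *)
Definition hat (s : R) : R := Num.max 0 (1 - `|s|).

Lemma hat_continuous : continuous hat.
Proof.
have -> : hat = fun s => (`|1 - `|s| | + (1 - `|s|)) / 2.
  apply/funext => s; rewrite /hat; case: leP => h; first by rewrite (ger0_norm h); field.
  by rewrite (ltr0_norm h); field.
move=> s; apply: cvgM; last exact: cvg_cst.
have c1 : 1 - `|t| @[t --> s] --> 1 - `|s|.
  by apply: cvgB; [exact: cvg_cst|exact: norm_continuous].
by apply: cvgD => //; exact: cvg_norm.
Qed.

Lemma cc_hat : cc 1 hat.
Proof.
split; first exact: hat_continuous.
by move=> s s1; rewrite /hat max_l// subr_le0 ltW.
Qed.

Lemma hat_ge0 s : 0 <= hat s. Proof. by rewrite /hat le_max lexx. Qed.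
Lemma hat_le1 s : hat s <= 1.
Proof. by rewrite /hat ge_max ler01 /= gerBl. Qed.

Lemma int_hat_gt0 : 0 < \int[lebesgue_measure]_s hat s.
Proof.
have -> : \int[lebesgue_measure]_s hat s = \int[lebesgue_measure]_(s in `[-1, 1]) hat s.
  exact: (int1_itv cc_hat).
have ih : lebesgue_measure.-integrable `[-1, 1] (EFin \o hat).
  by apply: integrableS (cc_integrable cc_hat).
have step (a b c : R) : -1 <= a -> a <= b -> b <= 1 -> 0 <= c ->
    (forall s, a <= s <= b -> c <= hat s) -> c * (b - a) <= \int[lebesgue_measure]_(s in `[-1, 1]) hat s.
  move=> a1 ab b1 c0 ch.
  have -> : c * (b - a) = \int[lebesgue_measure]_(s in `[a, b]) c.
    rewrite Rintegral_cst//= lebesgue_measure_itv/= lte_fin.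
    case: ifPn => // ; rewrite -leNgt => ba; have -> : a = b by lra.
    by rewrite subrr.
  have sub : `[a, b]%classic `<=` `[-1, 1]%classic.
    by apply: subset_itv; rewrite bnd_simp.
  have ic : lebesgue_measure.-integrable `[a, b] (EFin \o cst c).
    apply: continuous_compact_integrable; first exact: segment_compact.
    by move=> ?; exact: cst_continuous.
  apply: (@le_trans _ _ (\int[lebesgue_measure]_(s in `[a, b]) hat s)).
    by apply: le_Rintegral => //; exact: integrableS ih.
  rewrite /Rintegral; apply: fine_le.
    by apply: integrable_fin_num => //; exact: integrableS ih.
    exact: integrable_fin_num ih.
  apply: ge0_subset_integral => //.
    exact: (measurable_int _ ih).
  by move=> x _; rewrite lee_fin hat_ge0.
apply: (@lt_le_trans _ _ ((2^-1 : R) * (2^-1 - - 2^-1))); first lra.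
apply: step => [||||s sh]; [lra|lra|lra|lra|].
have : `|s| <= 2^-1 by rewrite ler_norml.
by rewrite /hat le_max => hs; apply/orP; right; lra.
Qed.

Definition bump k (x : 'rV[R]_k) : R := \prod_j hat (x 0 j).

Lemma bump_ge0 k (x : 'rV[R]_k) : 0 <= bump x.
Proof. by apply: prodr_ge0 => j _; exact: hat_ge0. Qed.

Lemma bump_le1 k (x : 'rV[R]_k) : bump x <= 1.
Proof.
rewrite /bump -[leRHS](big1_eq (op := *%R) (index_enum 'I_k) xpredT).
by apply: ler_prod => j _; rewrite hat_ge0 hat_le1.
Qed.

Lemma cc_bump k : cc 1 (@bump k).
Proof.
split.
  move=> x; apply: (@cvg_prodr _ _ (nbhs x)) => j.
  apply: (@continuous_cvg _ _ _ (nbhs x) _ (fun x => x 0 j) hat); first exact: hat_continuous.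
  by apply: cvg_entry; exact: cvg_id.
move=> x; apply: contra_ltP => h; apply: norm_le_entries => // j.
rewrite leNgt; apply/negP => jx.
by move: h; rewrite /bump (bigD1 j)//= (cc_hat.2 _ jx) mul0r.
Qed.

Lemma bumpN k (x : 'rV[R]_k) : bump (- x) = bump x.
Proof. by apply: eq_bigr => j _; rewrite mxE /hat normrN. Qed.

Lemma int_bump_gt0 k : 0 < rV_integral (@bump k).
Proof.
elim: k => [|k IH]; first by rewrite /= /bump big_ord0.
rewrite rV_integralS.
have -> : \int[lebesgue_measure]_s rV_integral (fun y : 'rV[R]_k => bump (consrV s y)) =
   \int[lebesgue_measure]_s (rV_integral (@bump k) * hat s).
  apply: eq_Rintegral => s _; rewrite mulrC.
  have [_ IZ _] := rV_integral_bl (R := R) k.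
  rewrite -(IZ _ _ _ (cc_bump k)); congr rV_integral; apply/funext => y.
  rewrite /bump big_ord_recl consrV0; congr (_ * _); apply: eq_bigr => j _.
  by rewrite consrVS.
by rewrite (int1Z _ cc_hat) mulr_gt0// int_hat_gt0.
Qed.
End Haar.

(** * Linear changes of variables *)

Section Linear.
Context {R : realType}.

Definition scales_volume k (A : 'M[R]_k) : Prop := forall (M : R) f, 0 <= M -> cc M f ->
  `|\det A| * rV_integral (fun x => f (x *m A)) = rV_integral f.

Lemma cc_mulmx k (A : 'M[R]_k) M (f : 'rV[R]_k -> R) : A \in unitmx -> 0 <= M ->
  cc M f -> exists2 M', 0 <= M' & cc M' (fun x => f (x *m A)).
Proof.
move=> uA M0 [cf f0]; have [C C0 hC] := mulmx_bound (invmx A).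
exists (C * M); first exact: mulr_ge0.
split=> [x|x xM].
  apply: (@continuous_cvg _ _ _ (nbhs x) _ (fun x => x *m A) f); first exact: cf.
  by apply: cvg_mulmx; exact: cvg_id.
apply: f0; rewrite ltNge; apply/negP => xAM.
have := hC (x *m A); rewrite mulmxK//; apply/negP; rewrite -ltNge.
by apply: le_lt_trans xM; rewrite ler_wpM2l.
Qed.

Lemma scales_volumeM k (A B : 'M[R]_k) : B \in unitmx ->
  scales_volume A -> scales_volume B -> scales_volume (A *m B).
Proof.
move=> uB sA sB M f M0 cf; have [M' M'0 cfB] := cc_mulmx uB M0 cf.
rewrite det_mulmx normrM (mulrC `|\det A|) -mulrA.
under eq_fun do rewrite mulmxA.
by rewrite -(sB M f)//; congr (_ * _); exact: (sA M').
Qed.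

(** The functional f |-> int f (x P) is translation invariant, hence a multiple of
the integral; the even, permutation-invariant bump shows that the factor is 1. *)
Lemma scales_volume_perm k (s : 'S_k) : scales_volume (perm_mx s : 'M[R]_k).
Proof.
move=> M f M0 cf; rewrite det_perm normrX normrN1 expr1n mul1r.
have us : (perm_mx s : 'M[R]_k) \in unitmx by exact: unitmx_perm.
pose Lam (g : 'rV[R]_k -> R) := rV_integral (fun x => g (x *m perm_mx s)).
have [ID IZ IB] := rV_integral_bl (R := R) k.
have norm_perm (x : 'rV[R]_k) : `|x| <= `|x *m perm_mx s|.
  apply: norm_le_entries => // j.
  have -> : x 0 j = (x *m perm_mx s) 0 (s j).
    by rewrite -[s in perm_mx s]invgK -col_permE mxE permK.
  exact: entry_le_norm.
have cs (N : R) (g : 'rV[R]_k -> R) : cc N g -> cc N (fun x => g (x *m perm_mx s)).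
  move=> [cg g0]; split=> [x|x xM].
    apply: (@continuous_cvg _ _ _ (nbhs x) _ (fun x => x *m perm_mx s) g); first exact: cg.
    by apply: cvg_mulmx; exact: cvg_id.
  by apply: g0; exact: lt_le_trans (norm_perm x).
have hL : bounded_linear Lam.
  split=> [N g h cg ch|N a g cg|N].
  - exact: (ID _ _ _ (cs _ _ cg) (cs _ _ ch)).
  - exact: (IZ _ _ _ (cs _ _ cg)).
  - have [C C0 hC] := IB N; exists C => // g b cg gb.
    by apply: hC => //; exact: cs.
have tL (N : R) (g : 'rV[R]_k -> R) d : 0 <= N -> cc N g -> Lam (fun x => g (x + d)) = Lam g.
  move=> N0 cg; rewrite /Lam -(rV_integral_shift (d *m invmx (perm_mx s)) N0 (cs _ _ cg)).
  by congr rV_integral; apply/funext => x; rewrite mulmxDl mulmxKV.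
pose M1 := Num.max M 1.
have cf1 : cc M1 f by apply: cc_le cf; rewrite le_max lexx.
have cb1 : cc M1 (@bump R k) by apply: cc_le (cc_bump k); rewrite le_max lexx orbT.
have M10 : 0 <= M1 by rewrite le_max M0.
have := translation_invariant_unique M10 hL tL cf1 cb1.
have -> : Lam (fun x => bump (- x)) = rV_integral (@bump R k).
  congr rV_integral; apply/funext => x; rewrite bumpN /bump.
  rewrite (reindex_inj (@perm_inj _ s))/=; apply: eq_bigr => j _.
  by rewrite -[s in perm_mx s]invgK -col_permE mxE permK.
by move/mulIf; apply; rewrite gt_eqF// int_bump_gt0.
Qed.

Lemma rV_integral_scale1 k M (a : R) (f : 'rV[R]_k.+1 -> R) : a != 0 -> 0 <= M -> cc M f ->
  `|a| * \int[lebesgue_measure]_s rV_integral (fun y => f (consrV (s * a) y)) = rV_integral f.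
Proof.
move=> a0 M0 cf.
have cG := cc_partial (rV_integral_bl k) cf.
have p0 : 0 < `|a| by rewrite normr_gt0.
rewrite [RHS]rV_integralS.
have [ap|an] := ltP 0 a.
  rewrite -[RHS](int1_affine 0 M0 cG p0); congr (_ * _); apply: eq_Rintegral => s _.
  by rewrite gtr0_norm// addr0 mulrC.
have cGN := cG.
rewrite -[RHS](int1N M0 cG).
have cGn : cc M (fun s => rV_integral (fun y => f (consrV (- s) y))).
  split; last by move=> s sM; apply: cG.2; rewrite normrN.
  move=> s; apply: (@continuous_cvg _ _ _ (nbhs s) _ (fun x => - x)
    (fun s => rV_integral (fun y => f (consrV s y)))); first exact: cG.1.
  by apply: cvgN; exact: cvg_id.
rewrite -[RHS](int1_affine 0 M0 cGn p0); congr (_ * _); apply: eq_Rintegral => s _.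
by rewrite ler0_norm// addr0 mulNr opprK mulrC.
Qed.

(** Induction on the dimension: the first coordinate is rescaled by the first
diagonal entry, and for a fixed first coordinate the others undergo the smaller
triangular matrix followed by a translation. *)
Lemma scales_volume_upper k (A : 'M[R]_k) : (forall i j : 'I_k, (j < i)%N -> A i j = 0) ->
  (forall i, A i i != 0) -> scales_volume A.
Proof.
move=> Au Ad M f M0 cf.
have -> : \det A = \prod_i A i i.
  rewrite -det_tr det_trig; last by apply/is_trig_mxP => i j ij; rewrite mxE Au.
  by apply: eq_bigr => i _; rewrite mxE.
elim: k A Au Ad M f M0 cf => [|k IH] A Au Ad M f M0 cf.
  by rewrite big_ord0 normr1 mul1r /= (thinmx0 (0 *m A)).
pose a := A ord0 ord0; pose A' := \matrix_(i < k, j < k) A (lift ord0 i) (lift ord0 j).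
pose u := \row_(j < k) A ord0 (lift ord0 j).
have E s y : consrV s y *m A = consrV (s * a) (y *m A' + s *: u).
  apply/rowP => j; rewrite mxE big_ord_recl consrV0.
  case: (unliftP ord0 j) => [i|] ->.
    rewrite consrVS !mxE addrC; congr (_ + _).
    by apply: eq_bigr => b _; rewrite consrVS !mxE.
  rewrite consrV0 big1 ?addr0// => b _.
  by rewrite Au ?mulr0.
rewrite big_ord_recl normrM rV_integralS.
rewrite -(rV_integral_scale1 (Ad ord0) M0 cf) -mulrA; congr (_ * _).
set P := \prod_(i < k) _.
have PE : P = \prod_i A' i i by apply: eq_bigr => i _; rewrite mxE.
have cp := cc_partial (rV_integral_bl k) cf.
have A'u (i j : 'I_k) : (j < i)%N -> A' i j = 0 by move=> ij; rewrite mxE Au.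
have A'd i : A' i i != 0 by rewrite mxE Ad.
have inner s : `|P| * rV_integral (fun y => f (consrV s y *m A)) =
   rV_integral (fun y => f (consrV (s * a) y)).
  have cs := cc_slice (s * a) cf.
  pose F y := f (consrV (s * a) (y + s *: u)).
  have cF : cc (M + `|s *: u|) F.
    split=> [y|y yM].
      apply: (@continuous_cvg _ _ _ (nbhs y) _ (fun y => y + s *: u) (fun y => f (consrV (s * a) y))); first exact: cs.1.
      by apply: cvgD; [exact: cvg_id|exact: cvg_cst].
    apply: (cs.2 (y + s *: u)); have := ler_normB (y + s *: u) (s *: u); rewrite addrK; lra.
  under eq_fun do rewrite E.
  by rewrite PE (IH A' A'u A'd _ F _ cF) ?addr_ge0// (rV_integral_shift _ M0 cs).
have cP : exists2 M', 0 <= M' & cc M' (fun s => rV_integral (fun y => f (consrV s y *m A))).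
  have uA : A \in unitmx.
    rewrite unitmxE unitfE -det_tr det_trig; last by apply/is_trig_mxP => i j ij; rewrite mxE Au.
    by apply/prodf_neq0 => i _; rewrite mxE Ad.
  have [M' M'0 cfA] := cc_mulmx uA M0 cf; exists M' => //.
  exact: (cc_partial (rV_integral_bl k) cfA).
have [M' M'0 cfA] := cP.
rewrite -(int1Z _ cfA); apply: eq_Rintegral => s _.
exact: inner.
Qed.

(** By the LUP decomposition every invertible matrix is a product of
permutations and of invertible triangular matrices. *)
Lemma linear_change_of_variables k (A : 'M[R]_k) : A \in unitmx -> scales_volume A.
Proof.
case: k A => [|k] A uA.
  by move=> M f M0 cf; rewrite det_mx00 normr1 mul1r /= (thinmx0 (0 *m A)).
have := cormen_lup_correct A; have := cormen_lup_perm A; have := cormen_lup_detL A.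
have := @cormen_lup_lower _ _ A; have := @cormen_lup_upper _ _ A.
case: (cormen_lup A) => [[P L] U]/= Uu Ll detL /is_perm_mxP[s ->] PLU.
have uL : L \in unitmx by rewrite unitmxE detL unitr1.
have uP t : (perm_mx t : 'M[R]_k.+1) \in unitmx by exact: unitmx_perm.
have uU : U \in unitmx.
  have : perm_mx s *m A \in unitmx by rewrite unitmx_mul uP.
  by rewrite (PLU : _ *m _ = _ *m _) unitmx_mul => /andP[].
have -> : A = perm_mx s^-1 *m (L *m U).
  by rewrite -(PLU : _ *m _ = _ *m _) mulmxA -perm_mxM mulVg perm_mx1 mul1mx.
have detU : \det U = \prod_i U i i.
  rewrite -det_tr det_trig; last by apply/is_trig_mxP => i j ij; rewrite mxE Uu.
  by apply: eq_bigr => i _; rewrite mxE.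
apply: scales_volumeM; [by rewrite unitmx_mul uL|exact: scales_volume_perm|].
apply: scales_volumeM => //; last first.
  apply: scales_volume_upper => // i; apply/negP => /eqP Ui.
  by move: uU; rewrite unitmxE detU (bigD1 i)//= Ui mul0r unitr0.
(* reversing the order of the basis turns the lower factor into an upper one *)
pose w : 'S_k.+1 := perm (@rev_ord_inj k.+1).
have ww : (w * w)%g = 1%g.
  by apply/permP => i; rewrite permM !permE rev_ordK.
have wV : w^-1%g = w by apply: (mulgI w); rewrite mulgV ww.
pose W : 'M[R]_k.+1 := perm_mx w.
have WW : W *m W = 1%:M by rewrite -perm_mxM ww perm_mx1.
pose L' := W *m L *m W.
have L'E i j : L' i j = L (rev_ord i) (rev_ord j).
  by rewrite /L' /W -{2}wV -col_permE -row_permE !mxE !permE.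
have -> : L = W *m (L' *m W).
  by rewrite /L' -!mulmxA WW mulmx1 mulmxA WW mul1mx.
have uW : W \in unitmx by exact: unitmx_perm.
have uL' : L' \in unitmx by rewrite !unitmx_mul uW uL.
apply: scales_volumeM; [by rewrite unitmx_mul uL'|exact: scales_volume_perm|].
apply: scales_volumeM => //; last exact: scales_volume_perm.
apply: scales_volume_upper => [i j ji|i]; last by rewrite L'E Ll// eqxx oner_neq0.
have rr : (rev_ord i < rev_ord j)%N by apply: ltn_sub2l; [exact: leq_ltn_trans ji (ltn_ord i)|].
by rewrite L'E Ll ?(ltnW rr)// -val_eqE/= ltn_eqF.
Qed.
End Linear.

(** * Integration by parts *)

Section IntegrationByParts.
Context {R : realType}.

Lemma cc_bounded k (M : R) (f : 'rV[R]_k -> R) : cc M f ->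
  exists2 b : R, 0 <= b & forall x, `|f x| <= b.
Proof.
move=> [cf f0].
have cK : compact (f @` [set x | `|x| <= M]).
  apply: continuous_compact; first exact: continuous_subspaceT.
  exact: compact_norm_le.
have [b [_ hb]] := compact_bounded cK.
exists (`|b| + 1); first by rewrite addr_ge0.
move=> x; case: (leP `|x| M) => xM; last by rewrite f0// normr0 addr_ge0.
by apply: hb; [have := ler_norm b; lra|exists x].
Qed.

Lemma is_derive_line (V W : normedModType R) (f : V -> W) (x w : V) (t : R) :
  derivable f (x + t *: w) w ->
  is_derive t 1 (fun s : R => f (x + s *: w)) ('D_w f (x + t *: w)).
Proof.
have E (h : R) : x + (h *: (1 : R) + t) *: w = h *: w + (x + t *: w).
  rewrite [X in X *: w](_ : _ = h + t) ?scalerDl 1?addrCA//.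
  by rewrite /GRing.scale/= mulr1.
have EE : (fun h : R => h^-1 *: (f (x + (h *: (1 : R) + t) *: w) - f (x + t *: w))) =
     (fun h => h^-1 *: (f (h *: w + (x + t *: w)) - f (x + t *: w))).
  by apply/funext => h; rewrite E.
move=> df; split; first by rewrite /derivable EE.
by rewrite /derive EE.
Qed.

Lemma mvt_line_eq (V : normedModType R) (f : V -> R) (x w : V) (h : R) : 0 <= h ->
  (forall t : R, 0 <= t <= h -> derivable f (x + t *: w) w) ->
  exists2 c : R, 0 <= c <= h & f (x + h *: w) - f x = 'D_w f (x + c *: w) * h.
Proof.
move=> h0 df.
have dl (t : R) : 0 <= t <= h ->
    is_derive t 1 (fun s : R => f (x + s *: w)) ('D_w f (x + t *: w)).
  by move=> /df; exact: is_derive_line.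
have [t||c c01] := @MVT_segment R (fun s : R => f (x + s *: w)) (fun t => 'D_w f (x + t *: w)) 0 h h0.
- by rewrite in_itv/= => /andP[t0 t1]; apply: dl; rewrite !ltW.
- apply: derivable_within_continuous => t; rewrite in_itv/= => t01.
  exact: (@ex_derive _ _ _ _ _ _ _ (dl t t01)).
rewrite scale0r addr0 subr0 => ->; exists c => //.
Qed.

Lemma mvt_line (V : normedModType R) (f : V -> R) (x w : V) (h b : R) : 0 <= h ->
  (forall t : R, 0 <= t <= h -> derivable f (x + t *: w) w) ->
  (forall t : R, 0 <= t <= h -> `|'D_w f (x + t *: w)| <= b) ->
  `|f (x + h *: w) - f x| <= b * h.
Proof.
move=> h0 df fb; have [c ch ->] := mvt_line_eq h0 df.
by rewrite normrM (ger0_norm h0) ler_wpM2r// fb.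
Qed.

Lemma cvg_harmonic0 : (n.+1%:R^-1 : R) @[n --> \oo] --> (0 : R).
Proof. exact: cvg_harmonic. Qed.

Lemma cvg_diff_quotient (V W : normedModType R) (f : V -> W) (x v : V) :
  derivable f x v ->
  (n.+1%:R : R) *: (f (n.+1%:R^-1 *: v + x) - f x) @[n --> \oo] --> 'D_v f x.
Proof.
move=> df.
have e0 : (n.+1%:R^-1 : R) @[n --> \oo] --> (0 : R)^'.
  move=> A [e /= e0 Ae].
  have /cvgrPdist_lt/(_ _ e0) := cvg_harmonic0.
  apply: filterS => n hn; apply: Ae => //=.
have := cvg_comp _ _ e0 df.
set g := (_ \o _); rewrite (_ : g = fun n => n.+1%:R *: (f (n.+1%:R^-1 *: v + x) - f x))//.
by apply/funext => n; rewrite /g /= invrK.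
Qed.

(** The difference quotients of g have integral zero by translation invariance;
they are bounded by the mean value inequality and converge to the derivative. *)
Lemma rV_integral_derive0 k (M : R) (g : 'rV[R]_k -> R) v : 0 <= M -> cc M g ->
  (forall x, derivable g x v) -> continuous (fun x => 'D_v g x) ->
  rV_integral (fun x => 'D_v g x) = 0.
Proof.
move=> M0 cg dg cD.
have D0 x : M < `|x| -> 'D_v g x = 0.
  move=> xM; have -> : 'D_v g x = 'D_v (fun=> 0 : R) x; last by rewrite derive_cst.
  apply: near_eq_derive; near=> y; apply: cg.2; near: y.
  by apply: (cvgr_gt `|x|) => //; exact: norm_continuous.
have cDg : cc M (fun x => 'D_v g x) by split.
have [b b0 Db] := cc_bounded cDg.
pose f n (x : 'rV[R]_k) := n.+1%:R * (g (x + n.+1%:R^-1 *: v) - g x).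
have gs n : cc (M + `|v|) (fun x => g (x + n.+1%:R^-1 *: v)).
  split=> [x|x xM].
    apply: (@continuous_cvg _ _ _ (nbhs x) _ (fun x => x + n.+1%:R^-1 *: v) g); first exact: cg.1.
    by apply: cvgD; [exact: cvg_id|exact: cvg_cst].
  apply: cg.2; have := ler_normB (x + n.+1%:R^-1 *: v) (n.+1%:R^-1 *: v); rewrite addrK.
  have : `|n.+1%:R^-1 *: v| <= `|v|.
    rewrite normrZ gtr0_norm ?invr_gt0// ler_piMl// invf_le1// ler1n//.
  lra.
have MM : M <= M + `|v| by rewrite lerDl.
have [ID IZ _] := rV_integral_bl (R := R) k.
have If n : rV_integral (f n) = 0.
  rewrite /f (IZ _ _ _ (ccB (gs n) (cc_le MM cg))).
  rewrite (blB (rV_integral_bl k) (gs n) (cc_le MM cg)).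
  by rewrite (rV_integral_shift _ M0 cg) subrr mulr0.
have : rV_integral (f n) @[n --> \oo] --> rV_integral (fun x => 'D_v g x).
  apply: (@rV_integral_dominated _ _ (M + `|v|) b).
  - by move=> n; apply: ccZ; apply: ccB; [exact: gs|exact: cc_le MM cg].
  - exact: cc_le MM cDg.
  - move=> n x; rewrite /f normrM ger0_norm//.
    have n0 : 0 < n.+1%:R :> R by rewrite ltr0n.
    rewrite -ler_pdivlMl// mulrC; apply: mvt_line => //.
  - move=> x; have h := cvg_diff_quotient (dg x); apply: cvg_trans h; apply: near_eq_cvg.
    by apply: nearW => n; rewrite /f /= (addrC x).
under eq_fun do rewrite If.
move/cvg_lim => <- //; apply: cvg_lim => //; exact: cvg_cst.
Unshelve. all: by end_near. Qed.
End IntegrationByParts.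

(** * Nonlinear changes of variables *)

Section Nonlinear.
Context {R : realType} {k : nat}.
Implicit Types (V K : set 'rV[R]_k) (chi psi : 'rV[R]_k -> 'rV[R]_k) (f F : 'rV[R]_k -> R).

Lemma rV_integral_affine (M e : R) z f : 0 <= M -> 0 < e -> cc M f ->
  rV_integral (fun w => f (z + e *: w)) = (e ^+ k)^-1 * rV_integral f.
Proof.
move=> M0 e0 cf.
have uA : (e%:M : 'M[R]_k) \in unitmx.
  by rewrite unitmxE det_scalar unitfE expf_neq0// gt_eqF.
have cfz : cc (M + `|z|) (fun w => f (w + z)).
  split=> [x|x xM].
    apply: (@continuous_cvg _ _ _ (nbhs x) _ (fun x => x + z) f); first exact: cf.1.
    by apply: cvgD; [exact: cvg_id|exact: cvg_cst].
  by apply: cf.2; have := ler_normB (x + z) z; rewrite addrK; lra.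
have := linear_change_of_variables uA _ cfz.
rewrite addr_ge0// => /(_ isT).
rewrite (rV_integral_shift _ M0 cf) det_scalar => <-.
have ek : 0 < e ^+ k by rewrite exprn_gt0.
rewrite (gtr0_norm ek) mulKf ?gt_eqF//; congr rV_integral; apply/funext => w.
by rewrite mul_mx_scalar addrC.
Qed.

(** Near the diagonal of K x K this is the local estimate; near a pair of distinct
points |chi a - chi b| is bounded below, by injectivity.  Compactness of K x K gives
a common constant. *)
Lemma locally_lipschitz_compact V K chi : compact K -> open V -> K `<=` V ->
  {in V, continuous chi} ->
  (forall z z', V z -> V z' -> chi z = chi z' -> z = z') ->
  (forall z, V z -> exists C : R, \forall a \near z & b \near z,
     `|a - b| <= C * `|chi a - chi b|) ->
  exists2 C : R, 0 < C & forall a b, K a -> K b -> `|a - b| <= C * `|chi a - chi b|.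
Proof.
move=> cK oV KV cchi ichi lip.
have : compact (K `*` K) by exact: compact_setX.
rewrite compact_near_coveringP.
move/(_ nat \oo (fun N p => `|p.1 - p.2| <= N.+1%:R * `|chi p.1 - chi p.2|) _) => H.
have {}H : \forall N \near \oo, K `*` K `<=` (fun p => `|p.1 - p.2| <= N.+1%:R * `|chi p.1 - chi p.2|).
  apply: H => -[z z'] [/= Kz Kz'].
  have [zz'|zz'] := eqVneq z z'.
    subst z'; have [C hC] := lip z (KV _ Kz).
    have hN : \forall N \near \oo, C <= N.+1%:R.
      near=> N; apply: (@le_trans _ _ N%:R); last by rewrite ler_nat.
      by near: N; exact: nbhs_infty_ger.
    move: hC => [[A B] /= [hA hB] AB].
    exists (A `*` B, [set N | C <= N.+1%:R]); first by split => //; exists (A, B).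
    move=> [[a b] N]/= [[Aa Bb] CN]; apply: (le_trans (AB (a, b) (conj Aa Bb))).
    by rewrite /= ler_wpM2r.
  have d0 : 0 < `|chi z - chi z'|.
    rewrite normr_gt0 subr_eq0; apply: contra zz' => /eqP h; apply/eqP.
    by apply: ichi => //; exact: KV.
  (* moving chi z and chi z' by at most d each leaves them at least d apart *)
  pose d := `|chi z - chi z'| / 4.
  have dd : 0 < d by rewrite divr_gt0.
  have /cvgrPdist_lt/(_ _ dd) h1 : chi a @[a --> z] --> chi z by apply: cchi; rewrite inE; exact: KV.
  have /cvgrPdist_lt/(_ _ dd) h2 : chi a @[a --> z'] --> chi z' by apply: cchi; rewrite inE; exact: KV.
  pose S := `|z| + `|z'| + 2.
  exists (([set a | `|chi z - chi a| < d] `&` ball z 1) `*` ([set a | `|chi z' - chi a| < d] `&` ball z' 1),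
    [set N | S / d <= N.+1%:R]).
    split => /=.
      exists (([set a | `|chi z - chi a| < d] `&` ball z 1), ([set a | `|chi z' - chi a| < d] `&` ball z' 1)) => //=.
      by split; apply: filterI => //; exact: nbhsx_ballx.
    near=> N; apply: (@le_trans _ _ N%:R); last by rewrite ler_nat.
    by near: N; exact: nbhs_infty_ger.
  move=> [[a b] N]/= [[[ha ba] [hb bb]] hN].
  have h3 : d <= `|chi a - chi b|.
    have : chi z - chi z' = (chi z - chi a) - (chi z' - chi b) + (chi a - chi b).
      by apply/rowP => j; rewrite !mxE; ring.
    move=> E; have := ler_normD (chi z - chi a - (chi z' - chi b)) (chi a - chi b); rewrite -E.
    have := ler_normB (chi z - chi a) (chi z' - chi b).
    have : `|chi z - chi z'| = 4 * d by rewrite /d; field.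
    lra.
  have h4 : `|a - b| <= S.
    apply: (le_trans (ler_normB _ _)); rewrite /S.
    move: ba bb; rewrite -ball_normE /ball_/= => ba bb.
    have := ler_normB z (z - a); have := ler_normB z' (z' - b); rewrite !subKr; lra.
  apply: (le_trans h4); rewrite ler_pdivrMr// in hN; apply: (le_trans hN).
  by rewrite ler_wpM2l.
have [N hN] := @filter_ex _ \oo _ _ H.
by exists N.+1%:R => // a b Ka Kb; exact: (hN (a, b)).
Unshelve. all: by end_near. Qed.
End Nonlinear.

Section ChangeOfVariables.
Context {R : realType} {k : nat}.
Variables (V K : set 'rV[R]_k) (chi : 'rV[R]_k -> 'rV[R]_k) (f F : 'rV[R]_k -> R) (MF : R).
Hypotheses (oV : open V) (cK : compact K) (KV : K `<=` V)
  (dchi : forall z, V z -> differentiable chi z)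
  (uchi : forall z, V z -> jacobian chi z \in unitmx)
  (ichi : forall z z', V z -> V z' -> chi z = chi z' -> z = z')
  (lip : forall z, V z -> exists C : R, \forall a \near z & b \near z,
     `|a - b| <= C * `|chi a - chi b|)
  (cf : continuous f) (fK : forall z, ~ K z -> f z = 0)
  (cF : cc MF F) (FV : forall z, V z -> F (chi z) * `|\det (jacobian chi z)| = f z)
  (F0 : forall y, (forall z, V z -> chi z <> y) -> F y = 0).

Let e (n : nat) : R := n.+1%:R^-1.
Let e_gt0 n : 0 < e n. Proof. by rewrite invr_gt0 ltr0n. Qed.
Let e_le1 n : e n <= 1. Proof. by rewrite invf_le1 ?ler1n ?ltr0n. Qed.
Let e_cvg0 : e n @[n --> \oo] --> (0 : R). Proof. exact: cvg_harmonic0. Qed.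

Let chi_cont z : V z -> chi a @[a --> z] --> chi z.
Proof. by move=> /dchi; exact: differentiable_continuous. Qed.

Let cchi : {in V, continuous chi}.
Proof. by move=> z; rewrite inE; exact: chi_cont. Qed.

Let K_bound : exists2 B : R, 0 <= B & forall z, K z -> `|z| <= B /\ `|chi z| <= B.
Proof.
have [A [_ hA]] := compact_bounded cK.
have cc : compact (chi @` K).
  apply: continuous_compact => //; apply: continuous_in_subspaceT => z /[!inE] Kz.
  by apply: chi_cont; exact: KV.
have [B [_ hB]] := compact_bounded cc.
exists (`|A| + `|B| + 1); first by rewrite !addr_ge0.
move=> z Kz; have := ler_norm A; have := ler_norm B => hb ha.
have := normr_ge0 A; have := normr_ge0 B => hb0 ha0.
split; first by apply: hA => //; lra.
by apply: hB; [lra|exists z].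
Qed.

Let ccf : exists2 M : R, 0 <= M & cc M f.
Proof.
have [B B0 hB] := K_bound; exists B => //; split=> // z zB; apply: fK => Kz.
by have [] := hB _ Kz; lra.
Qed.

Let closed_image : closed (chi @` K).
Proof.
apply: compact_closed; first exact: norm_hausdorff.
apply: continuous_compact => //; apply: continuous_in_subspaceT => z /[!inE] Kz.
by apply: chi_cont; exact: KV.
Qed.

(** The mollified function G n is the density, at y, of the image under chi of the
measure f dz, smoothed at the scale e n. *)
Let h n (y z : 'rV[R]_k) : R := f z * bump ((e n)^-1 *: (y - chi z)).
Let G n (y : 'rV[R]_k) : R := (e n ^+ k)^-1 * rV_integral (h n y).

Let bump_cont : continuous (@bump R k). Proof. exact: (cc_bump k).1. Qed.

Let bump_out n y z : bump ((e n)^-1 *: (y - chi z)) != 0 -> `|y - chi z| <= e n.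
Proof.
apply: contra_neqT; rewrite -ltNge => hlt; apply: (cc_bump k).2.
by rewrite normrZ gtr0_norm ?invr_gt0// ltr_pdivlMl// mulr1.
Qed.

Let h_eq0 n y z : (K z -> e n < `|y - chi z|) -> h n y z = 0.
Proof.
move=> H; rewrite /h; case: (pselect (K z)) => Kz; last by rewrite fK ?mul0r.
have [->|/bump_out] := eqVneq (bump ((e n)^-1 *: (y - chi z))) 0; first by rewrite mulr0.
by rewrite leNgt H.
Qed.

Let h_cont n : continuous (fun p : 'rV[R]_k * 'rV[R]_k => h n p.2 p.1).
Proof.
move=> -[z y]; rewrite /h /=; case: (pselect (V z)) => Vz.
  apply: cvgM.
    by apply: (@continuous_cvg _ _ _ (nbhs (z, y)) _ fst f); [exact: cf|exact: cvg_fst].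
  apply: (@continuous_cvg _ _ _ (nbhs (z, y)) _ (fun p => (e n)^-1 *: (p.2 - chi p.1))).
    exact: bump_cont.
  apply: cvgZr; apply: cvgB; first exact: cvg_snd.
  by apply: (cvg_comp _ _ cvg_fst); exact: chi_cont.
have Kz : ~ K z by move/KV.
have : \forall p \near (z, y), f p.1 = 0.
  have : nbhs z (~` K).
    by apply: open_nbhs_nbhs; split => //; apply: closed_openC; exact: compact_closed (@norm_hausdorff _ _) cK.
  move=> nz; exists (~` K, setT); first by split => //; exact: filterT.
  by move=> [z' y'] /= [Kz' _]; exact: fK.
move=> nf; rewrite /continuous_at /= (fK Kz) mul0r.
apply: cvg_near_cst; move: nf; apply: filterS => -[z' y'] /= ->.
by rewrite mul0r.
Qed.

Let h_cc n y : exists2 M : R, 0 <= M & cc M (h n y).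
Proof.
have [M M0 ccM] := ccf; exists M => //; split=> [z|z zM]; last by rewrite /h ccM.2 ?mul0r.
have := @continuous2_cvg _ _ _ _ (nbhs z) _ id (fun=> y) (fun z y => h n y z) z y (@h_cont n (z, y)).
by apply; [exact: cvg_id|exact: cvg_cst].
Qed.

(** Integrate over y first: the integral of the bump centred at chi z does not
depend on z. *)
Let G_int n : rV_integral (G n) = rV_integral (@bump R k) * rV_integral f.
Proof.
have [M M0 ccM] := ccf; have [B B0 hB] := K_bound.
have [_ IZ _] := rV_integral_bl (R := R) k.
pose M1 := M + B + 1.
have M10 : 0 <= M1 by rewrite !addr_ge0.
have h0 z y : M1 < `|z| -> h n y z = 0.
  by move=> zM; rewrite /h ccM.2 ?mul0r//; rewrite /M1 in zM; lra.
have hy z y : M1 < `|y| -> h n y z = 0.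
  move=> yM; apply: h_eq0 => Kz; have [_] := hB _ Kz.
  have := ler_normB (y - chi z) (- chi z); rewrite opprK subrK normrN.
  have := e_le1 n; rewrite /M1 in yM; lra.
have Fub := fubini M10 (rV_integral_bl k) (@h_cont n) h0 hy.
have cG : cc M1 (fun y => rV_integral (h n y)).
  split.
    apply: (@bl_continuous _ _ k _ M1 (h n) (rV_integral_bl k)) => [p|t x xM]; last exact: h0.
    apply: (@continuous2_cvg _ _ _ _ (nbhs p) _ snd fst (fun z y => h n y z) _ _ (@h_cont n (p.2, p.1))).
      exact: cvg_snd.
    exact: cvg_fst.
  move=> y yM; rewrite -[RHS](bl0 (rV_integral_bl k)); congr rV_integral.
  by apply/funext => z; exact: hy.
have ek0 : e n ^+ k != 0 by rewrite expf_neq0// gt_eqF.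
have key z : rV_integral (fun y => h n y z) = (e n ^+ k * rV_integral (@bump R k)) * f z.
  have cb : cc (e n + `|chi z|) (fun y => bump ((e n)^-1 *: (y - chi z))).
    split=> [y|y yM].
      apply: (@continuous_cvg _ _ _ (nbhs y) _ (fun y => (e n)^-1 *: (y - chi z))); first exact: bump_cont.
      by apply: cvgZr; apply: cvgB; [exact: cvg_id|exact: cvg_cst].
    apply/eqP/negPn/negP => /bump_out hy'.
    have := ler_normB (y - chi z) (- chi z); rewrite opprK subrK normrN; lra.
  rewrite /h (IZ _ _ _ cb) mulrC; congr (_ * _).
  have := rV_integral_affine (chi z) (addr_ge0 (ltW (e_gt0 n)) (normr_ge0 (chi z))) (e_gt0 n) cb.
  move/(congr1 (fun t => e n ^+ k * t)); rewrite mulVKf// => <-; congr (_ * _).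
  congr rV_integral; apply/funext => w; congr bump.
  by rewrite addrAC subrr add0r scalerA mulVf ?scale1r// gt_eqF.
rewrite /G (IZ _ _ _ cG) Fub (_ : (fun x => _) = fun z => (e n ^+ k * rV_integral (@bump R k)) * f z).
  by rewrite (IZ _ _ _ ccM) !mulrA mulVf// mul1r.
by apply/funext => z; rewrite -key.
Qed.

(** Zooming at z by the scale e n, under which chi becomes its derivative in the
limit. *)
Let G_resc n y z : G n y = rV_integral (fun w : 'rV[R]_k => h n y (z + e n *: w)).
Proof.
by have [M M0 ch] := h_cc n y; rewrite /G (rV_integral_affine z M0 (e_gt0 n) ch).
Qed.

Let Kgap y : ~ (chi @` K) y -> \forall n \near \oo, forall z, h n y z = 0.
Proof.
move=> yK.
have : nbhs y (~` (chi @` K)).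
  by apply: open_nbhs_nbhs; split => //; exact: closed_openC.
move=> /nbhs_ballP[d /= d0 hd].
have /cvgrPdist_lt/(_ _ d0) := e_cvg0; apply: filterS => n.
rewrite sub0r normrN gtr0_norm// => end_ z.
apply: h_eq0 => Kz; rewrite ltNge; apply/negP => hz; apply: (hd (chi z)); last by exists z.
by rewrite -ball_normE /ball_/=; exact: le_lt_trans end_.
Qed.

Let bumpJ (z : 'rV[R]_k) : V z ->
  `|\det (jacobian chi z)| * rV_integral (fun w => bump (w *m jacobian chi z)) = rV_integral (@bump R k).
Proof. by move=> Vz; exact: (linear_change_of_variables (uchi Vz) ler01 (cc_bump k)). Qed.

(** The integral of G n does not depend on n.  At a point y = chi z, after zooming
at z, the integrand converges to f z times the bump of the linear map D chi, and
its support stays bounded by the Lipschitz estimate for the inverse of chi; so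
G n y converges to a constant times f z / |det D chi z| = F y. *)
Lemma change_of_variables : rV_integral F = rV_integral f.
Proof.
have [M M0 ccM] := ccf; have [B B0 hB] := K_bound.
have [ID IZ IB] := rV_integral_bl (R := R) k.
have [C C0 hC] := locally_lipschitz_compact cK oV KV cchi ichi lip.
have [bf bf0 hbf] := cc_bounded ccM.
(* chi z and chi (z + e w) are both within e of y, so |e w| <= C (2 e) *)
have supp n (y z w : 'rV[R]_k) : K z -> `|y - chi z| <= e n -> h n y (z + e n *: w) != 0 -> `|w| <= 2 * C.
  move=> Kz hz; rewrite mulf_eq0 negb_or => /andP[f1 /bump_out hw].
  have Kw : K (z + e n *: w) by apply/not_notP => /fK fz; rewrite fz eqxx in f1.
  have := hC _ _ Kw Kz; rewrite addrAC subrr add0r normrZ gtr0_norm//.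
  have E : chi (z + e n *: w) - chi z = (y - chi z) - (y - chi (z + e n *: w)).
    by apply/rowP => j; rewrite !mxE; ring.
  have := ler_normB (y - chi z) (y - chi (z + e n *: w)); rewrite -E => h1 h2.
  rewrite -(ler_pM2l (e_gt0 n)); apply: (le_trans h2).
  apply: (@le_trans _ _ (C * (e n + e n))); last by rewrite (_ : e n * (2 * C) = C * (e n + e n))//; ring.
  by rewrite ler_wpM2l ?(ltW C0)//; lra.
have hres_cont n (y z : 'rV[R]_k) : continuous (fun w : 'rV[R]_k => h n y (z + e n *: w)).
  move=> w; have [M' _ ch] := h_cc n y.
  apply: (@continuous_cvg _ _ _ (nbhs w) _ (fun w => z + e n *: w)); first exact: ch.1.
  by apply: cvgD; [exact: cvg_cst|apply: cvgZr; exact: cvg_id].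
have hres n (y z : 'rV[R]_k) : K z -> `|y - chi z| <= e n -> cc (2 * C) (fun w : 'rV[R]_k => h n y (z + e n *: w)).
  move=> Kz hz; split; first exact: hres_cont.
  by move=> w; apply: contraTeq => hw; rewrite -leNgt; exact: supp hw.
have hb n y z : `|h n y z| <= bf.
  rewrite /h normrM (ger0_norm (bump_ge0 _)) (le_trans _ (hbf z))//.
  by rewrite ler_piMr// bump_le1.
have [C1 C10 hC1] := IB (2 * C).
pose M1 := M + B + 1 + `|MF|.
have M10 : 0 <= M1 by rewrite !addr_ge0.
have G0 n y : (forall z, K z -> e n < `|y - chi z|) -> G n y = 0.
  move=> hy; rewrite /G (_ : h n y = fun=> 0) ?(bl0 (rV_integral_bl k)) ?mulr0//.
  by apply/funext => z; apply: h_eq0; exact: hy.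
have cG n : cc M1 (G n).
  split.
    have cI : continuous (fun y => rV_integral (h n y)).
      apply: (@bl_continuous _ _ k _ M1 (h n) (rV_integral_bl k)) => [p|t x xM]; last first.
        by rewrite /h ccM.2 ?mul0r//; move: xM; rewrite /M1; have := normr_ge0 MF; lra.
      apply: (@continuous2_cvg _ _ _ _ (nbhs p) _ snd fst (fun z y => h n y z) _ _ (@h_cont n (p.2, p.1))).
        exact: cvg_snd.
      exact: cvg_fst.
    move=> y; apply: (@cvgM _ _ (nbhs y) _ (fun=> _) (fun y => rV_integral (h n y))).
      exact: cvg_cst.
    exact: cI.
  move=> y yM; apply: G0 => z Kz; have [_ hz] := hB _ Kz.
  have := ler_normB (y - chi z) (- chi z); rewrite opprK subrK normrN.
  have := e_le1 n; have := normr_ge0 MF; move: yM; rewrite /M1; lra.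
have Gb n y : `|G n y| <= C1 * bf.
  case: (pselect (exists2 z, K z & `|y - chi z| <= e n)) => [[z Kz hz]|hn].
    by rewrite (G_resc n y z); apply: hC1 => //; exact: hres.
  rewrite G0 ?normr0 ?mulr_ge0// => z Kz; rewrite ltNge; apply/negP => hz.
  by apply: hn; exists z.
have IJ (z : 'rV[R]_k) : V z -> rV_integral (fun w => f z * bump (w *m jacobian chi z)) =
    rV_integral (@bump R k) * F (chi z).
  move=> Vz; have [M' M'0 cb] := cc_mulmx (uchi Vz) ler01 (cc_bump k).
  by rewrite (IZ _ _ _ cb) -(FV Vz) -(bumpJ Vz); ring.
have Glim y : G n y @[n --> \oo] --> rV_integral (@bump R k) * F y.
  case: (pselect ((chi @` K) y)) => [[z Kz <-]|yK]; last first.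
    have -> : F y = 0.
      case: (pselect (exists2 z, V z & chi z = y)) => [[z Vz zy]|hn]; last first.
        by apply: F0 => z Vz zy; apply: hn; exists z.
      have fz : f z = 0 by apply: fK => Kz; apply: yK; exists z.
      move: (FV Vz); rewrite fz zy => /eqP; rewrite mulf_eq0 normr_eq0 => /orP[/eqP//|].
      by move/eqP => dz; have := uchi Vz; rewrite unitmxE dz unitr0.
    rewrite mulr0; apply: cvg_near_cst; have := Kgap yK; apply: filterS => n hn.
    rewrite /G (_ : h n y = fun=> 0) ?(bl0 (rV_integral_bl k)) ?mulr0//.
    exact/funext.
  have Vz := KV Kz.
  have [M' M'0 cb] := cc_mulmx (uchi Vz) ler01 (cc_bump k).
  rewrite -(IJ _ Vz); under eq_fun do rewrite (G_resc _ _ z).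
  apply: (@rV_integral_dominated _ _ (2 * C + M') bf).
  - move=> n; apply: (@cc_le _ _ (2 * C)); first by rewrite lerDl.
    by apply: hres => //; rewrite subrr normr0 ltW.
  - by apply: ccZ; apply: cc_le cb; rewrite lerDr mulr_ge0// ltW.
  - by [].
  - move=> w; rewrite /h; apply: cvgM.
      have : z + e n *: w @[n --> \oo] --> z.
        rewrite -[X in _ --> X]addr0 -(scale0r w); apply: cvgD; first exact: cvg_cst.
        by apply: (@cvgZ _ _ _ \oo _ e (fun=> w)); [exact: e_cvg0|exact: cvg_cst].
      by move=> hz; apply: (@continuous_cvg _ _ _ \oo _ (fun n => z + e n *: w) f); first exact: cf.
    (* at y = chi z the argument of the bump tends to - D_w chi, and the bump is even *)
    have -> : bump (w *m jacobian chi z) = bump (- ('D_w chi z)).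
      by rewrite bumpN deriveEjacobian//; exact: dchi.
    apply: (@continuous_cvg _ _ _ \oo _ (fun n => (e n)^-1 *: (chi z - chi (z + e n *: w)))).
      exact: bump_cont.
    have := cvg_diff_quotient (@diff_derivable _ _ _ chi z w (dchi Vz)) => /cvgN hl.
    apply: cvg_trans hl; apply: near_eq_cvg; apply: nearW => n /=.
    by rewrite [LHS]/GRing.opp/= /e invrK -scalerN opprB (addrC (_ *: w)).
have cF1 : cc M1 (fun y => rV_integral (@bump R k) * F y).
  by apply: ccZ; apply: cc_le cF; rewrite /M1; have := ler_norm MF; lra.
have L := rV_integral_dominated cG cF1 Gb Glim.
have L2 : rV_integral (G n) @[n --> \oo] --> rV_integral (@bump R k) * rV_integral f.
  by under eq_fun do rewrite G_int; exact: cvg_cst.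
have := cvg_unique (@norm_hausdorff _ _) L L2.
rewrite (IZ _ _ _ cF) => /(_ _)/mulfI; apply.
by rewrite gt_eqF// int_bump_gt0.
Qed.
End ChangeOfVariables.

(** * Directional derivatives and functions of class C1 *)

Section DirectionalDerivatives.
Context {R : realType} {V : normedModType R}.
Implicit Types (f g : V -> R) (x v : V).

Lemma is_derive_add f g x v df dg : is_derive x v f df -> is_derive x v g dg ->
  is_derive x v (fun y => f y + g y) (df + dg).
Proof. by move=> ? ?; exact: is_deriveD. Qed.

Lemma is_derive_opp f x v df : is_derive x v f df -> is_derive x v (fun y => - f y) (- df).
Proof. by move=> ?; exact: is_deriveN. Qed.

Lemma is_derive_mul f g x v df dg : is_derive x v f df -> is_derive x v g dg ->
  is_derive x v (fun y => f y * g y) (df * g x + f x * dg).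
Proof.
move=> hf hg; have := is_deriveM hf hg; rewrite /GRing.scale/=.
by rewrite addrC (mulrC (g x)).
Qed.

Lemma is_derive_constant (c : R) x v : is_derive x v (fun=> c) 0.
Proof. exact: is_derive_cst. Qed.

Lemma is_derive_bigsum (I : Type) (r : seq I) (f : I -> V -> R) (df : I -> R) x v :
  (forall i, is_derive x v (f i) (df i)) ->
  is_derive x v (fun y => \sum_(i <- r) f i y) (\sum_(i <- r) df i).
Proof.
move=> h; elim: r => [|i r IH].
  by rewrite big_nil; under eq_fun do rewrite big_nil; exact: is_derive_constant.
by rewrite big_cons; under eq_fun do rewrite big_cons; exact: is_derive_add.
Qed.

Lemma is_derive_bigprod n (f : 'I_n -> V -> R) (df : 'I_n -> R) x v :
  (forall i, is_derive x v (f i) (df i)) ->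
  is_derive x v (fun y => \prod_i f i y)
    (\sum_i \prod_j (if j == i then df j else f j x)).
Proof.
elim: n f df => [|n IH] f df h.
  by rewrite big_ord0; under eq_fun do rewrite big_ord0; exact: is_derive_constant.
under eq_fun do rewrite big_ord_recl.
have := is_derive_mul (h ord0) (IH _ _ (fun i => h (lift ord0 i))).
set d := (X in is_derive _ _ _ X -> _); set d' := (X in _ -> is_derive _ _ _ X).
suff -> : d = d' by [].
rewrite /d /d' big_ord_recl; congr (_ + _).
  by rewrite big_ord_recl eqxx; congr (_ * _); apply: eq_bigr.
rewrite mulr_sumr; apply: eq_bigr => i _.
rewrite [RHS]big_ord_recl /=; congr (_ * _); apply: eq_bigr => j _.
Qed.

Lemma is_derive_chain (g : R -> R) f x v df dg :
  is_derive x v f df -> is_derive (f x) 1 g dg ->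
  is_derive x v (fun y => g (f y)) (dg * df).
Proof.
move=> hf hg.
pose F (t : R) := f (x + t *: v).
have x0 : x = x + 0 *: v by rewrite scale0r addr0.
have hF : is_derive (0 : R) (1 : R) F df.
  have hf0 : is_derive (x + 0 *: v) v f df by rewrite -x0.
  have := is_derive_line (@ex_derive _ _ _ _ _ _ _ hf0).
  by rewrite (@derive_val _ _ _ _ _ _ _ hf0).
have hg' : is_derive (F 0) 1 g dg by rewrite /F -x0.
have : is_derive (0 : R) (1 : R) (g \o F) (dg * df) by exact: is_derive1_comp.
have E (h : R) : h *: v + x = x + (h *: (1 : R) + 0) *: v.
  by rewrite addr0 addrC [X in _ = _ + X *: v](_ : _ = h)//; rewrite /GRing.scale/= mulr1.
have EE : (fun h : R => h^-1 *: (((fun y => g (f y)) \o shift x) (h *: v) - g (f x))) =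
   (fun h : R => h^-1 *: (((g \o F) \o shift 0) (h *: (1 : R)) - (g \o F) 0)).
  by apply/funext => h /=; rewrite /F -x0 E.
move=> [d1 d2]; split; first by rewrite /derivable EE.
by rewrite /derive EE.
Qed.

Lemma is_derive_inv f x v df : is_derive x v f df -> f x != 0 ->
  is_derive x v (fun y => (f y)^-1) (- (f x) ^- 2 * df).
Proof.
move=> hf f0; split; first by apply: derivableV => //; exact: (@ex_derive _ _ _ _ _ _ _ hf).
by rewrite deriveV// derive_val.
Qed.

Lemma is_derive_sqrt f x v df : is_derive x v f df -> 0 < f x ->
  is_derive x v (fun y => Num.sqrt (f y)) ((2 * Num.sqrt (f x))^-1 * df).
Proof. by move=> hf f0; apply: (is_derive_chain hf); exact: is_derive1_sqrt. Qed.

Lemma is_derive_exp f n x v df : is_derive x v f df ->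
  is_derive x v (fun y => f y ^+ n) (n%:R * f x ^+ n.-1 * df).
Proof.
move=> hf; elim: n => [|n IH].
  by rewrite mul0r mul0r; exact: is_derive_constant.
under eq_fun do rewrite exprS.
apply: (is_derive_eq (is_derive_mul hf IH)).
case: n {IH} => [|n]; first by rewrite !mul0r mulr0 addr0 expr0 !mulr1 mul1r.
by rewrite /= exprS -[n.+2%:R]natr1; ring.
Qed.

Lemma is_derive_near f g x v d (U : set V) : open U -> U x ->
  (forall y, U y -> f y = g y) -> is_derive x v g d -> is_derive x v f d.
Proof.
move=> oU Ux fg; apply: near_eq_is_derive.
by near=> y; rewrite fg//; near: y; exact: open_nbhs_nbhs.
Unshelve. all: by end_near. Qed.
End DirectionalDerivatives.

(** Jacobi's formula: differentiating the Leibniz expansion gives one determinant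
for each differentiated row, which is expanded along that row. *)
Lemma derive_det {R : realType} {V : normedModType R} k (A : V -> 'M[R]_k) (dA : 'M[R]_k) x v :
  (forall i j, is_derive x v (fun y => A y i j) (dA i j)) ->
  is_derive x v (fun y => \det (A y)) (\sum_i \sum_j dA i j * cofactor (A x) i j).
Proof.
move=> h.
have hs := @is_derive_bigsum _ V _ (index_enum 'S_k)
  (fun (s : 'S_k) y => (-1) ^+ s * \prod_i A y i (s i)) _ x v
  (fun s => is_derive_mul (is_derive_constant _ _ _)
     (is_derive_bigprod (fun i => h i (s i)))).
apply: (is_derive_eq hs).
transitivity (\sum_i \det (\matrix_(a, b) if a == i then dA a b else A x a b)).
  rewrite exchange_big/=; apply: eq_bigr => s _.
  rewrite mul0r add0r mulr_sumr; apply: eq_bigr => i _.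
  by congr (_ * _); apply: eq_bigr => j _; rewrite mxE.
apply: eq_bigr => i _; rewrite (expand_det_row _ i); apply: eq_bigr => j _.
rewrite mxE eqxx; congr (_ * _); rewrite /cofactor; congr (_ * \det _).
by apply/matrixP => a b; rewrite !mxE eq_sym (negbTE (neq_lift _ _)).
Qed.

Section C1.
Context {R : realType} {V : normedModType R} (U : set V) (oU : open U).
Implicit Types (f g : V -> R).

(** Stated with directional derivatives only, so that it is stable under the
algebraic operations without mentioning differentials. *)
Definition C1 (f : V -> R) : Prop := forall x, U x ->
  {for x, continuous f} /\ forall v, derivable f x v /\ {for x, continuous ('D_v f)}.

Lemma continuous_near_eq {T : topologicalType} (f g : V -> T) x : U x ->
  (forall y, U y -> f y = g y) -> {for x, continuous g} -> {for x, continuous f}.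
Proof.
move=> Ux fg cg.
rewrite /prop_for /continuous_at (fg x Ux); apply: cvg_trans cg.
apply: near_eq_cvg; near=> y; rewrite fg//; near: y; exact: open_nbhs_nbhs.
Unshelve. all: by end_near. Qed.

Lemma C1_is_derive f x v : C1 f -> U x -> is_derive x v f ('D_v f x).
Proof. by move=> cf Ux; apply: derivableP; case: (cf x Ux) => _ /(_ v)[]. Qed.

Lemma C1_cont f x : C1 f -> U x -> {for x, continuous f}.
Proof. by move=> cf /cf[]. Qed.

Lemma C1_derive_cont f v x : C1 f -> U x -> {for x, continuous ('D_v f)}.
Proof. by move=> cf /cf[_ /(_ v)[]]. Qed.

Lemma C1_intro f (df : V -> V -> R) :
  (forall x, U x -> {for x, continuous f}) ->
  (forall x v, U x -> is_derive x v f (df v x)) ->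
  (forall x v, U x -> {for x, continuous (df v)}) -> C1 f.
Proof.
move=> cf hd cd x Ux; split; first exact: cf.
move=> v; split; first exact: (@ex_derive _ _ _ _ _ _ _ (hd x v Ux)).
apply: (@continuous_near_eq _ _ (df v)) => //; last exact: cd.
by move=> y Uy; rewrite (@derive_val _ _ _ _ _ _ _ (hd y v Uy)).
Qed.

Lemma C1_ext f g : (forall x, U x -> f x = g x) -> C1 g -> C1 f.
Proof.
move=> fg cg; apply: (C1_intro (df := fun v => 'D_v g)).
- by move=> x Ux; apply: (continuous_near_eq Ux fg); exact: C1_cont cg Ux.
- by move=> x v Ux; apply: (is_derive_near oU Ux fg); exact: (C1_is_derive v cg Ux).
- by move=> x v Ux; exact: C1_derive_cont cg Ux.
Qed.

Lemma C1_cst (c : R) : C1 (fun=> c).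
Proof.
apply: (@C1_intro _ (fun _ _ => 0)).
- by move=> x _; exact: cvg_cst.
- by move=> x v _; exact: cvg_cst.
Qed.

Lemma C1D f g : C1 f -> C1 g -> C1 (fun x => f x + g x).
Proof.
move=> cf cg; apply: (@C1_intro _ (fun v x => 'D_v f x + 'D_v g x)).
- by move=> x Ux; apply: (@cvgD _ _ _ (nbhs x)); exact: C1_cont.
- by move=> x v Ux; apply: is_derive_add; exact: C1_is_derive.
- by move=> x v Ux; apply: (@cvgD _ _ _ (nbhs x)); exact: C1_derive_cont.
Qed.

Lemma C1M f g : C1 f -> C1 g -> C1 (fun x => f x * g x).
Proof.
move=> cf cg; apply: (@C1_intro _ (fun v x => 'D_v f x * g x + f x * 'D_v g x)).
- by move=> x Ux; apply: (@cvgM _ _ (nbhs x)); exact: C1_cont.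
- by move=> x v Ux; apply: is_derive_mul; exact: C1_is_derive.
- move=> x v Ux; apply: (@cvgD _ _ _ (nbhs x)); apply: (@cvgM _ _ (nbhs x)).
  + exact: (C1_derive_cont (v := v) cf Ux).
  + exact: C1_cont cg Ux.
  + exact: C1_cont cf Ux.
  + exact: (C1_derive_cont (v := v) cg Ux).
Qed.

Lemma C1N f : C1 f -> C1 (fun x => - f x).
Proof.
move=> cf; have -> : (fun x => - f x) = (fun x => (- 1) * f x).
  by apply/funext => x; rewrite mulN1r.
exact: (C1M (C1_cst (-1)) cf).
Qed.

Lemma C1B f g : C1 f -> C1 g -> C1 (fun x => f x - g x).
Proof. by move=> cf cg; exact: (C1D cf (C1N cg)). Qed.

Lemma C1_sum (I : Type) (r : seq I) (P : pred I) (f : I -> V -> R) :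
  (forall i, C1 (f i)) -> C1 (fun x => \sum_(i <- r | P i) f i x).
Proof.
move=> cf; elim: r => [|i r IH].
  by under eq_fun do rewrite big_nil; exact: C1_cst.
under eq_fun do rewrite big_cons.
by case: (P i); [exact: (C1D (cf i) IH)|exact: IH].
Qed.

Lemma C1_prod (I : Type) (r : seq I) (P : pred I) (f : I -> V -> R) :
  (forall i, C1 (f i)) -> C1 (fun x => \prod_(i <- r | P i) f i x).
Proof.
move=> cf; elim: r => [|i r IH].
  by under eq_fun do rewrite big_nil; exact: C1_cst.
under eq_fun do rewrite big_cons.
by case: (P i); [exact: (C1M (cf i) IH)|exact: IH].
Qed.

Lemma C1X f n : C1 f -> C1 (fun x => f x ^+ n).
Proof.
move=> cf; elim: n => [|n IH]; first exact: C1_cst.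
by under eq_fun do rewrite exprS; exact: C1M.
Qed.

Lemma C1V f : (forall x, U x -> f x != 0) -> C1 f -> C1 (fun x => (f x)^-1).
Proof.
move=> f0 cf; apply: (@C1_intro _ (fun v x => - (f x) ^- 2 * 'D_v f x)).
- by move=> x Ux; apply: (@cvgV _ _ (nbhs x)); [exact: f0|exact: C1_cont].
- by move=> x v Ux; apply: is_derive_inv; [exact: C1_is_derive|exact: f0].
- move=> x v Ux; apply: (@cvgM _ _ (nbhs x)); last exact: C1_derive_cont.
  apply: (@cvgN _ _ _ (nbhs x)); apply: (@cvgV _ _ (nbhs x)).
    by rewrite expf_neq0// f0.
  rewrite expr2; under eq_fun do rewrite expr2.
  by apply: (@cvgM _ _ (nbhs x)); exact: C1_cont.
Qed.

Lemma C1_sqrt f : (forall x, U x -> 0 < f x) -> C1 f -> C1 (fun x => Num.sqrt (f x)).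
Proof.
move=> f0 cf.
have cs x : U x -> Num.sqrt (f y) @[y --> x] --> Num.sqrt (f x).
  by move=> Ux; apply: (@continuous_cvg _ _ _ (nbhs x) _ f); [exact: sqrt_continuous|exact: C1_cont].
apply: (@C1_intro _ (fun v x => (2 * Num.sqrt (f x))^-1 * 'D_v f x)).
- exact: cs.
- by move=> x v Ux; apply: is_derive_sqrt; [exact: C1_is_derive|exact: f0].
- move=> x v Ux; apply: (@cvgM _ _ (nbhs x)); last exact: C1_derive_cont.
  apply: (@cvgV _ _ (nbhs x)).
    by rewrite mulf_neq0// gt_eqF// sqrtr_gt0 f0.
  by apply: (@cvgM _ _ (nbhs x)); [exact: cvg_cst|exact: cs].
Qed.

Lemma C1_det k (A : V -> 'M[R]_k) : (forall i j, C1 (fun x => A x i j)) ->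
  C1 (fun x => \det (A x)).
Proof.
move=> cA; apply: C1_sum => s; apply: C1M; first exact: C1_cst.
by apply: C1_prod => i; exact: cA.
Qed.

Lemma C1_invmx k (A : V -> 'M[R]_k) : (forall x, U x -> A x \in unitmx) ->
  (forall i j, C1 (fun x => A x i j)) -> forall i j, C1 (fun x => invmx (A x) i j).
Proof.
move=> uA cA i j.
have c : C1 (fun x => (\det (A x))^-1 * cofactor (A x) j i).
  apply: C1M.
    apply: C1V; last exact: C1_det.
    by move=> x Ux; have := uA x Ux; rewrite unitmxE unitfE.
  apply: C1M; first exact: C1_cst.
  apply: C1_det => a b.
  by under eq_fun do rewrite !mxE; exact: cA.
move=> x Ux; have [c1 c2] := c x Ux.
have E y : U y -> invmx (A y) i j = (\det (A y))^-1 * cofactor (A y) j i.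
  by move=> Uy; rewrite /invmx uA// !mxE.
split; first by apply: continuous_near_eq c1.
move=> v; have [c3 c4] := c2 v; split.
  apply: (@ex_derive _ _ _ _ _ _ _ (is_derive_near oU Ux E (derivableP c3))).
apply: continuous_near_eq c4 => // y Uy.
apply: derive_val; apply: (is_derive_near oU Uy E).
by apply: derivableP; case: (c y Uy) => _ /(_ v)[].
Qed.
End C1.

(** * Symmetry of second derivatives *)

Section Schwarz.
Context {R : realType} {V : normedModType R}.

Lemma is_derive_translate {W : normedModType R} (f : V -> W) (a x v : V) d :
  is_derive (x + a) v f d -> is_derive x v (fun y => f (y + a)) d.
Proof.
have E : (fun h : R => h^-1 *: (((fun y => f (y + a)) \o shift x) (h *: v) - f (x + a))) =
  (fun h : R => h^-1 *: ((f \o shift (x + a)) (h *: v) - f (x + a))).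
  by apply/funext => h /=; rewrite addrA.
by move=> [d1 d2]; split; [rewrite /derivable E|rewrite /derive E].
Qed.

Variables (U : set V) (f : V -> R) (oU : open U).
Hypotheses (df : forall x v, U x -> derivable f x v) (cf : forall v, C1 U ('D_v f)).

(** The mean value theorem in the direction v for the difference in the direction
w, then in the direction w. *)
Lemma second_difference (u v w : V) (h : R) : 0 <= h ->
  (forall a b : R, 0 <= a <= h -> 0 <= b <= h -> U (u + a *: v + b *: w)) ->
  exists a b : R, [/\ 0 <= a <= h, 0 <= b <= h &
   f (u + h *: v + h *: w) - f (u + h *: v) - (f (u + h *: w) - f u) =
   'D_w ('D_v f) (u + a *: v + b *: w) * (h * h)].
Proof.
move=> h0 HU.
have hh : 0 <= h <= h by rewrite h0 lexx.
have h00 : 0 <= (0 : R) <= h by rewrite lexx h0.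
have U0 a : 0 <= a <= h -> U (u + a *: v).
  by move=> ha; rewrite -[_ + _ *: v]addr0 -(scale0r w); exact: HU.
pose g y := f (y + h *: w) - f y.
have dg (a : R) : 0 <= a <= h ->
    is_derive (u + a *: v) v g ('D_v f (u + a *: v + h *: w) - 'D_v f (u + a *: v)).
  move=> ha; apply: is_derive_add.
    by apply: is_derive_translate; apply: derivableP; apply: df; exact: HU.
  by apply: is_derive_opp; apply: derivableP; apply: df; exact: U0.
have [a ha E1] : exists2 a : R, 0 <= a <= h & g (u + h *: v) - g u = 'D_v g (u + a *: v) * h.
  by apply: (@mvt_line_eq R V g u v h h0) => t ht; exact: (@ex_derive _ _ _ _ _ _ _ (dg t ht)).
have [b hb E2] : exists2 b : R, 0 <= b <= h &
    'D_v f (u + a *: v + h *: w) - 'D_v f (u + a *: v) = 'D_w ('D_v f) (u + a *: v + b *: w) * h.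
  apply: (@mvt_line_eq R V ('D_v f) (u + a *: v) w h h0) => t ht.
  by have [_ /(_ w)[]] := cf v (HU a t ha ht).
exists a, b; split => //.
move: E1; rewrite (@derive_val _ _ _ _ _ _ _ (dg a ha)) E2 -mulrA => <-.
by rewrite /g addrAC -addrA addrCA !addrA.
Qed.
End Schwarz.

(** The second difference quotient is symmetric in v and w, and is a value of either
mixed derivative at points close to u. *)
Lemma derive_commute {R : realType} {V : normedModType R} (U : set V) (f : V -> R) (u v w : V) :
  open U -> (forall x v, U x -> derivable f x v) -> (forall v, C1 U ('D_v f)) -> U u ->
  'D_w ('D_v f) u = 'D_v ('D_w f) u.
Proof.
move=> oU df cf Uu.
apply/eqP; rewrite -subr_eq0 -normr_le0; apply/ler_addgt0Pl => e e0; rewrite addr0.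
have e2 : 0 < e / 2 by rewrite divr_gt0.
have /cvgrPdist_le/(_ _ e2) c1 : 'D_w ('D_v f) y @[y --> u] --> 'D_w ('D_v f) u.
  by have [_ /(_ w)[]] := cf v u Uu.
have /cvgrPdist_le/(_ _ e2) c2 : 'D_v ('D_w f) y @[y --> u] --> 'D_v ('D_w f) u.
  by have [_ /(_ v)[]] := cf w u Uu.
have nU : nbhs u U by exact: open_nbhs_nbhs.
have hI : nbhs u (U `&` ([set t | `|'D_w ('D_v f) u - 'D_w ('D_v f) t| <= e / 2] `&`
    [set t | `|'D_v ('D_w f) u - 'D_v ('D_w f) t| <= e / 2])).
  exact: filterI nU (filterI c1 c2).
have [d /= d0 hd] := (nbhs_ballP _ _).1 hI.
pose h := d / 2 / (`|v| + `|w| + 1).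
have den : 0 < `|v| + `|w| + 1 by rewrite ltr_wpDl// addr_ge0.
have h0 : 0 < h by rewrite !divr_gt0.
have hdist (a b : R) : 0 <= a <= h -> 0 <= b <= h -> ball u d (u + a *: v + b *: w).
  move=> /andP[a0 ah] /andP[b0 bh]; rewrite -ball_normE /ball_/=.
  rewrite -addrA opprD addrA subrr add0r normrN.
  apply: (le_lt_trans (ler_normD _ _)); rewrite !normrZ !ger0_norm//.
  apply: (@le_lt_trans _ _ (h * (`|v| + `|w| + 1))); last first.
    by rewrite /h divfK ?gt_eqF//; lra.
  have := ler_wpM2r (normr_ge0 v) ah; have := ler_wpM2r (normr_ge0 w) bh.
  by rewrite !mulrDr mulr1; lra.
have [a [b [ha hb E1]]] := second_difference df cf (ltW h0)
  (fun a b ha hb => (hd _ (hdist a b ha hb)).1).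
have [b' [a' [hb' ha' E2]]] := @second_difference _ _ U f df cf u w v h (ltW h0)
  (fun b a hb ha => (hd _ (eq_ind _ (ball u d) (hdist a b ha hb) _ (addrAC _ _ _))).1).
have E : 'D_w ('D_v f) (u + a *: v + b *: w) = 'D_v ('D_w f) (u + b' *: w + a' *: v).
  have hh : h * h != 0 by rewrite mulf_neq0 ?gt_eqF.
  apply: (mulIf hh); apply: (etrans (esym E1)); apply: (etrans _ E2).
  rewrite (addrAC u (h *: w)).
  have swap (a1 a2 a3 a4 : R) : a1 - a2 - (a3 - a4) = a1 - a3 - (a2 - a4) by ring.
  exact: swap.
have [_ [k1 _]] := hd _ (hdist a b ha hb).
have [_ [_ k2]] := hd _ (hdist a' b' ha' hb').
rewrite /= in k1 k2; rewrite addrAC -E in k2.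
move: k1 k2; move: ('D_w ('D_v f) u) ('D_v ('D_w f) u) ('D_w ('D_v f) (u + a *: v + b *: w)) => a1 a2 a3 k1 k2.
have -> : a1 - a2 = (a1 - a3) - (a2 - a3) by ring.
by apply: (le_trans (ler_normB _ _)); rewrite [leRHS](splitr e) lerD.
Qed.

(** * Maps between spaces of row vectors *)

Section VectorValued.
Context {R : realType}.

Lemma derive_entry {V : normedModType R} n (f : V -> 'rV[R]_n) (x v : V) j :
  derivable f x v -> is_derive x v (fun y => f y 0 j) ('D_v f x 0 j).
Proof.
move=> df; split; first by have /derivable_mxP := df; exact.
by rewrite derive_mx// mxE.
Qed.

Lemma is_derive_entries {V : normedModType R} n (f : V -> 'rV[R]_n) (x v : V) (d : 'rV[R]_n) :
  (forall j, is_derive x v (fun y => f y 0 j) (d 0 j)) -> is_derive x v f d.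
Proof.
move=> h.
have df : derivable f x v.
  by apply/derivable_mxP => i j; rewrite ord1; exact: (@ex_derive _ _ _ _ _ _ _ (h j)).
split => //; apply/rowP => j; rewrite derive_mx// mxE.
exact: (@derive_val _ _ _ _ _ _ _ (h j)).
Qed.

Lemma derive_delta {W : normedModType R} k (f : 'rV[R]_k -> W) (x w : 'rV[R]_k) :
  differentiable f x -> 'D_w f x = \sum_i w 0 i *: 'D_(delta_mx 0 i) f x.
Proof.
move=> df; rewrite deriveE// [w in LHS]row_sum_delta linear_sum/=.
by apply: eq_bigr => i _; rewrite linearZ/= deriveE.
Qed.

Lemma C1_of_Ck {V : normedModType R} (U : set V) (f : V -> R) : Ck_on U 1 f -> C1 U f.
Proof.
move=> [df cf] x Ux; split; first exact: differentiable_continuous (df x Ux).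
by move=> v; split; [exact: diff_derivable (df x Ux)|exact: cf].
Qed.

Lemma C1_entry {V : normedModType R} n (U : set V) (f : V -> 'rV[R]_n) j : open U ->
  Ck_on U 1 f -> C1 U (fun x => f x 0 j).
Proof.
move=> oU [df cf]; apply: (C1_intro oU (df := fun v x => 'D_v f x 0 j)).
- move=> x Ux; have c : f y @[y --> x] --> f x by exact: differentiable_continuous (df x Ux).
  exact: (@cvg_entry _ _ (nbhs x)).
- by move=> x v Ux; apply: derive_entry; exact: diff_derivable (df x Ux).
- by move=> x v Ux; apply: (@cvg_entry _ _ (nbhs x)); exact: cf.
Qed.

Lemma cvg_sumv {W : normedModType R} {T : Type} {F : set_system T} {FF : Filter F} (I : Type)
    (r : seq I) (f : I -> T -> W) (l : I -> W) :
  (forall i, f i x @[x --> F] --> l i) ->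
  \sum_(i <- r) f i x @[x --> F] --> \sum_(i <- r) l i.
Proof.
move=> h; elim: r => [|i r IH].
  by rewrite big_nil; under eq_fun do rewrite big_nil; exact: cvg_cst.
by rewrite big_cons; under eq_fun do rewrite big_cons; apply: cvgD.
Qed.

Lemma derive_comp {V W : normedModType R} n (phi : V -> 'rV[R]_n) (Y : 'rV[R]_n -> W) x v :
  differentiable phi x -> differentiable Y (phi x) ->
  differentiable (Y \o phi) x /\ 'D_v (Y \o phi) x = 'D_('D_v phi x) Y (phi x).
Proof.
move=> dp dY; split; first exact: differentiable_comp.
rewrite deriveE; last exact: differentiable_comp.
by rewrite (diff_comp dp dY) /= (deriveE _ dY) (deriveE _ dp).
Qed.

Lemma Ck1_comp {V W : normedModType R} n (U : set V) (U' : set 'rV[R]_n)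
    (phi : V -> 'rV[R]_n) (Y : 'rV[R]_n -> W) : open U ->
  (forall x, U x -> U' (phi x)) -> Ck_on U 1 phi -> Ck_on U' 1 Y -> Ck_on U 1 (Y \o phi).
Proof.
move=> oU UU' [dp cp] [dY cY]; split.
  by move=> x Ux; apply: differentiable_comp; [exact: dp|apply: dY; exact: UU'].
move=> v x Ux.
have E y : U y -> 'D_v (Y \o phi) y =
    \sum_i 'D_v phi y 0 i *: 'D_(delta_mx 0 i) Y (phi y).
  move=> Uy; have [_ ->] := derive_comp v (dp y Uy) (dY _ (UU' y Uy)).
  by rewrite derive_delta//; exact: dY (UU' y Uy).
apply: (continuous_near_eq oU Ux E).
apply: (@cvg_sumv _ _ (nbhs x)) => i.
apply: (@cvgZ _ _ _ (nbhs x)).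
  by apply: (@cvg_entry _ _ (nbhs x)); exact: cp.
apply: (@continuous_cvg _ _ _ (nbhs x) _ phi ('D_(delta_mx 0 i) Y)).
  by apply: cY; exact: UU'.
exact: differentiable_continuous (dp x Ux).
Qed.

Lemma norm_lt_add1 {W : normedModType R} (x y : W) : `|x - y| < 1 -> `|y| <= `|x| + 1.
Proof. by move=> h; have := ler_normB x (x - y); rewrite subKr; lra. Qed.

(** On a ball where the partial derivatives stay within 1 of their values at the
centre, the mean value inequality along segments gives the constant. *)
Lemma Ck1_locally_lipschitz k n (U : set 'rV[R]_k) (phi : 'rV[R]_k -> 'rV[R]_n) p :
  open U -> U p -> Ck_on U 1 phi ->
  exists2 C : R, 0 <= C & exists2 d : R, 0 < d &
    forall a b, ball p d a -> ball p d b -> `|phi a - phi b| <= C * `|a - b|.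
Proof.
move=> oU Up [dp cp].
pose C := \sum_(i < k) (`|'D_(delta_mx 0 i) phi p| + 1).
exists C; first by apply: sumr_ge0 => i _; rewrite addr_ge0.
have nU : nbhs p U by exact: open_nbhs_nbhs.
have : \forall y \near p, forall i : 'I_k,
    `|'D_(delta_mx 0 i) phi p - 'D_(delta_mx 0 i) phi y| < 1.
  have := @filter_forall _ 'I_k (fun i y => `|'D_(delta_mx 0 i) phi p - 'D_(delta_mx 0 i) phi y| < 1) (nbhs p) _; apply => i.
  have c : 'D_(delta_mx 0 i) phi y @[y --> p] --> 'D_(delta_mx 0 i) phi p by exact: cp.
  by have /cvgrPdist_lt/(_ _ ltr01) := c.
move=> /(filterI nU) hI; have /nbhs_ballP[d /= d0 hd] := hI; exists d => // a b pa pb.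
have seg (t : R) : 0 <= t <= 1 -> ball p d (b + t *: (a - b)).
  move=> /andP[t0 t1]; move: pa pb; rewrite -!ball_normE /ball_/= => pa pb.
  have -> : p - (b + t *: (a - b)) = (1 - t) *: (p - b) + t *: (p - a).
    by apply/rowP => j; rewrite !mxE; ring.
  apply: (le_lt_trans (ler_normD _ _)); rewrite !normrZ (ger0_norm t0).
  have -> : `|1 - t| = 1 - t by rewrite ger0_norm// subr_ge0.
  have M0 : Num.max `|p - a| `|p - b| < d by rewrite gt_max pa.
  apply: le_lt_trans M0.
  have h1 : `|p - a| <= Num.max `|p - a| `|p - b| by rewrite le_max lexx.
  have h2 : `|p - b| <= Num.max `|p - a| `|p - b| by rewrite le_max lexx orbT.
  have t10 : 0 <= 1 - t by lra.
  have := ler_wpM2l t0 h1; have := ler_wpM2l t10 h2; lra.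
apply: norm_le_entries; first by rewrite mulr_ge0// sumr_ge0// => i _; rewrite addr_ge0.
move=> j; rewrite !mxE.
have := @mvt_line R _ (fun y => phi y 0 j) b (a - b) 1 (C * `|a - b|) ler01.
rewrite mulr1 scale1r (addrC b) subrK; apply.
  move=> t ht; apply: (@ex_derive _ _ _ _ _ _ _ (@derive_entry _ _ _ _ _ _ _)).
  by apply: diff_derivable; apply: dp; exact: (hd _ (seg t ht)).1.
move=> t ht; have dt := dp _ (hd _ (seg t ht)).1.
rewrite (@derive_val _ _ _ _ _ _ _ (derive_entry j (@diff_derivable _ _ _ _ _ (a - b) dt))).
apply: (le_trans (entry_le_norm _ _)); rewrite derive_delta// (le_trans (ler_norm_sum _ _ _))//.
rewrite mulr_suml ler_sum// => i _; rewrite normrZ mulrC ler_pM//; last exact: entry_le_norm.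
exact: (norm_lt_add1 ((hd _ (seg t ht)).2 i)).
Qed.
End VectorValued.

(* [radius] is from here on the radial coordinate, not the radius of a ball *)
Import Defs.

(** * The Schwarzschild metric in Cartesian coordinates *)

Lemma unitmx_ker0 {R : fieldType} k (A : 'M[R]_k) :
  (forall X : 'rV[R]_k, X *m A = 0 -> X = 0) -> A \in unitmx.
Proof.
move=> h; rewrite -row_free_unit -kermx_eq0; apply/eqP/row_matrixP => i.
by rewrite row0; apply: h; rewrite -row_mul mulmx_ker row0.
Qed.

Lemma expand_linear {R : realType} k (F : 'rV[R]_k -> R) :
  (forall a x y, F (a *: x + y) = a * F x + F y) ->
  forall X, F X = \sum_i X 0 i * F (delta_mx 0 i).
Proof.
move=> hF X.
have F0 : F 0 = 0 by have := hF (-1) 0 0; rewrite scaler0 addr0 mulN1r addNr.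
have FZ a x : F (a *: x) = a * F x by rewrite -[a *: x]addr0 hF F0 addr0.
have FD x y : F (x + y) = F x + F y by rewrite -[x in LHS]scale1r hF mul1r.
rewrite {1}[X]row_sum_delta (big_morph F FD F0).
by apply: eq_bigr => i _; rewrite FZ.
Qed.

Lemma differentiable_rV {R : realType} {V : normedModType R} k (f : V -> 'rV[R]_k) x :
  (forall j, differentiable (fun y => f y 0 j) x) -> differentiable f x.
Proof.
move=> h.
have -> : f = \sum_(j < k) (fun y => f y 0 j *: (delta_mx 0 j : 'rV[R]_k)).
  by apply/funext => y; rewrite fct_sumE [LHS]row_sum_delta.
by apply: differentiable_sum => j; exact: differentiableZl.
Qed.

Lemma is_derive_entry {R : realType} {V : normedModType R} k (f : V -> 'rV[R]_k) x v d j :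
  is_derive x v f d -> is_derive x v (fun y => f y 0 j) (d 0 j).
Proof. by move=> hf; have := derive_entry j (@ex_derive _ _ _ _ _ _ _ hf); rewrite derive_val. Qed.

Section Spacetime.
Context {R : realType} {n : nat}.
Implicit Types (p X Y Z : 'rV[R]_n.+1).

(** The degenerate form dx . dx, so that, p being the position, xdot p X is r dr(X). *)
Definition xdot X Y : R := \sum_(i < n) X 0 (lift ord0 i) * Y 0 (lift ord0 i).

Lemma dot_xcoord X Y : dot (xcoord X) (xcoord Y) = xdot X Y.
Proof. by apply: eq_bigr => i _; rewrite !mxE. Qed.

Lemma xdotC X Y : xdot X Y = xdot Y X.
Proof. by apply: eq_bigr => i _; rewrite mulrC. Qed.

Lemma xdotPl a X Y Z : xdot (a *: X + Y) Z = a * xdot X Z + xdot Y Z.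
Proof.
rewrite /xdot mulr_sumr -big_split; apply: eq_bigr => i _.
by rewrite !mxE mulrDl mulrA.
Qed.

Lemma xdotPr a X Y Z : xdot Z (a *: X + Y) = a * xdot Z X + xdot Z Y.
Proof. by rewrite xdotC xdotPl !(xdotC Z). Qed.

Lemma xdot_ge0 X : 0 <= xdot X X.
Proof. by apply: sumr_ge0 => i _; rewrite -expr2 sqr_ge0. Qed.

Lemma xdot_ddt X : xdot X ddt = 0.
Proof. by apply: big1 => i _; rewrite mxE eqxx andbC /= mulr0. Qed.

Lemma ddt_xdot X : xdot ddt X = 0.
Proof. by rewrite xdotC xdot_ddt. Qed.

Lemma radiusE p : radius p = Num.sqrt (xdot p p).
Proof. by rewrite /radius dot_xcoord. Qed.

Lemma radius_sqr p : radius p ^+ 2 = xdot p p.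
Proof. by rewrite radiusE sqr_sqrtr// xdot_ge0. Qed.

Lemma dtE p X : dt p X = X 0 0.
Proof.
have d : differentiable (@tcoord R n) p by exact: differentiable_coord.
rewrite /dt -deriveE//.
exact: (@derive_val _ _ _ _ _ _ _ (is_derive_entry 0 (is_derive_id p X))).
Qed.

Lemma is_derive_xdot {V : normedModType R} (X Y : V -> 'rV[R]_n.+1) u v dX dY :
  is_derive u v X dX -> is_derive u v Y dY ->
  is_derive u v (fun y => xdot (X y) (Y y)) (xdot dX (Y u) + xdot (X u) dY).
Proof.
move=> hX hY; rewrite /xdot -big_split; apply: is_derive_bigsum => i /=.
by apply: is_derive_mul; exact: is_derive_entry.
Qed.

Lemma is_derive_radius {V : normedModType R} (phi : V -> 'rV[R]_n.+1) u v dphi :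
  0 < radius (phi u) -> is_derive u v phi dphi ->
  is_derive u v (fun y => radius (phi y)) (xdot (phi u) dphi / radius (phi u)).
Proof.
move=> r0 hp.
have -> : (fun y => radius (phi y)) = (fun y => Num.sqrt (xdot (phi y) (phi y))).
  by apply/funext => y; rewrite radiusE.
have q0 : 0 < xdot (phi u) (phi u) by rewrite -sqrtr_gt0 -radiusE.
apply: (is_derive_eq (is_derive_sqrt (is_derive_xdot hp hp) q0)).
rewrite -radiusE (xdotC dphi); field; exact: lt0r_neq0.
Qed.

Lemma differentiable_xdot p : differentiable (fun y : 'rV[R]_n.+1 => xdot y y) p.
Proof.
have -> : (fun y : 'rV[R]_n.+1 => xdot y y) =
    \sum_(i < n) (fun y : 'rV[R]_n.+1 => y 0 (lift ord0 i) * y 0 (lift ord0 i)).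
  by apply/funext => y; rewrite fct_sumE.
apply: differentiable_sum => i.
by apply: differentiableM; exact: differentiable_coord.
Qed.

Lemma differentiable_radius p : 0 < radius p -> differentiable (@radius R n) p.
Proof.
move=> r0.
have -> : @radius R n = Num.sqrt \o (fun y => xdot y y).
  by apply/funext => y; rewrite radiusE.
apply: differentiable_comp; first exact: differentiable_xdot.
apply/derivable1_diffP; apply: (@ex_derive _ _ _ _ _ _ _ (is_derive1_sqrt _)).
by rewrite -sqrtr_gt0 -radiusE.
Qed.

Lemma drE p X : 0 < radius p -> dr p X = xdot p X / radius p.
Proof.
move=> r0; rewrite /dr -deriveE; last exact: differentiable_radius.
exact: (@derive_val _ _ _ _ _ _ _ (is_derive_radius r0 (is_derive_id p X))).
Qed.

Lemma domegaE p X : 0 < radius p ->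
  'd (@omega R n) p X = (radius p)^-1 *: xcoord X - (xdot p X / radius p ^+ 3) *: xcoord p.
Proof.
move=> r0; have rn0 : radius p != 0 by exact: lt0r_neq0.
have d : differentiable (@omega R n) p.
  apply: differentiable_rV => j.
  have -> : (fun y : 'rV[R]_n.+1 => omega y 0 j) =
     (fun y => (radius y)^-1) * (fun y => y 0 (lift ord0 j)).
    by apply/funext => y; rewrite !mxE.
  apply: differentiableM; last exact: differentiable_coord.
  by apply: differentiableV => //; exact: differentiable_radius.
rewrite -deriveE//.
apply: (@derive_val _ _ _ _ _ _ _ (is_derive_entries _)) => j.
have -> : (fun y : 'rV[R]_n.+1 => omega y 0 j) =
   (fun y => (radius y)^-1 * y 0 (lift ord0 j)).
  by apply/funext => y; rewrite !mxE.
have h1 := is_derive_inv (is_derive_radius r0 (is_derive_id p X)) rn0.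
have h2 := is_derive_entry (lift ord0 j) (is_derive_id p X).
apply: (is_derive_eq (is_derive_mul h1 h2)).
by rewrite !mxE; field.
Qed.

(** The round metric on the sphere of radius r is the Euclidean metric minus its
radial part. *)
Lemma round_metricE p X Y : 0 < radius p -> radius p ^+ 2 * round_metric p X Y =
  xdot X Y - xdot p X * xdot p Y / xdot p p.
Proof.
move=> r0; have rn0 : radius p != 0 by exact: lt0r_neq0.
rewrite /round_metric !domegaE//.
set r := radius p; set a := xdot p X; set b := xdot p Y.
have -> : dot (r^-1 *: xcoord X - (a / r ^+ 3) *: xcoord p)
   (r^-1 *: xcoord Y - (b / r ^+ 3) *: xcoord p) =
   r^-1 * r^-1 * xdot X Y - r^-1 * (b / r ^+ 3) * xdot p X - (a / r ^+ 3) * r^-1 * xdot p Y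
   + (a / r ^+ 3) * (b / r ^+ 3) * xdot p p.
  rewrite /dot /xdot !mulr_sumr -!sumrB -big_split /=.
  by apply: eq_bigr => i _; rewrite !mxE; ring.
rewrite -/a -/b -radius_sqr -/r; field; exact: rn0.
Qed.
End Spacetime.

Section Schwarzschild.
Context {R : realType} {n : nat} (m : R) (hn : (3 <= n)%N) (hm : 0 <= m).
Implicit Types (p X Y Z : 'rV[R]_n.+1).
Local Notation region := (@schwarzschild R n m).

(** The coefficients of the metric written as - f dt^2 + dx . dx + h (x . dx)^2:
squared radial lengths are divided by f, so that 1 + h r^2 = 1/f. *)
Definition fS p : R := 1 - 2 * m / radius p ^+ (n - 2).
Definition hS p : R := ((fS p)^-1 - 1) / xdot p p.
(** The derivatives of the coefficients f and h in the direction X are f1S and h1S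
times xdot p X. *)
Definition f1S p : R :=
  2 * m * ((n - 2)%:R * radius p ^+ (n - 2).-1) / (radius p ^+ (n - 2)) ^+ 2 / radius p.
Definition h1S p : R := (- (f1S p / fS p ^+ 2) - 2 * hS p) / xdot p p.

Lemma region_radius p : region p -> 0 < radius p.
Proof.
rewrite /schwarzschild /= => h.
have r0 : 0 <= radius p by rewrite radiusE sqrtr_ge0.
rewrite lt_neqAle r0 andbT; apply/negP => /eqP re.
move: h; rewrite -re expr0n subn_eq0 leqNgt hn /= => h.
by move: (mulr_ge0 (ler0n R 2) hm); rewrite leNgt h.
Qed.

Lemma region_xdot p : region p -> 0 < xdot p p.
Proof. by move/region_radius; rewrite radiusE sqrtr_gt0. Qed.

Lemma region_fS p : region p -> 0 < fS p.
Proof.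
move=> h; have r0 := region_radius h.
by rewrite /fS subr_gt0 ltr_pdivrMr ?exprn_gt0// mul1r.
Qed.

Lemma radius_continuous : continuous (@radius R n).
Proof.
move=> p; have -> : @radius R n = fun y => Num.sqrt (xdot y y).
  by apply/funext => y; rewrite radiusE.
apply: (@continuous_cvg _ _ _ (nbhs p) _ (fun y => xdot y y)); first exact: sqrt_continuous.
exact: (differentiable_continuous (differentiable_xdot p)).
Qed.

Lemma open_region : open region.
Proof.
apply: (@open_comp _ _ (fun p => radius p ^+ (n - 2)) [set y | 2 * m < y]); last exact: open_gt.
move=> p _; apply: (@continuous_cvg _ _ _ (nbhs p) _ (@radius R n) (fun t => t ^+ (n - 2))).
  exact: exprn_continuous.
exact: radius_continuous.
Qed.

Lemma gbarE p X Y : region p ->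
  gbar m p X Y = - fS p * (X 0 0 * Y 0 0) + xdot X Y + hS p * (xdot p X * xdot p Y).
Proof.
move=> h; have r0 := region_radius h; have q0 := region_xdot h; have f0 := region_fS h.
rewrite /gbar round_metricE// !dtE !drE// /hS -/(fS p) -!radius_sqr.
by field; rewrite !lt0r_neq0.
Qed.

Lemma QformE p X Y : region p -> Qform p X Y = xdot p X * Y 0 0 - X 0 0 * xdot p Y.
Proof.
move=> h; have r0 := region_radius h.
by rewrite /Qform !dtE !drE//; field; exact: lt0r_neq0.
Qed.

Lemma gbarC p X Y : region p -> gbar m p X Y = gbar m p Y X.
Proof. by move=> h; rewrite !gbarE// (xdotC X); ring. Qed.

Lemma gbarPl p a X Y Z : region p ->
  gbar m p (a *: X + Y) Z = a * gbar m p X Z + gbar m p Y Z.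
Proof. by move=> h; rewrite !gbarE// xdotPl xdotPr !mxE; ring. Qed.

Lemma gbarPr p a X Y Z : region p ->
  gbar m p Z (a *: X + Y) = a * gbar m p Z X + gbar m p Z Y.
Proof. by move=> h; rewrite !gbarE// !xdotPr !mxE; ring. Qed.

Lemma QformPl p a X Y Z : region p ->
  Qform p (a *: X + Y) Z = a * Qform p X Z + Qform p Y Z.
Proof. by move=> h; rewrite !QformE// xdotPr !mxE; ring. Qed.

Lemma QformPr p a X Y Z : region p ->
  Qform p Z (a *: X + Y) = a * Qform p Z X + Qform p Z Y.
Proof. by move=> h; rewrite !QformE// xdotPr !mxE; ring. Qed.

Lemma QformC p X Y : region p -> Qform p X Y = - Qform p Y X.
Proof. by move=> h; rewrite !QformE//; ring. Qed.

Section AlongMap.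
Context {V : normedModType R} (U : set V) (oU : open U) (phi : V -> 'rV[R]_n.+1).
Hypothesis (Uphi : forall y, U y -> region (phi y)).

Lemma is_derive_fS u v dphi : U u -> is_derive u v phi dphi ->
  is_derive u v (fun y => fS (phi y)) (f1S (phi u) * xdot (phi u) dphi).
Proof.
move=> Uu hp; have r0 := region_radius (Uphi Uu).
have rk : radius (phi u) ^+ (n - 2) != 0 by rewrite expf_neq0// lt0r_neq0.
have h1 := is_derive_inv (is_derive_exp (n - 2) (is_derive_radius r0 hp)) rk.
have h2 := is_derive_opp (is_derive_mul (is_derive_constant (2 * m) u v) h1).
apply: (is_derive_eq (is_derive_add (is_derive_constant 1 u v) h2)).
by rewrite /f1S; field; rewrite rk lt0r_neq0.
Qed.

Lemma is_derive_hS u v dphi : U u -> is_derive u v phi dphi ->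
  is_derive u v (fun y => hS (phi y)) (h1S (phi u) * xdot (phi u) dphi).
Proof.
move=> Uu hp; have Ru := Uphi Uu; have q0 := region_xdot Ru; have f0 := region_fS Ru.
have fn0 : fS (phi u) != 0 by exact: lt0r_neq0.
have qn0 : xdot (phi u) (phi u) != 0 by exact: lt0r_neq0.
have h1 := is_derive_inv (is_derive_fS Uu hp) fn0.
have h2 := is_derive_add h1 (is_derive_opp (is_derive_constant 1 u v)).
have h3 := is_derive_inv (is_derive_xdot hp hp) qn0.
apply: (is_derive_eq (is_derive_mul h2 h3)).
rewrite /h1S /hS (xdotC dphi); field; exact/andP.
Qed.

(** The derivative of the metric coefficients in the direction X, evaluated on the
constant fields Y and Z. *)
Definition dgm p X Y Z : R :=
  - f1S p * xdot p X * (Y 0 0 * Z 0 0) + h1S p * xdot p X * (xdot p Y * xdot p Z)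
  + hS p * (xdot X Y * xdot p Z + xdot p Y * xdot X Z).

Lemma derive_00 (Y : V -> 'rV[R]_n.+1) u v dY : is_derive u v Y dY ->
  is_derive u v (fun y => Y y 0 0) (dY 0 0).
Proof. exact: is_derive_entry. Qed.

Lemma is_derive_gbar (Y Z : V -> 'rV[R]_n.+1) u v dphi dY dZ : U u ->
  is_derive u v phi dphi -> is_derive u v Y dY -> is_derive u v Z dZ ->
  is_derive u v (fun y => gbar m (phi y) (Y y) (Z y))
    (dgm (phi u) dphi (Y u) (Z u) + gbar m (phi u) dY (Z u) + gbar m (phi u) (Y u) dZ).
Proof.
move=> Uu hp hY hZ; have Ru := Uphi Uu.
apply: (is_derive_near oU Uu (fun y Uy => gbarE _ _ (Uphi Uy))).
have hf := is_derive_mul (is_derive_opp (is_derive_fS Uu hp))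
   (is_derive_mul (derive_00 hY) (derive_00 hZ)).
have hh := is_derive_mul (is_derive_hS Uu hp)
   (is_derive_mul (is_derive_xdot hp hY) (is_derive_xdot hp hZ)).
apply: (is_derive_eq (is_derive_add (is_derive_add hf (is_derive_xdot hY hZ)) hh)).
by rewrite /dgm !gbarE//; ring.
Qed.

Lemma is_derive_Qform_coord (Y Z : V -> 'rV[R]_n.+1) u v dphi dY dZ : U u ->
  is_derive u v phi dphi -> is_derive u v Y dY -> is_derive u v Z dZ ->
  is_derive u v (fun y => Qform (phi y) (Y y) (Z y))
    (xdot dphi (Y u) * (Z u) 0 0 - (Y u) 0 0 * xdot dphi (Z u)
     + Qform (phi u) dY (Z u) + Qform (phi u) (Y u) dZ).
Proof.
move=> Uu hp hY hZ; have Ru := Uphi Uu.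
apply: (is_derive_near oU Uu (fun y Uy => QformE _ _ (Uphi Uy))).
have h1 := is_derive_mul (is_derive_xdot hp hY) (derive_00 hZ).
have h2 := is_derive_mul (derive_00 hY) (is_derive_xdot hp hZ).
apply: (is_derive_eq (is_derive_add h1 (is_derive_opp h2))).
by rewrite !QformE//; ring.
Qed.
End AlongMap.

Lemma ddt00 : (@ddt R n) 0 0 = 1.
Proof. by rewrite mxE !eqxx. Qed.

(** The spatial part of the position vector, used to test identities radially. *)
Definition xi p : 'rV[R]_n.+1 := p - p 0 0 *: ddt.

Lemma xi00 p : xi p 0 0 = 0.
Proof. by rewrite !mxE !eqxx mulr1 subrr. Qed.

Lemma xdot_xi p X : xdot X (xi p) = xdot p X.
Proof.
rewrite /xi addrC -scaleNr xdotPr xdot_ddt mulr0 add0r; exact: xdotC.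
Qed.

Lemma xi_xdot p X : xdot (xi p) X = xdot p X.
Proof. by rewrite xdotC xdot_xi. Qed.

Lemma gmxE p X l : region p -> (X *m gmx m p) 0 l = gbar m p X (delta_mx 0 l).
Proof.
move=> h; rewrite mxE (@expand_linear _ _ (fun X => gbar m p X (delta_mx 0 l))).
  by apply: eq_bigr => i _; rewrite mxE.
by move=> a x y; exact: gbarPl.
Qed.

Lemma gbar_mulmx p X Y : region p -> gbar m p X Y = \sum_l (X *m gmx m p) 0 l * Y 0 l.
Proof.
move=> h; rewrite (@expand_linear _ _ (fun Y => gbar m p X Y)).
  by apply: eq_bigr => i _; rewrite gmxE// mulrC.
by move=> a x y; exact: gbarPr.
Qed.

Lemma gmx_sym p : region p -> (gmx m p)^T = gmx m p.
Proof. by move=> h; apply/matrixP => i j; rewrite !mxE gbarC. Qed.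

(** The metric is nondegenerate: pairing a vector of its kernel with d_t, then with the
radial direction, then with itself kills its successive components. *)
Lemma gmx_unit p : region p -> gmx m p \in unitmx.
Proof.
move=> h; apply: unitmx_ker0 => X X0.
have g0 Y : gbar m p X Y = 0 by rewrite gbar_mulmx// X0 big1// => l _; rewrite mxE mul0r.
have f0 := region_fS h; have q0 := region_xdot h.
have X00 : X 0 0 = 0.
  have := g0 ddt; rewrite gbarE// xdot_ddt ddt00 xdot_ddt !mulr0 mulr1 !addr0.
  by move/eqP; rewrite mulf_eq0 oppr_eq0 gt_eqF//= => /eqP.
have b0 : xdot p X = 0.
  have := g0 (xi p); rewrite gbarE// X00 xdot_xi mul0r mulr0 add0r xdot_xi /hS => e.
  apply: (@mulfI _ (fS p)^-1); first by rewrite invr_neq0// lt0r_neq0.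
  rewrite mulr0 -[RHS]e; field; by rewrite !lt0r_neq0.
have := g0 X; rewrite gbarE// X00 b0 !mulr0 add0r addr0 => /eqP.
rewrite psumr_eq0; last by move=> i _; rewrite -expr2 sqr_ge0.
move=> /allP hX; apply/rowP => j; rewrite mxE.
case: (unliftP ord0 j) => [i|] ->; last exact: X00.
by have := hX i (mem_index_enum _); rewrite /= mulf_eq0 orbb => /eqP.
Qed.

(** * The Levi-Civita connection and the conformal Killing-Yano form *)

(** The zeroth-order part of the covariant derivative. *)
Definition Gam p X Y : 'rV[R]_n.+1 :=
  \row_k \sum_i \sum_j christoffel m p k i j * X 0 i * Y 0 j.

Lemma dgmP1 p a X X' Y Z : dgm p (a *: X + X') Y Z = a * dgm p X Y Z + dgm p X' Y Z.
Proof. by rewrite /dgm !xdotPr !xdotPl; ring. Qed.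
Lemma dgmP2 p a X X' Y Z : dgm p Y (a *: X + X') Z = a * dgm p Y X Z + dgm p Y X' Z.
Proof. by rewrite /dgm !xdotPr !mxE; ring. Qed.
Lemma dgmC p X Y Z : dgm p X Y Z = dgm p X Z Y.
Proof. by rewrite /dgm; ring. Qed.
Lemma dgmP3 p a X X' Y Z : dgm p Y Z (a *: X + X') = a * dgm p Y Z X + dgm p Y Z X'.
Proof. by rewrite !(dgmC _ _ Z) dgmP2. Qed.

Lemma derive_gmx p a b c : region p ->
  'D_(delta_mx 0 a) (fun q => gmx m q b c) p = dgm p (delta_mx 0 a) (delta_mx 0 b) (delta_mx 0 c).
Proof.
move=> h.
have E : (fun q => gmx m q b c) = (fun q => gbar m q (delta_mx 0 b) (delta_mx 0 c)).
  by apply/funext => q; rewrite mxE.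
rewrite E.
have hc (k : 'I_n.+1) : is_derive p (delta_mx 0 a : 'rV[R]_n.+1) (fun _ => delta_mx 0 k : 'rV[R]_n.+1) 0.
  exact: is_derive_cst.
have := is_derive_gbar open_region (fun y hy => hy) h (is_derive_id p (delta_mx 0 a)) (hc b) (hc c).
move=> hd; rewrite (@derive_val _ _ _ _ _ _ _ hd).
have z Y : gbar m p 0 Y = 0 by have := gbarPl (-1) 0 0 Y h; rewrite scaler0 addr0 mulN1r addNr.
by rewrite (gbarC _ 0)// !z !addr0.
Qed.

(** The Koszul formula for constant fields; it determines Gam completely, and its
contractions below replace the inverse of the metric matrix. *)
Lemma gbar_Gam p X Y Z : region p -> gbar m p (Gam p X Y) Z =
  2^-1 * (dgm p X Y Z + dgm p Y X Z - dgm p Z X Y).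
Proof.
move=> h.
pose t := \row_l (2^-1 * (dgm p X Y (delta_mx 0 l) + dgm p Y X (delta_mx 0 l) - dgm p (delta_mx 0 l) X Y)).
have GE : Gam p X Y = t *m invmx (gmx m p).
  apply/rowP => k; rewrite !mxE.
  transitivity (\sum_l invmx (gmx m p) k l * t 0 l); last first.
    apply: eq_bigr => l _; rewrite mulrC; congr (_ * _).
    by rewrite -[in LHS](gmx_sym h) -trmx_inv mxE.
  have E l : t 0 l = \sum_i \sum_j 2^-1 * (dgm p (delta_mx 0 i) (delta_mx 0 j) (delta_mx 0 l)
     + dgm p (delta_mx 0 j) (delta_mx 0 i) (delta_mx 0 l)
     - dgm p (delta_mx 0 l) (delta_mx 0 i) (delta_mx 0 j)) * X 0 i * Y 0 j.
    rewrite mxE (@expand_linear _ _ (fun X => 2^-1 * (dgm p X Y (delta_mx 0 l) + dgm p Y X (delta_mx 0 l) - dgm p (delta_mx 0 l) X Y))); last first.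
      by move=> a x y; rewrite dgmP1 !dgmP2; ring.
    apply: eq_bigr => i _.
    rewrite (@expand_linear _ _ (fun Y => 2^-1 * (dgm p (delta_mx 0 i) Y (delta_mx 0 l) + dgm p Y (delta_mx 0 i) (delta_mx 0 l) - dgm p (delta_mx 0 l) (delta_mx 0 i) Y))); last first.
      by move=> a x y; rewrite dgmP1 dgmP2 dgmP3; ring.
    by rewrite mulr_sumr; apply: eq_bigr => j _; ring.
  under [RHS]eq_bigr do rewrite E mulr_sumr.
  rewrite [RHS]exchange_big; apply: eq_bigr => i _ /=.
  under [RHS]eq_bigr do rewrite mulr_sumr.
  rewrite [RHS]exchange_big; apply: eq_bigr => j _ /=.
  rewrite /christoffel /= -!mulrA mulr_suml mulr_sumr; apply: eq_bigr => l _.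
  by rewrite !derive_gmx//; ring.
rewrite gbar_mulmx// GE mulmxKV ?gmx_unit//.
rewrite [RHS](@expand_linear _ _ (fun Z => 2^-1 * (dgm p X Y Z + dgm p Y X Z - dgm p Z X Y))).
  by apply: eq_bigr => l _; rewrite mxE mulrC.
by move=> a x y; rewrite dgmP1 !dgmP3; ring.
Qed.

Lemma Gam00 p X Y : region p ->
  Gam p X Y 0 0 = f1S p / (2 * fS p) * (xdot p X * Y 0 0 + xdot p Y * X 0 0).
Proof.
move=> h; have f0 := region_fS h; have fn0 := lt0r_neq0 f0.
have := gbar_Gam X Y ddt h; rewrite gbarE// ddt00 !xdot_ddt /dgm !ddt00 !xdot_ddt.
rewrite !ddt_xdot => e.
apply: (@mulfI _ (- fS p)); first by rewrite oppr_eq0.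
rewrite (_ : - fS p * Gam p X Y 0 0 =
  - fS p * (Gam p X Y 0 0 * 1) + 0 + hS p * (xdot p (Gam p X Y) * 0)); last by ring.
by rewrite e; field.
Qed.

Lemma xdot_Gam p X Y : region p ->
  xdot p (Gam p X Y) = fS p / 2 * ((h1S p * xdot p p) * (xdot p X * xdot p Y)
    + 2 * hS p * xdot p p * xdot X Y + f1S p * xdot p p * (X 0 0 * Y 0 0)).
Proof.
move=> h; have f0 := region_fS h; have fn0 := lt0r_neq0 f0.
have q0 := region_xdot h; have qn0 := lt0r_neq0 q0.
have := gbar_Gam X Y (xi p) h; rewrite gbarE// xi00 !xdot_xi /dgm !xi00 !xdot_xi.
rewrite !xi_xdot (xdotC Y) => e.
apply: (@mulfI _ (fS p)^-1); first by rewrite invr_neq0.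
have -> : (fS p)^-1 * xdot p (Gam p X Y) =
   - fS p * (Gam p X Y 0 0 * 0) + xdot p (Gam p X Y) + hS p * (xdot p (Gam p X Y) * xdot p p).
  by rewrite /hS; field; apply/andP.
by rewrite e; field.
Qed.

(** The value (D_X Q)(Y, Z) of the covariant derivative of Q = x . dx /\ dt: the
derivative of its coefficients corrected by the connection. *)
Definition DQ p X Y Z : R :=
  xdot X Y * Z 0 0 - Y 0 0 * xdot X Z - Qform p (Gam p X Y) Z - Qform p Y (Gam p X Z).

(** Only the time and radial components of the connection enter, and both sides
are then rational in the coefficient f, its radial derivative and Euclidean
products; the terms in the derivative of f cancel. *)
Lemma conformal_Killing_Yano p X Y Z : region p ->
  DQ p X Y Z + DQ p Y X Z = - 2 * gbar m p X Y * gbar m p ddt Z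
    + gbar m p X Z * gbar m p ddt Y + gbar m p Y Z * gbar m p ddt X.
Proof.
move=> h; have f0 := region_fS h; have fn0 := lt0r_neq0 f0.
have q0 := region_xdot h; have qn0 := lt0r_neq0 q0.
rewrite /DQ !QformE// !Gam00// !xdot_Gam// !gbarE// ddt00 !ddt_xdot !xdot_ddt.
rewrite (xdotC Y X) /h1S /hS.
by field; apply/andP.
Qed.

Section AlongMap2.
Context {V : normedModType R} (U : set V) (oU : open U) (phi : V -> 'rV[R]_n.+1).
Hypothesis (Uphi : forall y, U y -> region (phi y)).

(** The derivatives of the metric coefficients are absorbed by the Koszul formula. *)
Lemma metric_compatible (Y Z : V -> 'rV[R]_n.+1) u v dphi dY dZ : U u ->
  is_derive u v phi dphi -> is_derive u v Y dY -> is_derive u v Z dZ ->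
  is_derive u v (fun y => gbar m (phi y) (Y y) (Z y))
    (gbar m (phi u) (dY + Gam (phi u) dphi (Y u)) (Z u)
     + gbar m (phi u) (Y u) (dZ + Gam (phi u) dphi (Z u))).
Proof.
move=> Uu hp hY hZ; have Ru := Uphi Uu.
apply: (is_derive_eq (is_derive_gbar oU Uphi Uu hp hY hZ)).
rewrite -[dY in RHS]scale1r -[dZ in RHS]scale1r gbarPl// gbarPr// !mul1r.
rewrite (gbarC (Y u) (Gam _ _ _))// !gbar_Gam//.
by rewrite (dgmC _ dphi (Z u)); field.
Qed.

Lemma is_derive_Qform (Y Z : V -> 'rV[R]_n.+1) u v dphi dY dZ : U u ->
  is_derive u v phi dphi -> is_derive u v Y dY -> is_derive u v Z dZ ->
  is_derive u v (fun y => Qform (phi y) (Y y) (Z y))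
    (DQ (phi u) dphi (Y u) (Z u)
     + Qform (phi u) (dY + Gam (phi u) dphi (Y u)) (Z u)
     + Qform (phi u) (Y u) (dZ + Gam (phi u) dphi (Z u))).
Proof.
move=> Uu hp hY hZ; have Ru := Uphi Uu.
apply: (is_derive_eq (is_derive_Qform_coord oU Uphi Uu hp hY hZ)).
rewrite /DQ -[dY in RHS]scale1r -[dZ in RHS]scale1r QformPl// QformPr//; ring.
Qed.

Lemma C1_xdot (X Y : V -> 'rV[R]_n.+1) : (forall j, C1 U (fun x => X x 0 j)) ->
  (forall j, C1 U (fun x => Y x 0 j)) -> C1 U (fun x => xdot (X x) (Y x)).
Proof. by move=> cX cY; apply: C1_sum => // i; exact: C1M. Qed.

Hypothesis cphi : forall j, C1 U (fun x => phi x 0 j).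

Lemma C1_radius : C1 U (fun x => radius (phi x)).
Proof.
under eq_fun do rewrite radiusE.
apply: C1_sqrt => //; first by move=> x Ux; exact: region_xdot (Uphi Ux).
exact: C1_xdot.
Qed.

Let rad0 x : U x -> radius (phi x) != 0.
Proof. by move=> Ux; rewrite lt0r_neq0// region_radius//; exact: Uphi. Qed.

Lemma C1_fS : C1 U (fun x => fS (phi x)).
Proof.
have nz x : U x -> radius (phi x) ^+ (n - 2) != 0 by move=> Ux; rewrite expf_neq0// rad0.
exact: (C1B oU (C1_cst oU 1) (C1M oU (C1_cst oU (2 * m)) (C1V oU nz (C1X oU _ C1_radius)))).
Qed.

Let fS0 x : U x -> fS (phi x) != 0.
Proof. by move=> Ux; exact: lt0r_neq0 (region_fS (Uphi Ux)). Qed.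

Let q0 x : U x -> xdot (phi x) (phi x) != 0.
Proof. by move=> Ux; exact: lt0r_neq0 (region_xdot (Uphi Ux)). Qed.

Lemma C1_hS : C1 U (fun x => hS (phi x)).
Proof.
exact: (C1M oU (C1B oU (C1V oU fS0 C1_fS) (C1_cst oU 1)) (C1V oU q0 (C1_xdot cphi cphi))).
Qed.

Lemma C1_f1S : C1 U (fun x => f1S (phi x)).
Proof.
have nz x : U x -> (radius (phi x) ^+ (n - 2)) ^+ 2 != 0 by move=> Ux; rewrite !expf_neq0// rad0.
have cr := C1_radius.
exact: (C1M oU (C1M oU (C1M oU (C1_cst oU (2 * m)) (C1M oU (C1_cst oU (n - 2)%:R) (C1X oU _ cr)))
  (C1V oU nz (C1X oU 2 (C1X oU _ cr)))) (C1V oU rad0 cr)).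
Qed.

Lemma C1_h1S : C1 U (fun x => h1S (phi x)).
Proof.
have nz x : U x -> fS (phi x) ^+ 2 != 0 by move=> Ux; rewrite expf_neq0// fS0.
exact: (C1M oU (C1B oU (C1N oU (C1M oU C1_f1S (C1V oU nz (C1X oU 2 C1_fS))))
  (C1M oU (C1_cst oU 2) C1_hS)) (C1V oU q0 (C1_xdot cphi cphi))).
Qed.

Variables (X Y Z : V -> 'rV[R]_n.+1).
Hypotheses (cX : forall j, C1 U (fun x => X x 0 j)) (cY : forall j, C1 U (fun x => Y x 0 j))
  (cZ : forall j, C1 U (fun x => Z x 0 j)).

Lemma C1_gbar : C1 U (fun x => gbar m (phi x) (X x) (Y x)).
Proof.
apply: (C1_ext oU (fun x Ux => gbarE _ _ (Uphi Ux))).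
exact: (C1D oU (C1D oU (C1M oU (C1N oU C1_fS) (C1M oU (cX 0) (cY 0))) (C1_xdot cX cY))
  (C1M oU C1_hS (C1M oU (C1_xdot cphi cX) (C1_xdot cphi cY)))).
Qed.

Lemma C1_Qform : C1 U (fun x => Qform (phi x) (X x) (Y x)).
Proof.
apply: (C1_ext oU (fun x Ux => QformE _ _ (Uphi Ux))).
exact: (C1B oU (C1M oU (C1_xdot cphi cX) (cY 0)) (C1M oU (cX 0) (C1_xdot cphi cY))).
Qed.

Lemma C1_Qform_Gam : C1 U (fun x => Qform (phi x) (X x) (Gam (phi x) (Y x) (Z x))).
Proof.
have E x : U x -> Qform (phi x) (X x) (Gam (phi x) (Y x) (Z x)) =
  xdot (phi x) (X x) * (f1S (phi x) / (2 * fS (phi x)) *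
     (xdot (phi x) (Y x) * Z x 0 0 + xdot (phi x) (Z x) * Y x 0 0)) -
  X x 0 0 * (fS (phi x) / 2 * ((h1S (phi x) * xdot (phi x) (phi x)) * (xdot (phi x) (Y x) * xdot (phi x) (Z x))
    + 2 * hS (phi x) * xdot (phi x) (phi x) * xdot (Y x) (Z x)
    + f1S (phi x) * xdot (phi x) (phi x) * (Y x 0 0 * Z x 0 0))).
  by move=> Ux; have h := Uphi Ux; rewrite QformE// Gam00// xdot_Gam.
apply: (C1_ext oU E).
have cq := C1_xdot cphi cphi; have c2 := C1_cst oU (2 : R).
have cpY := C1_xdot cphi cY; have cpZ := C1_xdot cphi cZ.
have nz x : U x -> 2 * fS (phi x) != 0 by move=> Ux; rewrite mulf_neq0// fS0.
exact: (C1B oU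
  (C1M oU (C1_xdot cphi cX) (C1M oU (C1M oU C1_f1S (C1V oU nz (C1M oU c2 C1_fS)))
     (C1D oU (C1M oU cpY (cZ 0)) (C1M oU cpZ (cY 0)))))
  (C1M oU (cX 0) (C1M oU (C1M oU C1_fS (C1_cst oU 2^-1))
     (C1D oU (C1D oU (C1M oU (C1M oU C1_h1S cq) (C1M oU cpY cpZ))
                     (C1M oU (C1M oU (C1M oU c2 C1_hS) cq) (C1_xdot cY cZ)))
             (C1M oU (C1M oU C1_f1S cq) (C1M oU (cY 0) (cZ 0))))))).
Qed.
End AlongMap2.
End Schwarzschild.

(** * Parametrizations of submanifolds *)

Lemma Ck_on_subset {R : realType} {E F : normedModType R} (U D : set E) k (f : E -> F) :
  D `<=` U -> Ck_on U k f -> Ck_on D k f.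
Proof.
move=> DU; elim: k f => [|k IH] f; first by move=> cf x Dx; exact: cf (DU x Dx).
move=> [df cf]; split; first by move=> x Dx; exact: df (DU x Dx).
by move=> v; apply: IH; exact: cf.
Qed.

Lemma open_preimage {E : topologicalType} {F : topologicalType} (U : set E) (W : set F) (f : E -> F) :
  open U -> open W -> (forall x, U x -> f y @[y --> x] --> f x) -> open (U `&` f @^-1` W).
Proof.
move=> oU oW cf; rewrite openE => x [Ux Wx]; apply: filterI.
  exact: open_nbhs_nbhs.
by apply: (cf x Ux); exact: open_nbhs_nbhs.
Qed.

Section Parametrizations.
Context {R : realType} {N k : nat} (S : set 'rV[R]_N).
Implicit Types (U : set 'rV[R]_k) (phi : 'rV[R]_k -> 'rV[R]_N).

Lemma param_Ck U phi j : is_parametrization S U phi -> Ck_on U j phi.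
Proof. by case=> _ h _ _; exact: h. Qed.

Lemma param_open U phi : is_parametrization S U phi -> open U.
Proof. by case. Qed.

Lemma param_cont U phi u : is_parametrization S U phi -> U u -> phi y @[y --> u] --> phi u.
Proof. by move=> /(param_Ck 0) c Uu; exact: c. Qed.

Lemma param_diff U phi u : is_parametrization S U phi -> U u -> differentiable phi u.
Proof. by move=> /(param_Ck 1)[d _] Uu; exact: d. Qed.

Lemma param_in U phi u : is_parametrization S U phi -> U u -> S (phi u).
Proof.
move=> [_ _ [W _ e] _] Uu; have : (phi @` U) (phi u) by exists u.
by rewrite e => -[].
Qed.

Lemma param_inj U phi u v : is_parametrization S U phi -> U u -> U v -> phi u = phi v -> u = v.
Proof. by move=> [_ _ _ [psi _ h]] Uu Uv e; rewrite -(h u Uu) -(h v Uv) e. Qed.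

Lemma param_local_inverse U phi u : is_parametrization S U phi -> U u ->
  exists psi (W : set 'rV[R]_N), [/\ open W, W (phi u), Ck_on W 1 psi &
    forall v, U v -> W (phi v) -> psi (phi v) = v].
Proof.
move=> [_ _ _ [psi hs h]] Uu.
have [psi' [W [oW Wu sm e]]] := hs (phi u) (ex_intro2 _ _ u Uu erefl).
exists psi', W; split => // v Uv Wv.
by rewrite e ?h//; exists v.
Qed.

(** The transition map is a local smooth extension of the inverse of phi composed
with phi2. *)
Lemma param_transition U phi U2 phi2 u : is_parametrization S U phi ->
  is_parametrization S U2 phi2 -> U2 u -> (phi @` U) (phi2 u) ->
  exists (D : set 'rV[R]_k) (tau : 'rV[R]_k -> 'rV[R]_k),
    [/\ open D, D u, D `<=` U2, Ck_on D 1 tau &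
        forall v, D v -> U (tau v) /\ phi (tau v) = phi2 v].
Proof.
move=> hp hp2 Uu [u0 U0 e0].
have [psi [W [oW Wu cpsi hpsi]]] := param_local_inverse hp U0.
have [_ _ [W' oW' imW] _] := hp.
have o2 := param_open hp2.
pose D := U2 `&` phi2 @^-1` (W `&` W').
have oD : open D.
  by apply: open_preimage => //; [exact: openI|move=> x Ux; exact: param_cont hp2 Ux].
have Du : D u.
  split=> //; split; first by rewrite -e0.
  have : (phi @` U) (phi2 u) by exists u0.
  by rewrite imW => -[].
exists D, (psi \o phi2); split => //; first by move=> x [].
  apply: (Ck1_comp oD _ (Ck_on_subset _ (param_Ck 1 hp2)) cpsi); by move=> x [? []].
move=> v [Uv [Wv Wv']].
have : (S `&` W') (phi2 v) by split => //; exact: param_in hp2 Uv.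
rewrite -imW => -[x Ux ex] /=; rewrite -ex.
by rewrite (hpsi x Ux) ?ex.
Qed.

(** A parametrization is an immersion, because it has a differentiable left inverse. *)
Lemma param_derive_eq0 U phi u w : is_parametrization S U phi -> U u ->
  'D_w phi u = 0 -> w = 0.
Proof.
move=> hp Uu e.
have [psi [W [oW Wu [dpsi _] hpsi]]] := param_local_inverse hp Uu.
have dp := param_diff hp Uu; have [_ dc] := derive_comp w dp (dpsi _ Wu).
have : 'D_w (psi \o phi) u = w.
  have oD : open (U `&` phi @^-1` W).
    by apply: open_preimage => //; [exact: param_open hp|move=> x Ux; exact: param_cont hp Ux].
  apply: (@derive_val _ _ _ _ _ _ _ _).
  apply: (@near_eq_is_derive _ _ _ id) => //.
  near=> y; have [Uy Wy] : (U `&` phi @^-1` W) y by near: y; exact: open_nbhs_nbhs.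
  by rewrite /= hpsi.
by rewrite dc e derive0.
Unshelve. all: by end_near. Qed.

(** The tangent space does not depend on the parametrization: by the chain rule for
the transition map. *)
Lemma param_tangent U phi u X : is_parametrization S U phi -> U u ->
  tangent k S (phi u) X <-> exists w, X = 'D_w phi u.
Proof.
move=> hp Uu; split=> [[U2 [phi2 [u2 [w [hp2 Uu2 e2 ->]]]]]|[w ->]]; last first.
  by exists U, phi, u, w; split => //; rewrite deriveE//; exact: param_diff hp Uu.
have [|D [tau [oD Du DU [dtau _] htau]]] := param_transition hp hp2 Uu2.
  by exists u.
have [Ut et] := htau _ Du.
have tu : tau u2 = u by apply: (param_inj hp) => //; rewrite et.
have dp := param_diff hp Ut.
have [_ dc] := derive_comp w (dtau _ Du) dp.
exists ('D_w tau u2); rewrite -tu -dc -deriveE; last exact: param_diff hp2 Uu2.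
apply: near_eq_derive; near=> y.
have Dy : D y by near: y; exact: open_nbhs_nbhs.
by rewrite /= (htau y Dy).2.
Unshelve. all: by end_near. Qed.

Lemma field_along {F : normedModType R} U phi u (Y Y' : 'rV[R]_N -> F) :
  is_parametrization S U phi -> U u -> is_local_extension S Y (phi u) Y' ->
  exists D : set 'rV[R]_k, [/\ open D, D u, D `<=` U, Ck_on D 1 (Y' \o phi) &
    forall y, D y -> (Y \o phi) y = (Y' \o phi) y].
Proof.
move=> hp Uu [W [oW Wu sY e]].
exists (U `&` phi @^-1` W); split.
- by apply: open_preimage => //; [exact: param_open hp|move=> x Ux; exact: param_cont hp Ux].
- by split.
- by move=> x [].
- apply: (Ck1_comp (U' := W) _ _ (Ck_on_subset _ (param_Ck 1 hp)) (sY 1)).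
  + by apply: open_preimage => //; [exact: param_open hp|move=> x Ux; exact: param_cont hp Ux].
  + by move=> x [].
  + by move=> x [].
- by move=> y [Uy Wy] /=; rewrite e//; exact: param_in hp Uy.
Qed.

Lemma C1_local {V : normedModType R} (U : set V) (f : V -> R) :
  (forall u, U u -> exists2 D : set V, D u & C1 D f) -> C1 U f.
Proof. by move=> h u Uu; have [D Du c] := h u Uu; exact: c. Qed.

Lemma field_along_C1 U phi (Y : 'rV[R]_N -> R) : is_parametrization S U phi ->
  smooth_on_subset S Y -> C1 U (fun y => Y (phi y)).
Proof.
move=> hp sY; apply: C1_local => u Uu.
have [Y' hY'] := sY _ (param_in hp Uu).
have [D [oD Du DU cD eD]] := field_along hp Uu hY'.
by exists D => //; apply: (C1_ext oD eD); exact: C1_of_Ck.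
Qed.

Lemma field_along_C1v j U phi (Y : 'rV[R]_N -> 'rV[R]_j) i : is_parametrization S U phi ->
  smooth_on_subset S Y -> C1 U (fun y => Y (phi y) 0 i).
Proof.
move=> hp sY; apply: C1_local => u Uu.
have [Y' hY'] := sY _ (param_in hp Uu).
have [D [oD Du DU cD eD]] := field_along hp Uu hY'.
exists D => //; apply: (C1_ext oD (g := fun y => (Y' \o phi) y 0 i)).
  by move=> x Dx; rewrite -eD.
exact: C1_entry.
Qed.
End Parametrizations.

Section CovAlong.
Context {R : realType} {n : nat} (m : R) (S : set 'rV[R]_n.+1).

(** The chosen extension of Y enters only through its derivative along phi, that is
through the restriction of Y to the submanifold. *)
Lemma cov_along_param U phi u (Y : 'rV[R]_n.+1 -> 'rV[R]_n.+1) :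
  is_parametrization (k := n.-1) S U phi -> U u ->
  (exists Y', is_local_extension S Y (phi u) Y') ->
  forall w, is_derive u w (Y \o phi) (\sum_i w 0 i *: 'D_(delta_mx 0 i) (Y \o phi) u) /\
  cov_along m S Y (phi u) ('D_w phi u) =
    \sum_i w 0 i *: 'D_(delta_mx 0 i) (Y \o phi) u + Gam m (phi u) ('D_w phi u) (Y (phi u)).
Proof.
move=> hp Uu hY w.
rewrite /cov_along; set Y' := xget _ _.
have hY' : is_local_extension S Y (phi u) Y' by exact: xgetPex hY.
have [D [oD Du DU cD eD]] := field_along hp Uu hY'.
have [W [oW Wu sY e]] := hY'.
have [dY _] := sY 1.
have dc : differentiable (Y' \o phi) u by apply: differentiable_comp; [exact: param_diff hp Uu|exact: dY].
have dE v := (derive_comp v (param_diff hp Uu) (dY _ Wu)).2.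
have nE : \near u, (Y' \o phi) u = (Y \o phi) u.
  near=> y; have Dy : D y by near: y; exact: open_nbhs_nbhs.
  by rewrite eD.
have sE : \sum_i w 0 i *: 'D_(delta_mx 0 i) (Y \o phi) u = 'D_w (Y' \o phi) u.
  rewrite (derive_delta _ dc); apply: eq_bigr => i _; congr (_ *: _).
  by apply: near_eq_derive; near=> y; apply/esym; near: y; exact: nE.
rewrite sE; split.
  by apply: (near_eq_is_derive nE); apply: derivableP; exact: diff_derivable.
rewrite /levi_civita -dE /Gam e//; exact: param_in hp Uu.
Unshelve. all: by end_near. Qed.

Lemma local_extension_restrict {F : normedModType R} (W : set 'rV[R]_n.+1)
    (Y Y' : 'rV[R]_n.+1 -> F) p : open W -> W p ->
  is_local_extension (S `&` W) Y p Y' -> is_local_extension S Y p Y'.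
Proof.
move=> oW Wp [W' [oW' Wp' sY e]]; exists (W `&` W'); split => //.
- exact: openI.
- by move=> j; apply: (Ck_on_subset _ (sY j)) => x [].
- by move=> q Sq [Wq Wq']; apply: e.
Qed.
End CovAlong.

(** * The metric of a submanifold in a chart *)

Lemma linear_bigsum {R : realType} k (F : 'rV[R]_k -> R) (I : Type) (r : seq I)
    (a : I -> R) (X : I -> 'rV[R]_k) :
  (forall a x y, F (a *: x + y) = a * F x + F y) ->
  F (\sum_(i <- r) a i *: X i) = \sum_(i <- r) a i * F (X i).
Proof.
move=> hF; elim: r => [|i r IH]; last by rewrite !big_cons hF IH.
by rewrite !big_nil; have := hF (-1) 0 0; rewrite scaler0 addr0 mulN1r addNr.
Qed.

Section Chart.
Context {R : realType} {n : nat} (m : R) (hn : (3 <= n)%N) (hm : 0 <= m).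
Variables (S : set 'rV[R]_n.+1) (HS : S `<=` schwarzschild m) (Hsp : is_spacelike m S).
Variables (U : set 'rV[R]_n.-1) (phi : 'rV[R]_n.-1 -> 'rV[R]_n.+1).
Hypothesis hp : is_parametrization S U phi.

Definition coord_field (phi : 'rV[R]_n.-1 -> 'rV[R]_n.+1) (i : 'I_n.-1) (y : 'rV[R]_n.-1) : 'rV[R]_n.+1 :=
  'D_(delta_mx 0 i) phi y.

Local Notation P i y := (coord_field phi i y).

Definition gram (phi : 'rV[R]_n.-1 -> 'rV[R]_n.+1) (y : 'rV[R]_n.-1) : 'M[R]_n.-1 :=
  \matrix_(i, j) gbar m (phi y) (coord_field phi i y) (coord_field phi j y).

Local Notation G y := (gram phi y).
Local Notation Gi y := (invmx (gram phi y)).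

Let oU : open U. Proof. exact: param_open hp. Qed.

Let Uphi y : U y -> schwarzschild m (phi y).
Proof. by move=> Uy; apply: HS; exact: param_in hp Uy. Qed.

Let gl (p Z : 'rV[R]_n.+1) : schwarzschild m p -> forall a x y, gbar m p (a *: x + y) Z = a * gbar m p x Z + gbar m p y Z.
Proof. by move=> h a x y; exact: gbarPl. Qed.
Let gr (p Z : 'rV[R]_n.+1) : schwarzschild m p -> forall a x y, gbar m p Z (a *: x + y) = a * gbar m p Z x + gbar m p Z y.
Proof. by move=> h a x y; exact: gbarPr. Qed.

Lemma derive_coord_field y w : U y -> 'D_w phi y = \sum_i w 0 i *: P i y.
Proof. by move=> Uy; apply: derive_delta; exact: param_diff hp Uy. Qed.

Lemma chart_tangent y X : U y ->
  tangent n.-1 S (phi y) X <-> exists w : 'rV[R]_n.-1, X = \sum_i w 0 i *: P i y.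
Proof.
move=> Uy; rewrite (param_tangent X hp Uy).
by split=> -[w ->]; exists w; rewrite derive_coord_field.
Qed.

Lemma coord_field_tangent y i : U y -> tangent n.-1 S (phi y) (P i y).
Proof.
by move=> Uy; apply/(param_tangent _ hp Uy); exists (delta_mx 0 i).
Qed.

Lemma gram_sym y : U y -> (G y)^T = G y.
Proof.
move=> Uy; apply/matrixP => i j; rewrite [LHS]mxE [LHS]mxE [RHS]mxE.
exact: (gbarC hn hm _ _ (Uphi Uy)).
Qed.

Lemma gram_unit y : U y -> G y \in unitmx.
Proof.
move=> Uy; have Ry := Uphi Uy; apply: unitmx_ker0 => w w0; apply/eqP/negPn/negP => wn0.
have X0 : 'D_w phi y != 0 by apply: contra wn0 => /eqP /(param_derive_eq0 hp Uy) ->.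
have := Hsp (param_in hp Uy) ((param_tangent _ hp Uy).2 (ex_intro _ w erefl)) X0.
rewrite derive_coord_field// (linear_bigsum _ _ _ (gr _ Ry)) big1 ?ltxx// => j _.
rewrite (linear_bigsum _ _ _ (gl _ Ry)).
move/rowP: w0 => /(_ j); rewrite !mxE => e; apply/eqP; rewrite mulf_eq0; apply/orP; right.
apply/eqP; rewrite -[RHS]e; by apply: eq_bigr => i _; rewrite mxE.
Qed.

Lemma gram_inv_sym y i j : U y -> Gi y i j = Gi y j i.
Proof. by move=> Uy; rewrite -[in LHS](gram_sym Uy) -trmx_inv mxE. Qed.

Lemma sum_gram_inv y i j : U y -> \sum_l Gi y i l * gbar m (phi y) (P l y) (P j y) = (i == j)%:R.
Proof.
move=> Uy; have := mulVmx (gram_unit Uy) => /matrixP/(_ i j); rewrite !mxE => <-.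
by apply: eq_bigr => l _; rewrite mxE.
Qed.

(** The orthogonal projection onto the tangent space, written with the inverse of the
Gram matrix. *)
Definition tan_part y X : 'rV[R]_n.+1 :=
  \sum_i (\sum_j Gi y i j * gbar m (phi y) X (P j y)) *: P i y.

Lemma normal_chart y X : U y ->
  normal m S (phi y) X <-> forall j, gbar m (phi y) X (P j y) = 0.
Proof.
move=> Uy; have Ry := Uphi Uy; split=> [h j|h Y /(chart_tangent _ Uy)[w ->]].
  by apply: h; exact: coord_field_tangent.
by rewrite (linear_bigsum _ _ _ (gr _ Ry)) big1// => j _; rewrite h mulr0.
Qed.

Lemma gbar_tan_part y X l : U y ->
  gbar m (phi y) (tan_part y X) (P l y) = gbar m (phi y) X (P l y).
Proof.
move=> Uy; have Ry := Uphi Uy; rewrite /tan_part (linear_bigsum _ _ _ (gl _ Ry)).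
under eq_bigr do rewrite mulr_suml.
rewrite exchange_big/= (bigD1 l)//= [X in _ + X]big1 ?addr0.
  under eq_bigr do rewrite mulrAC gram_inv_sym//.
  by rewrite -mulr_suml sum_gram_inv// eqxx mul1r.
move=> j jl; under eq_bigr do rewrite mulrAC gram_inv_sym//.
by rewrite -mulr_suml sum_gram_inv// (negbTE jl) mul0r.
Qed.

Lemma tan_part_linear y a X Y : U y -> tan_part y (a *: X + Y) = a *: tan_part y X + tan_part y Y.
Proof.
move=> Uy; have Ry := Uphi Uy; rewrite /tan_part scaler_sumr -big_split; apply: eq_bigr => i _ /=.
rewrite scalerA -scalerDl mulr_sumr -big_split; congr (_ *: _); apply: eq_bigr => j _ /=.
by rewrite gl//; ring.
Qed.

(** Removing the tangential projection leaves a normal vector; the decomposition is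
unique because the induced metric is definite. *)
Lemma perpE y X : U y -> perp m S (phi y) X = X - tan_part y X.
Proof.
move=> Uy; have Ry := Uphi Uy.
have gN V W : gbar m (phi y) (V - W) = (fun Z => gbar m (phi y) V Z - gbar m (phi y) W Z).
  by apply/funext => Z; rewrite -scaleN1r addrC gl//; ring.
have ex : [set Z | normal m S (phi y) Z /\ tangent n.-1 S (phi y) (X - Z)] (X - tan_part y X).
  split; first by apply/(normal_chart _ Uy) => j; rewrite gN gbar_tan_part// subrr.
  rewrite subKr; apply/(chart_tangent _ Uy).
  exists (\row_i \sum_j Gi y i j * gbar m (phi y) X (P j y)).
  by apply: eq_bigr => i _; rewrite mxE.
have [n1 t1] : [set Z | normal m S (phi y) Z /\ tangent n.-1 S (phi y) (X - Z)] (perp m S (phi y) X).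
  exact: xgetPex (ex_intro _ _ ex).
have [n2 t2] := ex.
apply/eqP; rewrite -subr_eq0; apply/negPn/negP => nz.
set Z1 := perp m S (phi y) X in n1 t1 nz *; set Z2 := X - tan_part y X in n2 t2 nz *.
have tt : tangent n.-1 S (phi y) (Z1 - Z2).
  move: t1 t2 => /(chart_tangent _ Uy)[w1 e1] /(chart_tangent _ Uy)[w2 e2].
  apply/(chart_tangent _ Uy); exists (w2 - w1).
  have sub3 (a b c : 'rV[R]_n.+1) : c - b = (a - b) - (a - c).
    by apply/rowP => j; rewrite !mxE; ring.
  rewrite (sub3 X).
  rewrite e1 e2 -sumrB; apply: eq_bigr => i _.
  by rewrite !mxE scalerBl.
have := Hsp (param_in hp Uy) tt nz.
by rewrite gN (n1 _ tt) (n2 _ tt) subrr ltxx.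
Qed.

Lemma perp_linear y a X Y : U y ->
  perp m S (phi y) (a *: X + Y) = a *: perp m S (phi y) X + perp m S (phi y) Y.
Proof.
move=> Uy; rewrite !perpE// tan_part_linear// scalerBr opprD !addrA.
by congr (_ + _); rewrite addrAC.
Qed.

Lemma perp_sum y (I : Type) (r : seq I) (a : I -> R) (X : I -> 'rV[R]_n.+1) : U y ->
  perp m S (phi y) (\sum_(i <- r) a i *: X i) = \sum_(i <- r) a i *: perp m S (phi y) (X i).
Proof.
move=> Uy; elim: r => [|i r IH]; last by rewrite !big_cons perp_linear// IH.
rewrite !big_nil; have := perp_linear (-1) 0 0 Uy.
by rewrite scaler0 addr0 scaleN1r addNr.
Qed.

Lemma perp_tangent y X : U y -> tangent n.-1 S (phi y) X -> perp m S (phi y) X = 0.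
Proof.
move=> Uy /(chart_tangent _ Uy)[w ->].
rewrite perp_sum// big1// => i _; rewrite perpE//.
rewrite (_ : tan_part y (P i y) = P i y) ?subrr ?scaler0//.
rewrite /tan_part (bigD1 i)//= [X in _ + X]big1 ?addr0.
  by under eq_bigr do rewrite (gbarC hn hm _ _ (Uphi Uy)); rewrite sum_gram_inv// eqxx scale1r.
move=> j ji; under eq_bigr do rewrite (gbarC hn hm _ _ (Uphi Uy)).
by rewrite sum_gram_inv// (negbTE ji) scale0r.
Qed.

(** The coordinates of a tangent vector are recovered by pairing with the coordinate
fields and applying the inverse Gram matrix. *)
Lemma coord_coef u (v : 'I_n.-1 -> R) i : U u ->
  \sum_j gbar m (phi u) (\sum_l v l *: P l u) (P j u) * Gi u j i = v i.
Proof.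
move=> Uu; have Ru := Uphi Uu.
under eq_bigr do rewrite (linear_bigsum _ _ _ (gl _ Ru)) mulr_suml.
rewrite exchange_big/=.
rewrite (bigD1 i)//= [X in _ + X]big1 ?addr0.
  under eq_bigr do rewrite -mulrA (mulrC (gbar _ _ _ _)) (gram_inv_sym _ _ Uu) (gbarC hn hm _ _ Ru).
  by rewrite -mulr_sumr sum_gram_inv// eqxx mulr1.
move=> j ji; under eq_bigr do rewrite -mulrA (mulrC (gbar _ _ _ _)) (gram_inv_sym _ _ Uu) (gbarC hn hm _ _ Ru).
by rewrite -mulr_sumr sum_gram_inv// eq_sym (negbTE ji) mulr0.
Qed.

Section Frame.
Variables (y : 'rV[R]_n.-1) (Uy : U y) (e : 'I_n.-1 -> 'rV[R]_n.+1).
Hypotheses (te : forall a, tangent n.-1 S (phi y) (e a))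
  (oe : forall a b, gbar m (phi y) (e a) (e b) = (a == b)%:R).

Definition frame_mx : 'M[R]_n.-1 :=
  \matrix_(a, i) \sum_j gbar m (phi y) (e a) (P j y) * Gi y j i.

Lemma frame_mxE a : e a = \sum_i frame_mx a i *: P i y.
Proof.
have [w ew] := (chart_tangent _ Uy).1 (te a).
by rewrite [LHS]ew; apply: eq_bigr => i _; congr (_ *: _); rewrite mxE ew coord_coef.
Qed.

Lemma frame_gram : frame_mx *m G y *m frame_mx^T = 1%:M.
Proof.
have Ry := Uphi Uy; apply/matrixP => a b; rewrite [RHS]mxE -oe (frame_mxE a) (frame_mxE b).
rewrite (linear_bigsum _ _ _ (gr _ Ry)) mxE; apply: eq_bigr => j _.
have -> : frame_mx^T j b = frame_mx b j by rewrite mxE.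
rewrite (linear_bigsum _ _ _ (gl _ Ry)) mulrC; congr (_ * _); rewrite [LHS]mxE.
by apply: eq_bigr => i _; congr (_ * _); rewrite mxE.
Qed.

(** From E G E^T = 1 follows E^T E = G^-1: the sum of the e_a (x) e_a is the inverse
metric, whatever the frame. *)
Lemma frame_trace : frame_mx^T *m frame_mx = Gi y.
Proof.
have h5 := mulmx1C frame_gram; rewrite mulmxA in h5.
by rewrite -[LHS](mulmxK (gram_unit Uy)) h5 mul1mx.
Qed.

(** An orthonormal frame E gives (det E)^2 det G = 1. *)
Lemma gram_det_gt0 : 0 < \det (G y).
Proof.
have := congr1 determinant frame_gram; rewrite !det_mulmx det_tr det1 => h.
have f0 : \det frame_mx != 0.
  by apply/negP => /eqP d0; move: h; rewrite d0 !mul0r => /eqP; rewrite eq_sym oner_eq0.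
have : 0 < \det frame_mx ^+ 2 by rewrite exprn_even_gt0//= f0.
have : \det frame_mx ^+ 2 * \det (G y) = 1 by rewrite -h; ring.
by move=> e1 e2; rewrite -(pmulr_rgt0 _ e2) e1.
Qed.

Lemma frame_sum (B : 'rV[R]_n.+1 -> 'rV[R]_n.+1 -> R) :
  (forall Z a X Y, B (a *: X + Y) Z = a * B X Z + B Y Z) ->
  (forall Z a X Y, B Z (a *: X + Y) = a * B Z X + B Z Y) ->
  \sum_a B (e a) (e a) = \sum_i \sum_j Gi y i j * B (P i y) (P j y).
Proof.
move=> Bl Br.
have E a : B (e a) (e a) = \sum_i \sum_j frame_mx a i * frame_mx a j * B (P i y) (P j y).
  rewrite frame_mxE (linear_bigsum _ _ _ (Bl _)); apply: eq_bigr => i _.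
  by rewrite (linear_bigsum _ _ _ (Br _)) mulr_sumr; apply: eq_bigr => j _; rewrite mulrA.
under eq_bigr do rewrite E.
rewrite exchange_big; apply: eq_bigr => i _ /=; rewrite exchange_big; apply: eq_bigr => j _ /=.
rewrite -mulr_suml; congr (_ * _); rewrite -frame_trace mxE.
by apply: eq_bigr => a _; congr (_ * _); rewrite [RHS]mxE.
Qed.
End Frame.
End Chart.

(** * The divergence identity in a chart *)

Lemma continuous_sumr {R : realType} {V : normedModType R} (I : Type) (r : seq I) (f : I -> V -> R) u :
  (forall i, {for u, continuous (f i)}) ->
  {for u, continuous (fun y => \sum_(i <- r) f i y)}.
Proof.
move=> h; elim: r => [|i r IH].
  have -> : (fun y => \sum_(i <- [::]) f i y) = (fun=> 0) by apply/funext => y; rewrite big_nil.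
  exact: (C1_cont (C1_cst openT (0 : R)) (Logic.I : setT u)).
have -> : (fun y => \sum_(j <- i :: r) f j y) = (fun y => f i y + \sum_(j <- r) f j y).
  by apply/funext => y; rewrite big_cons.
by apply: (@cvgD _ _ _ (nbhs u)); [exact: h|exact: IH].
Qed.

Lemma continuous_mulr {R : realType} {V : normedModType R} (f g : V -> R) u : {for u, continuous f} ->
  {for u, continuous g} -> {for u, continuous (fun y => f y * g y)}.
Proof. by move=> cf cg; apply: (@cvgM _ _ (nbhs u)); [exact: cf|exact: cg]. Qed.

Lemma continuous_addr {R : realType} {V : normedModType R} (f g : V -> R) u :
  {for u, continuous f} -> {for u, continuous g} -> {for u, continuous (fun y => f y + g y)}.
Proof. by move=> cf cg; apply: (@cvgD _ _ _ (nbhs u)); [exact: cf|exact: cg]. Qed.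

Section ChristoffelBilinear.
Context {R : realType} {n : nat} (m : R) (hn : (3 <= n)%N) (hm : 0 <= m).
Implicit Types (p X Y Z : 'rV[R]_n.+1).
Local Notation region := (@schwarzschild R n m).

Lemma gbar_nondegenerate p X Y : region p ->
  (forall Z, gbar m p X Z = gbar m p Y Z) -> X = Y.
Proof.
move=> h e; rewrite -[LHS](mulmxK (gmx_unit hn hm h)) -[RHS](mulmxK (gmx_unit hn hm h)).
by congr (_ *m _); apply/rowP => l; rewrite !(gmxE hn hm)// e.
Qed.

Lemma GamPl p a X Y Z : region p -> Gam m p (a *: X + Y) Z = a *: Gam m p X Z + Gam m p Y Z.
Proof.
move=> h; apply: (gbar_nondegenerate h) => T.
by rewrite (gbarPl hn hm)// !(gbar_Gam hn hm)// !(dgmP1, dgmP2); ring.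
Qed.

Lemma GamC p X Y : region p -> Gam m p X Y = Gam m p Y X.
Proof.
move=> h; apply: (gbar_nondegenerate h) => T.
by rewrite !(gbar_Gam hn hm)// (dgmC _ _ T X Y); ring.
Qed.

Lemma GamPr p a X Y Z : region p -> Gam m p Z (a *: X + Y) = a *: Gam m p Z X + Gam m p Z Y.
Proof. by move=> h; rewrite !(GamC Z)// GamPl. Qed.

Lemma Gam_sum p (I : finType) (a b : I -> R) (X Y : I -> 'rV[R]_n.+1) : region p ->
  Gam m p (\sum_i a i *: X i) (\sum_j b j *: Y j) =
  \sum_i a i *: \sum_j b j *: Gam m p (X i) (Y j).
Proof.
move=> h; apply/rowP => c.
rewrite (linear_bigsum (F := fun V => Gam m p V _ 0 c)); last first.
  by move=> x V V'; rewrite GamPl// !mxE.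
rewrite summxE; apply: eq_bigr => i _; rewrite [RHS]mxE; congr (_ * _).
rewrite (linear_bigsum (F := fun V => Gam m p _ V 0 c)); last first.
  by move=> x V V'; rewrite GamPr// !mxE.
by rewrite summxE; apply: eq_bigr => j _; rewrite [RHS]mxE.
Qed.
End ChristoffelBilinear.

(** The part of the divergence that comes from differentiating the metric.  Here g
is the inverse Gram matrix, A i j l = <D_i P_j, P_l> is symmetric in its first two
indices, and A i a b + A i b a is the derivative of the Gram matrix; the derivative of
the volume density cancels one of these two terms in that of the inverse matrix. *)
Lemma divergence_algebra {R : realType} k (g : 'I_k -> 'I_k -> R) (A : 'I_k -> 'I_k -> 'I_k -> R)
    (W : 'I_k -> R) : (forall i j, g i j = g j i) -> (forall i j l, A i j l = A j i l) ->
  \sum_i (2^-1 * \sum_a \sum_b (A i a b + A i b a) * g b a) * W i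
  - \sum_i \sum_a \sum_b g i a * (A i a b + A i b a) * W b =
  - \sum_i \sum_a \sum_b g i a * A i a b * W b.
Proof.
move=> gs As.
have E1 i : \sum_a \sum_b (A i a b + A i b a) * g b a = 2 * \sum_a \sum_b A i a b * g a b.
  transitivity (\sum_a \sum_b A i a b * g a b + \sum_a \sum_b A i b a * g b a).
    by rewrite -big_split; apply: eq_bigr => a _; rewrite -big_split; apply: eq_bigr => b _ /=; rewrite (gs b a); ring.
  by rewrite [X in _ + X]exchange_big /=; ring.
have E2 : \sum_i (2^-1 * \sum_a \sum_b (A i a b + A i b a) * g b a) * W i =
   \sum_i \sum_a \sum_b g i a * A i b a * W b.
  transitivity (\sum_i \sum_a \sum_b A i a b * g a b * W i).
    apply: eq_bigr => i _; rewrite E1 mulrA mulVf ?mul1r ?pnatr_eq0// mulr_suml.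
    by apply: eq_bigr => a _; rewrite mulr_suml.
  under [RHS]eq_bigr do rewrite exchange_big.
  rewrite [RHS]exchange_big /=; apply: eq_bigr => i _; apply: eq_bigr => a _; apply: eq_bigr => b _.
  by rewrite (As i a); ring.
rewrite E2 -sumrB -sumrN; apply: eq_bigr => i _; rewrite -sumrB -sumrN; apply: eq_bigr => a _.
by rewrite -sumrB -sumrN; apply: eq_bigr => b _; ring.
Qed.

Lemma sym_antisym {R : realType} k (C Q : 'I_k -> 'I_k -> R) : (forall i j, C i j = C j i) ->
  (forall i j, Q i j = - Q j i) -> \sum_i \sum_j C i j * Q i j = 0.
Proof.
move=> cs qa; set s := LHS.
have : s = - s.
  rewrite {1}/s exchange_big -sumrN; apply: eq_bigr => i _; rewrite -sumrN; apply: eq_bigr => j _ /=.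
  by rewrite cs qa mulrN.
by move=> e; lra.
Qed.

Lemma cofactor_invmx {R : fieldType} k (A : 'M[R]_k) i j : A \in unitmx ->
  cofactor A i j = \det A * invmx A j i.
Proof.
move=> uA; rewrite /invmx uA !mxE mulrA mulfV ?mul1r//.
by move: uA; rewrite unitmxE unitfE.
Qed.

Lemma trace_symmetrize {R : realType} k (g D E : 'I_k -> 'I_k -> R) :
  (forall i j, g i j = g j i) -> (forall i j, D i j + D j i = E i j) ->
  \sum_i \sum_j g i j * D i j = 2^-1 * \sum_i \sum_j g i j * E i j.
Proof.
move=> gs h; set s := LHS.
have e : s = \sum_i \sum_j g i j * D j i.
  by rewrite /s exchange_big; apply: eq_bigr => i _ /=; apply: eq_bigr => j _; rewrite (gs j i).
have -> : \sum_i \sum_j g i j * E i j = s + s.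
  rewrite {2}e /s -big_split; apply: eq_bigr => i _ /=; rewrite -big_split.
  by apply: eq_bigr => j _ /=; rewrite -h mulrDr.
by move: s {e} => s; field.
Qed.

Lemma Killing_Yano_normal {R : realType} {n : nat} (m : R) (hn : (3 <= n)%N) (hm : 0 <= m)
    (p X Y Z : 'rV[R]_n.+1) : schwarzschild m p ->
  gbar m p X Z = 0 -> gbar m p Y Z = 0 ->
  DQ m p X Y Z + DQ m p Y X Z = -2 * gbar m p X Y * gbar m p ddt Z.
Proof.
by move=> Rp xz yz; rewrite (conformal_Killing_Yano hn hm _ _ _ Rp) xz yz !mul0r !addr0.
Qed.

Section Divergence.
Context {R : realType} {n : nat} (m : R) (hn : (3 <= n)%N) (hm : 0 <= m).
Variables (S : set 'rV[R]_n.+1) (HS : S `<=` schwarzschild m) (Hsp : is_spacelike m S).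
Variables (U : set 'rV[R]_n.-1) (phi : 'rV[R]_n.-1 -> 'rV[R]_n.+1).
Hypothesis hp : is_parametrization S U phi.
Variable (L : 'rV[R]_n.+1 -> 'rV[R]_n.+1).
Hypotheses (sL : smooth_on_subset S L) (nL : forall p, S p -> normal m S p (L p)).
Variable (e : 'rV[R]_n.+1 -> 'I_n.-1 -> 'rV[R]_n.+1 -> 'rV[R]_n.+1).
Hypothesis he : forall p, S p -> exists W : set 'rV[R]_n.+1,
    [/\ open W, W p, forall a, smooth_on_subset (S `&` W) (e p a) &
     forall q, S q -> W q ->
     (forall a, tangent n.-1 S q (e p a q)) /\
     (forall a b, gbar m q (e p a q) (e p b q) = (a == b)%:R)].

Local Notation P i y := (coord_field phi i y).
Local Notation G y := (gram m phi y).
Local Notation Gi y := (invmx (gram m phi y)).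
Local Notation ei i := (delta_mx 0 i : 'rV[R]_n.-1).

Let oU : open U. Proof. exact: param_open hp. Qed.
Let Uphi y : U y -> schwarzschild m (phi y).
Proof. by move=> Uy; apply: HS; exact: param_in hp Uy. Qed.

Let gl (p Z : 'rV[R]_n.+1) : schwarzschild m p -> forall a x y, gbar m p (a *: x + y) Z = a * gbar m p x Z + gbar m p y Z.
Proof. by move=> h a x y; exact: gbarPl. Qed.
Let gr (p Z : 'rV[R]_n.+1) : schwarzschild m p -> forall a x y, gbar m p Z (a *: x + y) = a * gbar m p Z x + gbar m p Z y.
Proof. by move=> h a x y; exact: gbarPr. Qed.
Let ql (p Z : 'rV[R]_n.+1) : schwarzschild m p -> forall a x y, Qform p (a *: x + y) Z = a * Qform p x Z + Qform p y Z.
Proof. by move=> h a x y; exact: (QformPl hn hm _ _ _ _ h). Qed.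
Let qr (p Z : 'rV[R]_n.+1) : schwarzschild m p -> forall a x y, Qform p Z (a *: x + y) = a * Qform p Z x + Qform p Z y.
Proof. by move=> h a x y; exact: (QformPr hn hm _ _ _ _ h). Qed.

Let cphi j : C1 U (fun y => phi y 0 j).
Proof. exact: (C1_entry _ oU (param_Ck 1 hp)). Qed.

Let cP i j : C1 U (fun y => P i y 0 j).
Proof. by have [_ c] := param_Ck 2 hp; exact: (C1_entry _ oU (c (ei i))). Qed.

Let cL j : C1 U (fun y => L (phi y) 0 j).
Proof. exact: field_along_C1v hp sL. Qed.

Let dP i j u : U u -> is_derive u (ei i) (coord_field phi j) ('D_(ei i) (coord_field phi j) u).
Proof.
move=> Uu; have [_ /(_ (ei j))[d _]] := param_Ck 2 hp.
by apply: derivableP; exact: diff_derivable (d u Uu).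
Qed.

Let dphi i u : U u -> is_derive u (ei i) phi (P i u).
Proof. by move=> Uu; apply: derivableP; exact: diff_derivable (param_diff hp Uu). Qed.

Let dL i u : U u -> is_derive u (ei i) (L \o phi) ('D_(ei i) (L \o phi) u).
Proof.
move=> Uu; have [h _] := cov_along_param m hp Uu (sL (param_in hp Uu)) (ei i).
exact: derivableP (@ex_derive _ _ _ _ _ _ _ h).
Qed.

Let normL y j : U y -> gbar m (phi y) (L (phi y)) (P j y) = 0.
Proof.
move=> Uy; apply: nL; first exact: param_in hp Uy.
exact: (coord_field_tangent hp).
Qed.

(** The covariant derivative of the j-th coordinate field in the direction of the
i-th one; its normal part is the second fundamental form. *)
Definition second_cov u i j : 'rV[R]_n.+1 :=
  'D_(ei i) (coord_field phi j) u + Gam m (phi u) (P i u) (P j u).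
Definition cov_L u i : 'rV[R]_n.+1 :=
  'D_(ei i) (L \o phi) u + Gam m (phi u) (P i u) (L (phi u)).

(** Second derivatives commute and the connection has no torsion. *)
Lemma second_cov_sym u i j : U u -> second_cov u i j = second_cov u j i.
Proof.
move=> Uu; have gC := GamC hn hm (P i u) (P j u) (Uphi Uu).
apply: (etrans (congr1 (fun z => 'D_(ei i) (coord_field phi j) u + z) gC)).
apply: (congr1 (fun z => z + Gam m (phi u) (P j u) (P i u))).
apply/rowP => a.
have dphiU x v : U x -> is_derive x v (fun y => phi y 0 a) ('D_v phi x 0 a).
  move=> Ux; apply: is_derive_entry; apply: derivableP.
  exact: diff_derivable (param_diff hp Ux).
have cD v : C1 U ('D_v (fun y => phi y 0 a)).
  have [_ c] := param_Ck 2 hp.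
  apply: (C1_ext oU (g := fun y => 'D_v phi y 0 a)); last exact: (C1_entry _ oU (c v)).
  by move=> x Ux; exact: (@derive_val _ _ _ _ _ _ _ (dphiU x v Ux)).
have E b c : 'D_(ei b) (coord_field phi c) u 0 a = 'D_(ei b) ('D_(ei c) (fun y => phi y 0 a)) u.
  rewrite -(@derive_val _ _ _ _ _ _ _ (is_derive_entry a (dP b c Uu))).
  apply: (@near_eq_derive _ _ _ (fun y => P c y 0 a) ('D_(ei c) (fun y => phi y 0 a))).
  apply: (filterS _ (open_nbhs_nbhs (conj oU Uu))) => y Uy.
  exact: (esym (@derive_val _ _ _ _ _ _ _ (dphiU y (ei c) Uy))).
have dd x v : U x -> derivable (fun y => phi y 0 a) x v.
  by move=> Ux; exact: (@ex_derive _ _ _ _ _ _ _ (dphiU x v Ux)).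
exact: (etrans (E i j) (etrans (derive_commute (ei j) (ei i) oU dd cD Uu) (esym (E j i)))).
Qed.

Let A u i k l : R := gbar m (phi u) (second_cov u i k) (P l u).

Lemma derive_gram u i k l : U u -> is_derive u (ei i) (fun y => G y k l) (A u i k l + A u i l k).
Proof.
move=> Uu.
have E : (fun y => G y k l) = (fun y => gbar m (phi y) (P k y) (P l y)).
  by apply/funext => y; rewrite mxE.
rewrite E; apply: (is_derive_eq (metric_compatible hn hm oU Uphi Uu (dphi i Uu) (dP i k Uu) (dP i l Uu))).
by congr (_ + _); rewrite (gbarC hn hm _ _ (Uphi Uu)).
Qed.

(** The coefficients of the one-form X |-> Q(X, L). *)
Definition flux j y : R := Qform (phi y) (P j y) (L (phi y)).

Lemma derive_flux u i j : U u -> is_derive u (ei i) (flux j)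
  (DQ m (phi u) (P i u) (P j u) (L (phi u)) + Qform (phi u) (second_cov u i j) (L (phi u))
   + Qform (phi u) (P j u) (cov_L u i)).
Proof.
move=> Uu; exact: (is_derive_Qform hn hm oU Uphi Uu (dphi i Uu) (dP i j Uu) (dL i Uu)).
Qed.

Definition density y : R := Num.sqrt (\det (G y)).

Let framed y : U y -> exists e' : 'I_n.-1 -> 'rV[R]_n.+1,
  (forall a, tangent n.-1 S (phi y) (e' a)) /\
  (forall a b, gbar m (phi y) (e' a) (e' b) = (a == b)%:R).
Proof.
move=> Uy; have Sy := param_in hp Uy; have [W [oW Wy _ h]] := he Sy.
by have [h1 h2] := h _ Sy Wy; exists (e (phi y) ^~ (phi y)).
Qed.

Lemma det_gram_gt0 y : U y -> 0 < \det (G y).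
Proof. by move=> Uy; have [e' [t o]] := framed Uy; exact: (gram_det_gt0 hn hm HS Hsp hp Uy t o). Qed.

Lemma density_gt0 y : U y -> 0 < density y.
Proof. by move=> Uy; rewrite sqrtr_gt0 det_gram_gt0. Qed.

Lemma volume_densityE y : U y -> volume_density m phi y = density y.
Proof.
move=> Uy; rewrite /volume_density /density; congr (Num.sqrt (\det _)).
by apply/matrixP => i j; rewrite !mxE /coord_field !deriveE//; exact: param_diff hp Uy.
Qed.

Lemma C1_gram k l : C1 U (fun y => G y k l).
Proof.
have E y : U y -> G y k l = gbar m (phi y) (P k y) (P l y) by rewrite mxE.
exact: (C1_ext oU E (C1_gbar hn hm oU Uphi cphi (cP k) (cP l))).
Qed.

Lemma C1_gram_inv k l : C1 U (fun y => Gi y k l).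
Proof.
apply: (C1_invmx oU); last exact: C1_gram.
by move=> y Uy; exact: (gram_unit hn hm HS Hsp hp Uy).
Qed.

Lemma C1_density : C1 U density.
Proof. by apply: (C1_sqrt oU det_gram_gt0); apply: C1_det => //; exact: C1_gram. Qed.

Lemma C1_flux j : C1 U (flux j).
Proof. exact: (C1_Qform hn hm oU Uphi cphi (cP j) cL). Qed.

(** The components of the dual tangent field W, which is multiplied by the volume
density in [div_field]. *)
Definition field_coord i y : R := \sum_j Gi y i j * flux j y.
Definition div_field i y : R := density y * field_coord i y.

Lemma C1_field_coord i : C1 U (field_coord i).
Proof.
apply: C1_sum => // j; exact: (C1M oU (C1_gram_inv i j) (C1_flux j)).
Qed.

Lemma C1_div_field i : C1 U (div_field i).
Proof. exact: (C1M oU C1_density (C1_field_coord i)). Qed.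

(** Jacobi's formula, the cofactors being det G times the inverse matrix. *)
Lemma derive_density u i : U u -> 'D_(ei i) density u =
  density u * (2^-1 * \sum_a \sum_b (A u i a b + A u i b a) * Gi u b a).
Proof.
move=> Uu.
pose dA := \matrix_(a, b) (A u i a b + A u i b a).
have dG a b : is_derive u (ei i) (fun y => G y a b) (dA a b).
  by rewrite mxE; exact: derive_gram.
have d0 := det_gram_gt0 Uu.
rewrite (@derive_val _ _ _ _ _ _ _ (is_derive_sqrt (derive_det dG) d0)) -/(density u).
have E : \sum_a \sum_b dA a b * cofactor (G u) a b =
   density u ^+ 2 * \sum_a \sum_b (A u i a b + A u i b a) * Gi u b a.
  rewrite sqr_sqrtr ?(ltW d0)// mulr_sumr; apply: eq_bigr => a _; rewrite mulr_sumr.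
  apply: eq_bigr => b _.
  rewrite (cofactor_invmx _ _ (gram_unit hn hm HS Hsp hp Uu)) [dA a b]mxE.
  by move: (A u i a b + _) (\det _) (Gi u b a) => x y z; ring.
have dn0 : density u != 0 by rewrite lt0r_neq0// density_gt0.
by rewrite E; move: (\sum_a _) => s; field.
Qed.

(** Differentiate G^-1 G = 1. *)
Lemma derive_gram_inv u i a b : U u -> 'D_(ei i) (fun y => Gi y a b) u =
  - \sum_c \sum_d Gi u a c * (A u i c d + A u i d c) * Gi u d b.
Proof.
move=> Uu; have uG := gram_unit hn hm HS Hsp hp Uu.
pose dG := \matrix_(c, d) (A u i c d + A u i d c).
pose dGi := \matrix_(c, d) 'D_(ei i) (fun y => Gi y c d) u.
have E : dGi *m G u + Gi u *m dG = 0.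
  apply/matrixP => c d; rewrite mxE [X in X + _]mxE [X in _ + X]mxE -big_split /=.
  have h : is_derive u (ei i) (fun y => \sum_j Gi y c j * G y j d)
     (\sum_j (dGi c j * G u j d + Gi u c j * dG j d)).
    apply: is_derive_bigsum => j; apply: is_derive_mul.
      by rewrite mxE; exact: C1_is_derive (C1_gram_inv c j) Uu.
    by rewrite [dG j d]mxE; exact: derive_gram.
  have h0 : is_derive u (ei i) (fun y => \sum_j Gi y c j * G y j d) 0.
    apply: (is_derive_near oU Uu _ (is_derive_constant ((c == d)%:R : R) u (ei i))).
    move=> y Uy; have /matrixP/(_ c d) := mulVmx (gram_unit hn hm HS Hsp hp Uy).
    by rewrite !mxE.
  by rewrite -(@derive_val _ _ _ _ _ _ _ h) (@derive_val _ _ _ _ _ _ _ h0) mxE.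
have E2 : dGi = - (Gi u *m dG *m Gi u).
  apply/eqP; rewrite -addr_eq0; apply/eqP.
  by rewrite -[dGi](mulmxK uG) -mulmxDl E mul0mx.
move/matrixP: E2 => /(_ a b); rewrite [LHS]mxE => ->; rewrite mxE; congr (- _).
rewrite mxE exchange_big /=; apply: eq_bigr => d _; rewrite mxE mulr_suml.
by apply: eq_bigr => c _; rewrite [dG _ _]mxE.
Qed.

(** The tangential parts of the second derivatives are exactly what the derivatives
of the density and of the inverse metric compensate. *)
Lemma sum_derive_div_field u : U u ->
  \sum_i 'D_(ei i) (div_field i) u = density u * \sum_i \sum_j Gi u i j *
    (DQ m (phi u) (P i u) (P j u) (L (phi u))
     + Qform (phi u) (perp m S (phi u) (second_cov u i j)) (L (phi u))
     + Qform (phi u) (P j u) (cov_L u i)).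
Proof.
move=> Uu; have Ru := Uphi Uu.
have gs i j : Gi u i j = Gi u j i by exact: (gram_inv_sym hn hm HS hp).
have As i j l : A u i j l = A u j i l by rewrite /A second_cov_sym.
pose W i := field_coord i u.
pose dfl i j := DQ m (phi u) (P i u) (P j u) (L (phi u)) + Qform (phi u) (second_cov u i j) (L (phi u))
   + Qform (phi u) (P j u) (cov_L u i).
have E i : 'D_(ei i) (div_field i) u = density u *
   ((2^-1 * \sum_a \sum_b (A u i a b + A u i b a) * Gi u b a) * W i
    - \sum_a \sum_b Gi u i a * (A u i a b + A u i b a) * W b + \sum_j Gi u i j * dfl i j).
  have hV : is_derive u (ei i) (field_coord i)
     (\sum_j ('D_(ei i) (fun y => Gi y i j) u * flux j u + Gi u i j * dfl i j)).
    apply: is_derive_bigsum => j; apply: is_derive_mul; last exact: derive_flux.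
    exact: C1_is_derive (C1_gram_inv i j) Uu.
  have hD := C1_is_derive (ei i) C1_density Uu.
  rewrite (@derive_val _ _ _ _ _ _ _ (is_derive_mul hD hV)) (derive_density _ Uu) big_split /=.
  have -> : \sum_j 'D_(ei i) (fun y => Gi y i j) u * flux j u =
     - \sum_a \sum_b Gi u i a * (A u i a b + A u i b a) * W b.
    under eq_bigr do rewrite (derive_gram_inv _ _ _ Uu) mulNr mulr_suml.
    rewrite sumrN; congr (- _); rewrite exchange_big; apply: eq_bigr => a _ /=.
    under eq_bigr do rewrite mulr_suml.
    rewrite exchange_big; apply: eq_bigr => b _ /=; rewrite mulr_sumr.
    by apply: eq_bigr => j _; rewrite mulrA.
  by rewrite -/(W i); move: (\sum_a _) (\sum_a _) (\sum_j _) (W i) (density u) => s1 s2 s3 w d; ring.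
under eq_bigr do rewrite E.
rewrite -mulr_sumr; congr (_ * _); rewrite big_split big_split /= sumrN.
rewrite divergence_algebra// -sumrN -big_split; apply: eq_bigr => i _ /=.
rewrite -sumrN -big_split; apply: eq_bigr => j _ /=.
have -> : Qform (phi u) (perp m S (phi u) (second_cov u i j)) (L (phi u)) =
   Qform (phi u) (second_cov u i j) (L (phi u)) - \sum_b A u i j b * W b.
  rewrite (perpE hn hm HS Hsp hp)// -scaleN1r addrC ql// mulN1r addrC; congr (_ - _).
  rewrite /tan_part (linear_bigsum _ _ _ (ql _ Ru)).
  under eq_bigr do rewrite mulr_suml.
  rewrite exchange_big; apply: eq_bigr => b _ /=; rewrite mulr_sumr; apply: eq_bigr => l _.
  by rewrite (gs l b) /A /flux; ring.
rewrite /dfl; under eq_bigr do rewrite -mulrA.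
rewrite -mulr_sumr; move: (\sum_b _) => s; ring.
Qed.

(** Only the part of D Q symmetric in its first two arguments contributes, and L is
normal. *)
Lemma trace_DQ u : U u ->
  \sum_i \sum_j Gi u i j * DQ m (phi u) (P i u) (P j u) (L (phi u)) =
  - (n.-1)%:R * gbar m (phi u) ddt (L (phi u)).
Proof.
move=> Uu; have Ru := Uphi Uu.
have gs i j : Gi u i j = Gi u j i by exact: (gram_inv_sym hn hm HS hp).
have N l : gbar m (phi u) (P l u) (L (phi u)) = 0.
  by rewrite (gbarC hn hm _ (L (phi u)) Ru); exact: normL.
have K i j := Killing_Yano_normal hn hm Ru (N i) (N j).
rewrite (trace_symmetrize gs K).
under eq_bigr do under eq_bigr do rewrite mulrA.
under eq_bigr do rewrite -mulr_suml.
rewrite -mulr_suml; set t := \sum_i _.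
suff -> : t = -2 * (n.-1)%:R by move: (gbar m (phi u) ddt (L (phi u))) => x; field.
rewrite /t [RHS]mulrC mulr_natl -[in RHS](card_ord n.-1) -sumr_const.
apply: eq_bigr => i _.
transitivity (-2 * \sum_l Gi u i l * gbar m (phi u) (P l u) (P i u)).
  rewrite mulr_sumr; apply: eq_bigr => l _; have gC := gbarC hn hm (P l u) (P i u) Ru.
  exact: (etrans (congr1 (fun t => Gi u i l * (-2 * t)) (esym gC)) (mulrCA _ _ _)).
by rewrite (sum_gram_inv hn hm HS Hsp hp i i Uu) eqxx mulr1.
Qed.

(** The tangential part of D L has symmetric coefficients B: since <L, P_l> = 0 along
the chart, B i l = - <L, D_i P_l>.  Raising the indices of B keeps it symmetric, and
it is contracted with the antisymmetric form Q. *)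
Lemma trace_cov_L u : U u ->
  \sum_i \sum_j Gi u i j * Qform (phi u) (P j u) (cov_L u i) =
  \sum_i \sum_j Gi u i j * Qform (phi u) (P j u) (perp m S (phi u) (cov_L u i)).
Proof.
move=> Uu; have Ru := Uphi Uu.
have gs i j : Gi u i j = Gi u j i by exact: (gram_inv_sym hn hm HS hp).
pose B i l := gbar m (phi u) (cov_L u i) (P l u).
have Bs i l : B i l = B l i.
  have E a b : B a b = - gbar m (phi u) (L (phi u)) (second_cov u a b).
    have h := metric_compatible hn hm oU Uphi Uu (dphi a Uu) (dL a Uu) (dP a b Uu).
    have h0 : is_derive u (ei a) (fun y => gbar m (phi y) ((L \o phi) y) (coord_field phi b y)) 0.
      apply: (is_derive_near oU Uu _ (is_derive_constant (0 : R) u (ei a))).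
      by move=> y Uy; exact: normL.
    have : B a b + gbar m (phi u) (L (phi u)) (second_cov u a b) = 0.
      by rewrite -(@derive_val _ _ _ _ _ _ _ h0) (@derive_val _ _ _ _ _ _ _ h).
    by move/eqP; rewrite addr_eq0 => /eqP.
  by rewrite !E second_cov_sym.
have qB Z V W : Qform (phi u) Z (V - W) = Qform (phi u) Z V - Qform (phi u) Z W.
  by rewrite addrC -scaleN1r (qr _ Ru) mulN1r addrC.
apply/eqP; rewrite -subr_eq0 -sumrB; apply/eqP.
transitivity (\sum_j \sum_k (\sum_i \sum_l Gi u i j * B i l * Gi u l k) * Qform (phi u) (P j u) (P k u)); last first.
  apply: sym_antisym => j k; last exact: (QformC hn hm _ _ Ru).
  rewrite exchange_big; apply: eq_bigr => i _ /=; apply: eq_bigr => l _.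
  by rewrite (Bs l i); move: (Gi u l j) (B i l) (Gi u i k) => x y z; ring.
transitivity (\sum_i \sum_j Gi u i j * \sum_k (\sum_l Gi u k l * B i l) * Qform (phi u) (P j u) (P k u)).
  apply: eq_bigr => i _; rewrite -sumrB; apply: eq_bigr => j _; rewrite -mulrBr; congr (_ * _).
  rewrite (perpE hn hm HS Hsp hp)// qB subKr.
  by rewrite /tan_part (linear_bigsum _ _ _ (qr _ Ru)).
rewrite exchange_big; apply: eq_bigr => j _ /=.
under eq_bigr do rewrite mulr_sumr.
rewrite exchange_big; apply: eq_bigr => k _ /=; rewrite mulr_suml; apply: eq_bigr => i _.
rewrite !mulr_suml mulr_sumr; apply: eq_bigr => l _.
by rewrite (gs k l); ring.
Qed.


(** The normal part of D_Y Y is tensorial in Y: writing Y in terms of the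
coordinate fields, the derivatives of its coefficients give tangent vectors. *)
Lemma derive_frame_field u (Y : 'rV[R]_n.+1 -> 'rV[R]_n.+1) (w : 'rV[R]_n.-1) :
  U u -> (exists W : set 'rV[R]_n.+1, [/\ open W, W (phi u), smooth_on_subset (S `&` W) Y &
     forall q, S q -> W q -> tangent n.-1 S q (Y q)]) ->
  Y (phi u) = \sum_i w 0 i *: P i u ->
  perp m S (phi u) (cov_along m S Y (phi u) (Y (phi u))) =
    \sum_i \sum_j (w 0 i * w 0 j) *: perp m S (phi u) (second_cov u i j).
Proof.
move=> Uu [W [oW Wu sY tY]] Ew; have Ru := Uphi Uu; have Su := param_in hp Uu.
have [Y' hY'] := sY _ (conj Su Wu).
have hex : exists Y', is_local_extension S Y (phi u) Y'.
  by exists Y'; exact: local_extension_restrict oW Wu hY'.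
have Ew' : Y (phi u) = 'D_w phi u by rewrite Ew (derive_coord_field hp).
rewrite [in X in cov_along _ _ _ _ X]Ew' (cov_along_param m hp Uu hex w).2.
pose c (y : 'rV[R]_n.-1) i : R := \sum_j gbar m (phi y) (Y (phi y)) (P j y) * Gi y j i.
have cE y : U y -> W (phi y) -> Y (phi y) = \sum_i c y i *: P i y.
  move=> Uy Wy; have [v ev] := (chart_tangent hp _ Uy).1 (tY _ (param_in hp Uy) Wy).
  by rewrite [LHS]ev; apply: eq_bigr => i _; congr (_ *: _); rewrite /c ev (coord_coef hn hm HS Hsp hp).
have cw i : c u i = w 0 i by rewrite /c Ew (coord_coef hn hm HS Hsp hp).
have dY i : is_derive u (ei i) (Y \o phi) ('D_(ei i) (Y \o phi) u).
  have [h _] := cov_along_param m hp Uu hex (ei i).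
  exact: derivableP (@ex_derive _ _ _ _ _ _ _ h).
have [dc hdc] : exists dc : 'I_n.-1 -> 'I_n.-1 -> R,
    forall i j, is_derive u (ei i) (fun y => c y j) (dc i j).
  exists (fun i j => 'D_(ei i) (fun y => c y j) u) => i j; apply: derivableP.
  have h l : derivable (fun y => gbar m (phi y) (Y (phi y)) (P l y) * Gi y l j) u (ei i).
    exact: (@ex_derive _ _ _ _ _ _ _ (is_derive_mul
      (is_derive_gbar hn hm oU Uphi Uu (dphi i Uu) (dY i) (dP i l Uu))
      (C1_is_derive (ei i) (C1_gram_inv l j) Uu))).
  exact: (@ex_derive _ _ _ _ _ _ _ (is_derive_bigsum (index_enum 'I_n.-1) (fun l => derivableP (h l)))).
have DY i : 'D_(ei i) (Y \o phi) u =
    \sum_j dc i j *: P j u + \sum_j w 0 j *: 'D_(ei i) (coord_field phi j) u.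
  apply/rowP => l.
  have h1 := is_derive_entry l (dY i).
  have oD : open (U `&` phi @^-1` W).
    by apply: open_preimage => // x Ux; exact: param_cont hp Ux.
  have h2 : is_derive u (ei i) (fun y => \sum_j c y j * P j y 0 l)
     (\sum_j (dc i j * P j u 0 l + c u j * 'D_(ei i) (coord_field phi j) u 0 l)).
    apply: is_derive_bigsum => j.
    exact: (is_derive_mul (hdc i j) (is_derive_entry l (dP i j Uu))).
  have h3 : is_derive u (ei i) (fun y => (Y \o phi) y 0 l)
     (\sum_j (dc i j * P j u 0 l + c u j * 'D_(ei i) (coord_field phi j) u 0 l)).
    apply: (is_derive_near oD (conj Uu Wu) _ h2) => y [Uy Wy] /=.
    by rewrite (cE y Uy Wy) summxE; apply: eq_bigr => j _; rewrite [LHS]mxE.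
  rewrite -(@derive_val _ _ _ _ _ _ _ h1) (@derive_val _ _ _ _ _ _ _ h3).
  rewrite [RHS]mxE !summxE -big_split; apply: eq_bigr => j _ /=.
  by rewrite cw; congr (_ + _); rewrite [RHS]mxE.
rewrite (derive_coord_field hp _ Uu) Ew (Gam_sum hn hm _ _ _ _ Ru).
rewrite -big_split /=.
under eq_bigr do rewrite DY -scalerDr -addrA -big_split /=.
rewrite (perp_sum hn hm HS Hsp hp)//; apply: eq_bigr => i _.
under [X in perp _ _ _ (_ + X)]eq_bigr do rewrite -scalerDr.
rewrite -[X in perp _ _ _ (X + _)]scale1r (perp_linear hn hm HS Hsp hp)// scale1r.
rewrite (perp_sum hn hm HS Hsp hp)// big1 ?add0r; last first.
  move=> j _; rewrite (perp_tangent hn hm HS Hsp hp Uu (coord_field_tangent hp _ Uu)) scaler0//.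
rewrite (perp_sum hn hm HS Hsp hp)// scaler_sumr; apply: eq_bigr => j _.
by rewrite scalerA.
Qed.

Lemma Gam_suml p (X : 'I_n.-1 -> 'rV[R]_n.+1) (a : 'I_n.-1 -> R) Y : schwarzschild m p ->
  Gam m p (\sum_i a i *: X i) Y = \sum_i a i *: Gam m p (X i) Y.
Proof.
move=> h; apply/rowP => c.
rewrite (linear_bigsum (F := fun V => Gam m p V _ 0 c)); last first.
  by move=> x V V'; rewrite (GamPl hn hm)// !mxE.
by rewrite summxE; apply: eq_bigr => i _; rewrite [RHS]mxE.
Qed.

Lemma cov_along_L u w : U u ->
  cov_along m S L (phi u) ('D_w phi u) = \sum_i w 0 i *: cov_L u i.
Proof.
move=> Uu; rewrite (cov_along_param m hp Uu (sL (param_in hp Uu)) w).2.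
rewrite (derive_coord_field hp _ Uu) (Gam_suml _ _ _ (Uphi Uu)) -big_split.
by apply: eq_bigr => i _; exact: (esym (scalerDr _ _ _)).
Qed.

Definition frame_at p a := e p a p.

Lemma frame_at_tangent u a : U u -> tangent n.-1 S (phi u) (frame_at (phi u) a).
Proof.
move=> Uu; have Su := param_in hp Uu; have [W [oW Wu _ h]] := he Su.
exact: (h _ Su Wu).1.
Qed.

Lemma frame_at_orthonormal u a b : U u ->
  gbar m (phi u) (frame_at (phi u) a) (frame_at (phi u) b) = (a == b)%:R.
Proof.
move=> Uu; have Su := param_in hp Uu; have [W [oW Wu _ h]] := he Su.
exact: (h _ Su Wu).2.
Qed.

Local Notation FM u := (frame_mx m phi u (frame_at (phi u))).

Lemma frame_coords u a : U u -> frame_at (phi u) a = \sum_i FM u a i *: P i u.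
Proof.
move=> Uu.
exact: (frame_mxE hn hm HS Hsp hp Uu (fun a => frame_at_tangent a Uu)).
Qed.

Lemma frame_trace_sum u (B : 'I_n.-1 -> 'I_n.-1 -> R) : U u ->
  \sum_a \sum_i \sum_j FM u a i * FM u a j * B i j = \sum_i \sum_j Gi u i j * B i j.
Proof.
move=> Uu; rewrite exchange_big; apply: eq_bigr => i _ /=.
rewrite exchange_big; apply: eq_bigr => j _ /=; rewrite -mulr_suml; congr (_ * _).
rewrite -(frame_trace hn hm HS Hsp hp Uu (fun a => frame_at_tangent a Uu) (fun a b => frame_at_orthonormal a b Uu)).
by rewrite [RHS]mxE; apply: eq_bigr => a _; congr (_ * _); rewrite [RHS]mxE.
Qed.

Lemma Qform_mean_curvature u : U u ->
  Qform (phi u) (mean_curvature m S (e (phi u)) (phi u)) (L (phi u)) =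
  \sum_i \sum_j Gi u i j * Qform (phi u) (perp m S (phi u) (second_cov u i j)) (L (phi u)).
Proof.
move=> Uu; have Ru := Uphi Uu; have Su := param_in hp Uu.
rewrite -(frame_trace_sum _ Uu) /mean_curvature.
under eq_bigr do rewrite -[perp _ _ _ _]scale1r.
rewrite (linear_bigsum _ _ _ (ql _ Ru)); apply: eq_bigr => a _; rewrite mul1r.
have [W [oW Wu sW h]] := he Su.
have -> := derive_frame_field (Y := e (phi u) a) (w := \row_i FM u a i) Uu.
- rewrite pair_big_dep (linear_bigsum _ _ _ (ql _ Ru)).
  rewrite [RHS]pair_big_dep; apply: eq_bigr => -[i j] _ /=; congr (_ * _).
  by congr (_ * _); rewrite mxE.
- by exists W; split => // q Sq Wq; exact: (h q Sq Wq).1.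
- by rewrite -/(frame_at (phi u) a) (frame_coords _ Uu); apply: eq_bigr => i _; congr (_ *: _); rewrite [RHS]mxE.
Qed.

Lemma Qform_cov_L u : U u ->
  \sum_a Qform (phi u) (frame_at (phi u) a) (perp m S (phi u) (cov_along m S L (phi u) (frame_at (phi u) a))) =
  \sum_i \sum_j Gi u i j * Qform (phi u) (P j u) (perp m S (phi u) (cov_L u i)).
Proof.
move=> Uu; have Ru := Uphi Uu.
rewrite -(frame_trace_sum _ Uu); apply: eq_bigr => a _.
have E : frame_at (phi u) a = 'D_(\row_i FM u a i) phi u.
  by rewrite (derive_coord_field hp _ Uu) (frame_coords _ Uu); apply: eq_bigr => i _; congr (_ *: _); rewrite [RHS]mxE.
rewrite [X in cov_along _ _ _ _ X]E (cov_along_L _ Uu) (perp_sum hn hm HS Hsp hp)//.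
rewrite (linear_bigsum _ _ _ (qr _ Ru)); apply: eq_bigr => i _.
rewrite [X in Qform _ X _](frame_coords _ Uu) (linear_bigsum _ _ _ (ql _ Ru)) mulr_sumr.
by apply: eq_bigr => j _; rewrite mulrA; congr (_ * _ * _); rewrite [LHS]mxE.
Qed.

(** The frame enters only through traces, which [frame_trace] turns into
contractions with the inverse Gram matrix. *)
Lemma integrand_divergence u : U u ->
  \sum_i 'D_(ei i) (div_field i) u = density u *
   (- n.-1%:R * gbar m (phi u) ddt (L (phi u))
    + Qform (phi u) (mean_curvature m S (e (phi u)) (phi u)) (L (phi u))
    + \sum_a Qform (phi u) (e (phi u) a (phi u))
        (perp m S (phi u) (cov_along m S L (phi u) (e (phi u) a (phi u))))).
Proof.
move=> Uu; rewrite (sum_derive_div_field Uu); congr (_ * _).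
rewrite (Qform_mean_curvature Uu) (Qform_cov_L Uu) -(trace_cov_L Uu).
rewrite -(trace_DQ Uu) -!big_split; apply: eq_bigr => i _ /=.
by rewrite -!big_split; apply: eq_bigr => j _ /=; rewrite !mulrDr.
Qed.

Lemma Qform_continuous (X Y : 'rV[R]_n.-1 -> 'rV[R]_n.+1) u : U u ->
  (forall j, {for u, continuous (fun y => X y 0 j)}) ->
  (forall j, {for u, continuous (fun y => Y y 0 j)}) ->
  {for u, continuous (fun y => Qform (phi y) (X y) (Y y))}.
Proof.
move=> Uu cX cY.
have E y : U y -> Qform (phi y) (X y) (Y y) =
    (\sum_(i < n) phi y 0 (lift ord0 i) * X y 0 (lift ord0 i)) * Y y 0 0
    + -1 * (X y 0 0 * \sum_(i < n) phi y 0 (lift ord0 i) * Y y 0 (lift ord0 i)).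
  by move=> Uy; rewrite (QformE hn hm _ _ (Uphi Uy)) mulN1r.
apply: (continuous_near_eq oU Uu E).
apply: continuous_addr.
  apply: continuous_mulr (cY 0); apply: continuous_sumr => i; apply: continuous_mulr (cX _).
  exact: C1_cont (cphi _) Uu.
apply: continuous_mulr; first exact: (C1_cont (C1_cst oU (-1)) Uu).
apply: continuous_mulr (cX 0) _; apply: continuous_sumr => i; apply: continuous_mulr (cY _).
exact: C1_cont (cphi _) Uu.
Qed.

Lemma Qform_cov_L_continuous u i j : U u ->
  {for u, continuous (fun y => Qform (phi y) (P j y) (cov_L y i))}.
Proof.
move=> Uu.
have E y : U y -> Qform (phi y) (P j y) (cov_L y i) =
    Qform (phi y) (P j y) ('D_(ei i) (L \o phi) y)
    + Qform (phi y) (P j y) (Gam m (phi y) (P i y) (L (phi y))).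
  move=> Uy; rewrite /cov_L -[X in Qform _ _ (X + _)]scale1r (qr _ (Uphi Uy)) mul1r//.
apply: (continuous_near_eq oU Uu E); apply: continuous_addr; last first.
  exact: C1_cont (C1_Qform_Gam hn hm oU Uphi cphi (cP j) (cP i) cL) Uu.
apply: Qform_continuous => // l; first exact: C1_cont (cP j l) Uu.
apply: (continuous_near_eq oU Uu (g := 'D_(ei i) (fun y => L (phi y) 0 l))).
  by move=> y Uy; exact: (esym (@derive_val _ _ _ _ _ _ _ (is_derive_entry l (dL i Uy)))).
exact: C1_derive_cont (cL l) Uu.
Qed.

(** The trace with D L instead of its normal part involves no projection, and is
visibly continuous. *)
Lemma cov_L_integrand_continuous u : U u ->
  {for u, continuous (fun y => \sum_a Qform (phi y) (e (phi y) a (phi y))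
     (perp m S (phi y) (cov_along m S L (phi y) (e (phi y) a (phi y)))))}.
Proof.
move=> Uu.
have E y : U y -> \sum_a Qform (phi y) (e (phi y) a (phi y))
     (perp m S (phi y) (cov_along m S L (phi y) (e (phi y) a (phi y)))) =
     \sum_i \sum_j Gi y i j * Qform (phi y) (P j y) (cov_L y i).
  move=> Uy; rewrite (trace_cov_L Uy).
  exact: (Qform_cov_L Uy).
apply: (continuous_near_eq oU Uu E); apply: continuous_sumr => i; apply: continuous_sumr => j.
apply: continuous_mulr; last exact: Qform_cov_L_continuous.
exact: C1_cont (C1_gram_inv i j) Uu.
Qed.

Lemma killing_integrand_continuous u : U u ->
  {for u, continuous (fun y => gbar m (phi y) ddt (L (phi y)))}.
Proof.
move=> Uu; have cd j : C1 U (fun=> (ddt : 'rV[R]_n.+1) 0 j) by exact: C1_cst.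
exact: C1_cont (C1_gbar hn hm oU Uphi cphi cd cL) Uu.
Qed.

(** The derivative W(rho) = sum_a Q(e_a, L) e_a(rho), defined on the submanifold
without reference to a chart. *)
Definition slope (rho : 'rV[R]_n.+1 -> R) (p : 'rV[R]_n.+1) : R :=
  \sum_a Qform p (e p a p) (L p) *
    'D_(e p a p) (xget (fun=> 0) [set r | is_local_extension S rho p r]) p.

Lemma slope_chart rho u : U u -> smooth_on_subset S rho ->
  slope rho (phi u) = \sum_i field_coord i u * 'D_(ei i) (fun y => rho (phi y)) u.
Proof.
move=> Uu srho; have Ru := Uphi Uu; have Su := param_in hp Uu.
rewrite /slope; set r := xget _ _.
have hr : is_local_extension S rho (phi u) r by exact: xgetPex (srho _ Su).
have [W [oW Wu sr er]] := hr.
have dr : differentiable r (phi u) by exact: (sr 1).1.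
have [D [oD Du DU cD eD]] := field_along hp Uu hr.
have DE i : 'D_(P i u) r (phi u) = 'D_(ei i) (fun y => rho (phi y)) u.
  have [_ <-] := derive_comp (ei i) (param_diff hp Uu) dr.
  apply: near_eq_derive; apply: filterS (open_nbhs_nbhs (conj oD Du)) => y Dy.
  exact: (esym (eD y Dy)).
pose B X Y := Qform (phi u) X (L (phi u)) * 'D_Y r (phi u).
have Bl Z a X Y : B (a *: X + Y) Z = a * B X Z + B Y Z.
  by rewrite /B (ql _ Ru); move: (Qform _ X _) (Qform _ Y _) ('D_Z r _) => x y z; ring.
have Br Z a X Y : B Z (a *: X + Y) = a * B Z X + B Z Y.
  rewrite /B !deriveE// linearP; move: ('d r _ X) ('d r _ Y) (Qform _ _ _) => x y z.
  by rewrite mulrDr; congr (_ + _); exact: mulrCA.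
have h := frame_sum hn hm HS Hsp hp Uu (e := frame_at (phi u))
  (fun a => frame_at_tangent a Uu) (fun a b => frame_at_orthonormal a b Uu) Bl Br.
transitivity (\sum_a B (frame_at (phi u) a) (frame_at (phi u) a)); first by [].
rewrite h exchange_big; apply: eq_bigr => j _ /=.
rewrite /field_coord mulr_suml; apply: eq_bigr => i _.
by rewrite /B DE (gram_inv_sym hn hm HS hp i j Uu) mulrA.
Qed.

Lemma slope_chart_continuous rho u : U u -> smooth_on_subset S rho ->
  {for u, continuous (fun y => slope rho (phi y))}.
Proof.
move=> Uu srho.
apply: (continuous_near_eq oU Uu (fun y Uy => slope_chart Uy srho)).
apply: continuous_sumr => i; apply: continuous_mulr.
  exact: C1_cont (C1_field_coord i) Uu.
exact: C1_derive_cont (field_along_C1 hp srho) Uu.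
Qed.

(** Outside its closed support rho vanishes in a neighbourhood. *)
Lemma slope_chart_eq0 rho u : U u -> smooth_on_subset S rho ->
  ~ closure (S `&` [set p | rho p != 0]) (phi u) -> slope rho (phi u) = 0.
Proof.
move=> Uu srho nc; rewrite (slope_chart Uu srho) big1// => i _.
have o : open (U `&` phi @^-1` (~` closure (S `&` [set p | rho p != 0]))).
  apply: open_preimage => //; first by apply: closed_openC; exact: closed_closure.
  by move=> x Ux; exact: param_cont hp Ux.
rewrite [X in _ * X](_ : _ = 0) ?mulr0// -(derive_cst (0 : R) u (ei i)).
apply: near_eq_derive; apply: filterS (open_nbhs_nbhs (conj o (conj Uu nc))) => y [Uy nCy].
apply/eqP/negPn/negP => r0; apply: nCy; apply: subset_closure; split => //.
exact: param_in hp Uy.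
Qed.
End Divergence.

(** * Functions extended by zero from a chart *)

Lemma near0_differentiable {R : realType} {V W : normedModType R} (r : V -> W) x :
  (\forall y \near x, r y = 0) -> differentiable r x.
Proof.
move=> r0; apply/diffP => /=.
apply: (@getPex _ (fun (df : {linear V -> W}) => continuous df /\
  forall y, r y = r (lim (nbhs x)) + df (y - lim (nbhs x))
                  +o_(y \near x) (y - lim (nbhs x)))).
exists (GRing.null_fun W : {linear V -> W}); split=> [y|]; first exact: cvg_cst.
suff h : r = cst (r (lim (nbhs x))) + (\0 : V -> W) +o_x (center (lim (nbhs x))).
  by move=> y; exact: (congr1 (fun f => f y) h).
apply/eqaddoP => _/posnumP[eps]; near=> y.
have -> : (r - (cst (r (lim (nbhs x))) + (\0 : V -> W))) y = 0.
  rewrite lim_id// !fctE /= (nbhs_singleton r0) addr0 subr0; near: y; exact: r0.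
by rewrite normr0 mulr_ge0.
Unshelve. all: by end_near. Qed.

Lemma near_eq_differentiable {R : realType} {V W : normedModType R} (f g : V -> W) x :
  (\forall y \near x, f y = g y) -> differentiable g x -> differentiable f x.
Proof.
move=> fg dg; have -> : f = (fun y => f y - g y) + g.
  by apply/funext => y; rewrite fctE subrK.
apply: differentiableD dg; apply: near0_differentiable.
by apply: filterS fg => y ->; rewrite subrr.
Qed.

Definition extend0 {R : realType} {V : Type} (U : set V) (f : V -> R) (u : V) : R :=
  if u \in U then f u else 0.

Lemma extend0_in {R : realType} {V : Type} (U : set V) (f : V -> R) u : U u -> extend0 U f u = f u.
Proof. by move=> Uu; rewrite /extend0 mem_set. Qed.

Lemma extend0_out {R : realType} {V : Type} (U : set V) (f : V -> R) u : ~ U u -> extend0 U f u = 0.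
Proof. by move=> Uu; rewrite /extend0 memNset. Qed.

Section ZeroExtension.
Context {R : realType} {k : nat}.
Variables (U K : set 'rV[R]_k) (oU : open U) (cK : compact K) (KU : K `<=` U).
Implicit Types f g : 'rV[R]_k -> R.

Let oKC : open (~` K).
Proof. by apply: closed_openC; apply: compact_closed => //; exact: Rhausdorff. Qed.

Lemma extend0_near f u : U u -> \forall y \near u, f y = extend0 U f y.
Proof.
move=> Uu; apply: filterS (open_nbhs_nbhs (conj oU Uu)) => y Uy.
by rewrite extend0_in.
Qed.

Lemma extend0_near0 f u : (forall y, U y -> ~ K y -> f y = 0) -> ~ U u ->
  \forall y \near u, 0 = extend0 U f y.
Proof.
move=> f0 nUu; have nK : (~` K) u by move=> /KU.
apply: filterS (open_nbhs_nbhs (conj oKC nK)) => y nKy.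
by have [Uy|nUy] := pselect (U y); [rewrite extend0_in ?f0|rewrite extend0_out].
Qed.

(** The functions on U whose extension by zero is continuous of compact support. *)
Definition supported_in f := (forall u, U u -> {for u, continuous f}) /\
  (forall u, U u -> ~ K u -> f u = 0).

Lemma cc_extend0 : exists2 M, 0 <= M & forall f, supported_in f -> cc M (extend0 U f).
Proof.
have [A [_ hA]] := compact_bounded cK.
exists (`|A| + 1) => [|f [cf f0]]; first by rewrite addr_ge0.
split=> [u|u uA].
  have [Uu|nUu] := pselect (U u).
    apply: (cvg_trans (near_eq_cvg (extend0_near f Uu))).
    by rewrite extend0_in//; exact: cf.
  apply: (cvg_trans (near_eq_cvg (extend0_near0 f0 nUu))).
  by rewrite extend0_out//; exact: cvg_cst.
have [Uu|nUu] := pselect (U u); last exact: extend0_out.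
rewrite extend0_in// f0// => Ku; move: uA; rewrite ltNge => /negP; apply.
by apply: hA Ku; rewrite (le_lt_trans (ler_norm _))// ltrDl.
Qed.

Lemma rV_integral_extend0D f g : supported_in f -> supported_in g ->
  rV_integral (extend0 U (fun u => f u + g u)) = rV_integral (extend0 U f) + rV_integral (extend0 U g).
Proof.
have [M _ h] := cc_extend0; have [D _ _] := @rV_integral_bl R k.
move=> /h cf /h cg; rewrite -(D _ _ _ cf cg); congr rV_integral; apply/funext => u.
by rewrite /extend0; case: ifP; rewrite ?addr0.
Qed.

Lemma rV_integral_extend0Z a f : supported_in f ->
  rV_integral (extend0 U (fun u => a * f u)) = a * rV_integral (extend0 U f).
Proof.
have [M _ h] := cc_extend0; have [_ Z _] := @rV_integral_bl R k.
move=> /h cf; rewrite -(Z _ _ _ cf); congr rV_integral; apply/funext => u.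
by rewrite /extend0; case: ifP; rewrite ?mulr0.
Qed.

Lemma supported_inZ a f : supported_in f -> supported_in (fun u => a * f u).
Proof.
move=> [cf f0]; split=> [u Uu|u Uu nK]; last by rewrite f0// mulr0.
by apply: (@cvgM _ _ (nbhs u)); [exact: cvg_cst|exact: cf].
Qed.

Lemma supported_inD f g : supported_in f -> supported_in g ->
  supported_in (fun u => f u + g u).
Proof.
move=> [cf f0] [cg g0]; split=> [u Uu|u Uu nK]; last by rewrite f0// g0// addr0.
exact: continuous_addr (cf u Uu) (cg u Uu).
Qed.

Lemma supported_in_sum (I : eqType) (r : seq I) (f : I -> 'rV[R]_k -> R) :
  (forall i, i \in r -> supported_in (f i)) -> supported_in (fun u => \sum_(i <- r) f i u).
Proof.
elim: r => [|i r IH] h.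
  have -> : (fun u => \sum_(i <- [::]) f i u) = (fun=> 0) by apply/funext => u; rewrite big_nil.
  by split=> [u Uu|//]; exact: (C1_cont (C1_cst oU 0) Uu).
have [ci i0] := h i (mem_head _ _).
have [cr r0] : supported_in (fun u => \sum_(i <- r) f i u).
  by apply: IH => j jr; apply: h; rewrite in_cons jr orbT.
have -> : (fun u => \sum_(j <- i :: r) f j u) = (fun u => f i u + \sum_(j <- r) f j u).
  by apply/funext => u; rewrite big_cons.
split=> [u Uu|u Uu nK]; last by rewrite i0// r0// addr0.
by apply: (@cvgD _ _ _ (nbhs u)); [exact: ci|exact: cr].
Qed.

Lemma rV_integral_extend0_sum (I : eqType) (r : seq I) (f : I -> 'rV[R]_k -> R) :
  (forall i, i \in r -> supported_in (f i)) ->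
  rV_integral (extend0 U (fun u => \sum_(i <- r) f i u)) = \sum_(i <- r) rV_integral (extend0 U (f i)).
Proof.
elim: r => [|i r IH] h.
  rewrite big_nil; apply: etrans (bl0 (@rV_integral_bl R k)); congr rV_integral.
  by apply/funext => u; rewrite /extend0 big_nil; case: ifP.
have hr j : j \in r -> supported_in (f j) by move=> jr; apply: h; rewrite in_cons jr orbT.
rewrite big_cons -(IH hr) -(rV_integral_extend0D (h i (mem_head _ _)) (supported_in_sum hr)).
by congr (rV_integral (extend0 U _)); apply/funext => u; rewrite big_cons.
Qed.

Lemma supported_in_derive f v : C1 U f -> (forall u, U u -> ~ K u -> f u = 0) ->
  supported_in (fun u => 'D_v f u).
Proof.
move=> cf f0; split=> [u Uu|].
  exact: (C1_derive_cont (v := v) cf Uu).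
have D0 u : U u -> ~ K u -> 'D_v f u = 0.
  move=> Uu nKu; rewrite -(derive_cst (0 : R) u v); apply: near_eq_derive.
  have o : open (U `&` ~` K) by exact: openI.
  by apply: filterS (open_nbhs_nbhs (conj o (conj Uu nKu))) => y [Uy nKy]; exact: f0.
exact: D0.
Qed.

(** The extension by zero of f is differentiable everywhere, with derivative the
extension by zero, since f vanishes near the boundary of U. *)
Lemma rV_integral_extend0_derive f v : C1 U f -> (forall u, U u -> ~ K u -> f u = 0) ->
  rV_integral (extend0 U (fun u => 'D_v f u)) = 0.
Proof.
move=> cf f0; have [M M0 h] := cc_extend0.
have ccf := h _ (conj (fun u Uu => C1_cont cf Uu) f0).
have ccD := h _ (supported_in_derive v cf f0).
have dE u : is_derive u v (extend0 U f) (extend0 U (fun u => 'D_v f u) u).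
  have [Uu|nUu] := pselect (U u).
    rewrite extend0_in//; apply: near_eq_is_derive (C1_is_derive v cf Uu).
    by apply: filterS (extend0_near f Uu) => y ->.
  rewrite extend0_out//; apply: near_eq_is_derive (is_derive_constant 0 u v).
  by apply: filterS (extend0_near0 f0 nUu) => y <-.
have E : extend0 U (fun u => 'D_v f u) = (fun u => 'D_v (extend0 U f) u).
  by apply/funext => u; rewrite (@derive_val _ _ _ _ _ _ _ (dE u)).
rewrite E; apply: (rV_integral_derive0 M0 ccf).
  by move=> u; exact: (@ex_derive _ _ _ _ _ _ _ (dE u)).
by rewrite -E; case: ccD.
Qed.
End ZeroExtension.

Lemma smooth_on_subset_continuous {R : realType} {E F : normedModType R} (A : set E) (f : E -> F) :
  smooth_on_subset A f -> {within A, continuous f}.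
Proof.
move=> sf; apply/subspace_continuousP => p Ap.
have [f' [W [oW Wp sf' e]]] := sf p Ap.
rewrite /from_subspace -(e p Ap Wp).
have c : f' y @[y --> within A (nbhs p)] --> f' p.
  by apply: cvg_within_filter; exact: (sf' 0 p Wp).
apply: (cvg_trans _ c); apply: near_eq_cvg.
apply: filterS (open_nbhs_nbhs (conj oW Wp)) => q Wq Aq; exact: e.
Qed.

(** It is the image of C under the inverse of phi, which is continuous on S. *)
Lemma param_compact_preimage {R : realType} {N k : nat} (S : set 'rV[R]_N)
    (U : set 'rV[R]_k) (phi : 'rV[R]_k -> 'rV[R]_N) (C : set 'rV[R]_N) :
  is_parametrization S U phi -> compact C -> C `<=` phi @` U ->
  compact (U `&` phi @^-1` C).
Proof.
move=> [_ _ _ [psi spsi h]] cC CU.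
have -> : U `&` phi @^-1` C = psi @` C.
  apply/seteqP; split=> [u [Uu Cu]|_ [p Cp <-]]; first by exists (phi u) => //; exact: h.
  by have [u Uu eu] := CU p Cp; rewrite -eu h//; split => //=; rewrite eu.
apply: continuous_compact => //.
apply: continuous_subspaceW (smooth_on_subset_continuous spsi).
exact: CU.
Qed.

(** * Change of chart *)

Section ChartChange.
Context {R : realType} {n : nat} (m : R) (hn : (3 <= n)%N) (hm : 0 <= m).
Variables (S : set 'rV[R]_n.+1) (HS : S `<=` schwarzschild m).
Variables (U V : set 'rV[R]_n.-1) (phi psi : 'rV[R]_n.-1 -> 'rV[R]_n.+1).
Hypotheses (hp : is_parametrization S U phi) (hq : is_parametrization S V psi).

Local Notation ei i := (delta_mx 0 i : 'rV[R]_n.-1).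

Lemma jacobianE k l (chi : 'rV[R]_k -> 'rV[R]_l) z i j : differentiable chi z ->
  jacobian chi z i j = ('D_(delta_mx 0 i) chi z) 0 j.
Proof. by move=> d; rewrite /jacobian mxE deriveE. Qed.

Lemma mul_jacobian k l (chi : 'rV[R]_k -> 'rV[R]_l) z w : differentiable chi z ->
  w *m jacobian chi z = 'D_w chi z.
Proof. by move=> d; rewrite /jacobian mul_rV_lin1 deriveE. Qed.

(** The chain rule for phi = psi o chi, expressing the coordinate fields of phi in
those of psi. *)
Lemma gram_pullback (chi : 'rV[R]_n.-1 -> 'rV[R]_n.-1) z : U z -> V (chi z) ->
  differentiable chi z -> (\forall y \near z, psi (chi y) = phi y) ->
  gram m phi z = jacobian chi z *m gram m psi (chi z) *m (jacobian chi z)^T.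
Proof.
move=> Uz Vz d e.
have Ru : schwarzschild m (phi z) by apply: HS; exact: param_in hp Uz.
have ez : psi (chi z) = phi z by exact: nbhs_singleton e.
have E i : coord_field phi i z = \sum_k jacobian chi z i k *: coord_field psi k (chi z).
  have [_ dc] := derive_comp (ei i) d (param_diff hq Vz).
  rewrite /coord_field -(near_eq_derive (ei i) e) dc (derive_coord_field hq _ Vz).
  by apply: eq_bigr => k _; rewrite jacobianE.
apply/matrixP => i j; rewrite [LHS]mxE [RHS]mxE (E i) (E j).
rewrite (linear_bigsum (F := gbar m (phi z) _)); last by move=> *; exact: gbarPr.
apply: eq_bigr => l _.
have -> : (jacobian chi z)^T l j = jacobian chi z j l by rewrite mxE.
rewrite (linear_bigsum (F := fun X => gbar m (phi z) X _)); last by move=> *; exact: gbarPl.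
rewrite mulrC; congr (_ * _); rewrite [RHS]mxE; apply: eq_bigr => k _; congr (_ * _).
by rewrite [RHS]mxE ez.
Qed.

Lemma density_pullback (chi : 'rV[R]_n.-1 -> 'rV[R]_n.-1) z : U z -> V (chi z) ->
  differentiable chi z -> (\forall y \near z, psi (chi y) = phi y) ->
  density m phi z = density m psi (chi z) * `|\det (jacobian chi z)|.
Proof.
move=> Uz Vz d e; rewrite /density (gram_pullback Uz Vz d e) !det_mulmx det_tr.
set J := \det _; set G := \det _.
have -> : J * G * J = J ^+ 2 * G by ring.
by rewrite sqrtrM ?sqr_ge0// sqrtr_sqr mulrC.
Qed.

(** The change of variables is applied to the transition map chi, defined where phi
takes values in the image of psi.  Its Jacobian is invertible because phi is an
immersion, and its inverse, the opposite transition map, is locally Lipschitz. *)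
Lemma chart_change (C : set 'rV[R]_n.+1) (g : 'rV[R]_n.+1 -> R) :
  compact C -> C `<=` phi @` U -> C `<=` psi @` V ->
  (forall p, S p -> ~ C p -> g p = 0) ->
  (forall u, U u -> {for u, continuous (fun u => g (phi u) * density m phi u)}) ->
  (forall u, V u -> {for u, continuous (fun u => g (psi u) * density m psi u)}) ->
  rV_integral (extend0 V (fun u => g (psi u) * density m psi u)) =
  rV_integral (extend0 U (fun u => g (phi u) * density m phi u)).
Proof.
move=> cC CU CV g0 cu cv.
have oU := param_open hp; have oV := param_open hq.
have [_ _ [W oW imW] [psi' _ psiK]] := hq.
pose D := U `&` phi @^-1` W; pose K := U `&` phi @^-1` C; pose chi z := psi' (phi z).
have oD : open D by apply: open_preimage => // x Ux; exact: param_cont hp Ux.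
have chiE z : D z -> V (chi z) /\ psi (chi z) = phi z.
  move=> [Uz Wz]; have : (S `&` W) (phi z) by split=> //; exact: param_in hp Uz.
  by rewrite -imW => -[v Vv e]; rewrite /chi -e psiK.
have chin z : D z -> \forall y \near z, psi (chi y) = phi y.
  by move=> Dz; apply: filterS (open_nbhs_nbhs (conj oD Dz)) => y /chiE[].
have dchi z : D z -> differentiable chi z.
  move=> Dz; have [Vz ez] := chiE _ Dz.
  have [|D' [tau [oD' D'z D'U [dtau _] htau]]] := param_transition hq hp Dz.1.
    by exists (chi z).
  apply: near_eq_differentiable (dtau z D'z).
  apply: filterS (open_nbhs_nbhs (conj oD' D'z)) => y D'y.
  by have [Vt et] := htau y D'y; rewrite /chi -et psiK.
have cK : compact K by exact: param_compact_preimage hp cC CU.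
have KD : K `<=` D.
  move=> z [Uz Cz]; split => //; have := CV _ Cz; rewrite imW => -[] //.
have cKV : compact (V `&` psi @^-1` C) by exact: param_compact_preimage hq cC CV.
have sV : V `&` psi @^-1` C `<=` V by move=> x [].
have sU : K `<=` U by move=> x [].
have [MF _ hF] := cc_extend0 oV cKV sV.
have ccF := hF _ (conj cv (fun u Vu (nK : ~ (V `&` psi @^-1` C) u) => etrans (congr1 (fun t => t * _)
     (g0 _ (param_in hq Vu) (fun Cu => nK (conj Vu Cu)))) (mul0r _))).
have [Mf _ hf] := cc_extend0 oU cK sU.
have [cf _] := hf _ (conj cu (fun u Uu (nK : ~ K u) => etrans (congr1 (fun t => t * _)
     (g0 _ (param_in hp Uu) (fun Cu => nK (conj Uu Cu)))) (mul0r _))).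
apply: (@change_of_variables R n.-1 D K chi _ _ MF oD cK KD dchi) => //.
- move=> z Dz; have [Vz ez] := chiE _ Dz; apply: unitmx_ker0 => w.
  rewrite (mul_jacobian _ (dchi _ Dz)) => w0; apply: (param_derive_eq0 hp Dz.1).
  have [_ dc] := derive_comp w (dchi _ Dz) (param_diff hq Vz).
  by rewrite -(near_eq_derive w (chin _ Dz)) dc w0 derive0.
- move=> z z' Dz Dz' e; apply: (param_inj hp Dz.1 Dz'.1).
  by rewrite -(chiE _ Dz).2 -(chiE _ Dz').2 e.
- move=> z Dz; have [Vz ez] := chiE _ Dz.
  have [|D' [tau [oD' D'z D'V ctau htau]]] := param_transition hp hq Vz.
    by exists z => //; exact: Dz.1.
  have [c _ [d d0 hc]] := Ck1_locally_lipschitz oD' D'z ctau.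
  have tauK a : D a -> D' (chi a) -> tau (chi a) = a.
    move=> Da D'a; have [Ut et] := htau _ D'a.
    by apply: (param_inj hp Ut Da.1); rewrite et (chiE _ Da).2.
  exists c.
  have cchi := differentiable_continuous (dchi _ Dz).
  have nb : \forall a \near z, [/\ D a, D' (chi a) & ball (chi z) d (chi a)].
    near=> a; split; near: a.
    + exact: open_nbhs_nbhs.
    + by apply: cchi; exact: open_nbhs_nbhs.
    + by apply: cchi; exact: nbhsx_ballx.
  near=> a b.
  have [Da D'a ba] : [/\ D a, D' (chi a) & ball (chi z) d (chi a)] by near: a.
  have [Db D'b bb] : [/\ D b, D' (chi b) & ball (chi z) d (chi b)] by near: b.
  by have := hc _ _ ba bb; rewrite (tauK _ Da D'a) (tauK _ Db D'b).
- move=> z nK; have [Uz|nUz] := pselect (U z); last exact: extend0_out.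
  by rewrite extend0_in// (g0 _ (param_in hp Uz)) ?mul0r// => Cz; apply: nK.
- move=> z Dz; have [Vz ez] := chiE _ Dz.
  rewrite (extend0_in _ Vz) (extend0_in _ Dz.1) ez.
  by rewrite (density_pullback Dz.1 Vz (dchi _ Dz) (chin _ Dz)) mulrA.
- move=> y hy; have [Vy|nVy] := pselect (V y); last exact: extend0_out.
  rewrite extend0_in// (g0 _ (param_in hq Vy)) ?mul0r// => Cy.
  have [u Uu eu] := CU _ Cy.
  have Du : D u.
    split => //=; rewrite eu; have : (psi @` V) (psi y) by exists y.
    by rewrite imW => -[].
  by apply: (hy u Du); rewrite /chi eu psiK.
Unshelve. all: by end_near. Qed.
End ChartChange.

(** * The divergence theorem *)

Section Global.
Context {R : realType} {n : nat} (m : R) (hn : (3 <= n)%N) (hm : 0 <= m).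
Variables (S : set 'rV[R]_n.+1) (HS : S `<=` schwarzschild m) (cS : compact S)
  (mS : is_submanifold n.-1 S) (Hsp : is_spacelike m S).
Variable (L : 'rV[R]_n.+1 -> 'rV[R]_n.+1).
Hypotheses (sL : smooth_on_subset S L) (nL : forall p, S p -> normal m S p (L p)).
Variable (e : 'rV[R]_n.+1 -> 'I_n.-1 -> 'rV[R]_n.+1 -> 'rV[R]_n.+1).
Hypothesis he : forall p, S p -> exists W : set 'rV[R]_n.+1,
    [/\ open W, W p, forall a, smooth_on_subset (S `&` W) (e p a) &
     forall q, S q -> W q ->
     (forall a, tangent n.-1 S q (e p a q)) /\
     (forall a b, gbar m q (e p a q) (e p b q) = (a == b)%:R)].
Variables (o : 'rV[R]_n.+1 -> set 'M[R]_(n.-1, n.+1)) (Ps : seq (patch R n)).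
Hypothesis hPs : is_partition_of_unity S o Ps.
Implicit Types c d : patch R n.

Local Notation ei i := (delta_mx 0 i : 'rV[R]_n.-1).

Definition support c : set 'rV[R]_n.+1 := closure (S `&` [set p | c.2 p != 0]).

Let patchP c : c \in Ps -> [/\ is_parametrization S c.1.1 c.1.2,
  smooth_on_subset S c.2 & support c `<=` c.1.2 @` c.1.1].
Proof. by case: c => [[U phi] rho] /hPs.1 []. Qed.

Lemma compact_support c : c \in Ps -> compact (support c).
Proof.
move=> /patchP[hp _ cU]; apply: (subclosed_compact _ cS); first exact: closed_closure.
by move=> p /cU[u Uu <-]; exact: param_in hp Uu.
Qed.

Definition chart_support c : set 'rV[R]_n.-1 := c.1.1 `&` c.1.2 @^-1` support c.

Lemma compact_chart_support c : c \in Ps -> compact (chart_support c).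
Proof.
by move=> Pc; have [hp _ cU] := patchP Pc; exact: param_compact_preimage hp (compact_support Pc) cU.
Qed.

Lemma out_support c p : S p -> ~ support c p -> c.2 p = 0.
Proof.
move=> Sp nc; apply/eqP/negPn/negP => r0; apply: nc; apply: subset_closure; split => //.
Qed.

Definition chart_integral c (f : 'rV[R]_n.+1 -> R) : R :=
  rV_integral (extend0 c.1.1 (fun u => f (c.1.2 u) * density m c.1.2 u)).

Definition chart_supported c (f : 'rV[R]_n.+1 -> R) : Prop :=
  supported_in c.1.1 (chart_support c) (fun u => f (c.1.2 u) * density m c.1.2 u).

Lemma density_continuous c u : c \in Ps -> c.1.1 u -> {for u, continuous (density m c.1.2)}.
Proof.
move=> /patchP[hp _ _] Uu; exact: C1_cont (C1_density hn hm HS Hsp hp he) Uu.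
Qed.

Lemma bump_continuous c d u : c \in Ps -> d \in Ps -> d.1.1 u ->
  {for u, continuous (fun y => c.2 (d.1.2 y))}.
Proof.
move=> /patchP[_ sc _] /patchP[hd _ _] Uu; exact: C1_cont (field_along_C1 hd sc) Uu.
Qed.

Local Notation slope := (slope S L e).

Lemma slope_eq0 c p : c \in Ps -> S p -> ~ support c p -> slope c.2 p = 0.
Proof.
move=> /patchP[_ sc _] Sp nc; have [U [phi [hp [u Uu eu]]]] := mS Sp.
by move: nc; rewrite -eu; exact: (slope_chart_eq0 hn hm HS Hsp hp L he Uu sc).
Qed.

Lemma slope_continuous c d u : c \in Ps -> d \in Ps -> d.1.1 u ->
  {for u, continuous (fun y => slope c.2 (d.1.2 y))}.
Proof.
move=> /patchP[_ sc _] /patchP[hd _ _] Uu.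
exact: (slope_chart_continuous hn hm HS Hsp hd sL he Uu sc).
Qed.

Lemma supported_bump_mul c (f : 'rV[R]_n.+1 -> R) : c \in Ps ->
  (forall u, c.1.1 u -> {for u, continuous (fun y => f (c.1.2 y))}) ->
  chart_supported c (fun p => c.2 p * f p).
Proof.
move=> Pc cf; have [hp _ _] := patchP Pc; split=> [u Uu|u Uu nK].
  apply: continuous_mulr (density_continuous Pc Uu).
  exact: continuous_mulr (bump_continuous Pc Pc Uu) (cf u Uu).
by rewrite (out_support (param_in hp Uu)) ?mul0r// => h; apply: nK.
Qed.

Lemma supported_slope c (f : 'rV[R]_n.+1 -> R) : c \in Ps ->
  (forall u, c.1.1 u -> {for u, continuous (fun y => f (c.1.2 y))}) ->
  chart_supported c (fun p => f p * slope c.2 p).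
Proof.
move=> Pc cf; have [hp _ _] := patchP Pc; split=> [u Uu|u Uu nK].
  apply: continuous_mulr (density_continuous Pc Uu).
  exact: continuous_mulr (cf u Uu) (slope_continuous Pc Pc Uu).
by rewrite (slope_eq0 Pc (param_in hp Uu)) ?mulr0 ?mul0r// => h; apply: nK.
Qed.

Definition killing_term p : R := gbar m p ddt (L p).
Definition curvature_term p : R := Qform p (mean_curvature m S (e p) p) (L p).
Definition connection_term p : R :=
  \sum_a Qform p (e p a p) (perp m S p (cov_along m S L p (e p a p))).

(** Integration by parts: the sum over i of the derivatives of rho_c times [div_field i]
has integral zero, and splits into rho_c times the integrand and W(rho_c).  The
mean curvature term is integrable as the difference of the other ones. *)
Lemma chart_divergence c : c \in Ps ->
  - n.-1%:R * chart_integral c (fun p => c.2 p * killing_term p)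
  + chart_integral c (fun p => c.2 p * curvature_term p)
  + chart_integral c (fun p => c.2 p * connection_term p)
  = - chart_integral c (slope c.2).
Proof.
move=> Pc; have [hp sc _] := patchP Pc; have oU := param_open hp.
have cK := compact_chart_support Pc.
have KU : chart_support c `<=` c.1.1 by move=> x [].
have c1 : chart_supported c (fun p => c.2 p * killing_term p).
  apply: supported_bump_mul => // u Uu.
  exact: (killing_integrand_continuous hn hm HS hp sL Uu).
have c3 : chart_supported c (fun p => c.2 p * connection_term p).
  apply: supported_bump_mul => // u Uu.
  exact: (cov_L_integrand_continuous hn hm HS Hsp hp sL nL he Uu).
have c4 : chart_supported c (slope c.2).
  have h := supported_slope Pc (f := fun=> 1) (fun u Uu => C1_cont (C1_cst oU 1) Uu).
  rewrite /chart_supported; congr (supported_in _ _ _): h.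
  by apply/funext => u; rewrite mul1r.
pose r u := c.2 (c.1.2 u).
have r0 u : c.1.1 u -> ~ chart_support c u -> r u = 0.
  by move=> Uu nK; rewrite /r (out_support (param_in hp Uu))// => h; apply: nK.
pose w i u := r u * div_field m c.1.2 L i u.
have cw i : C1 c.1.1 (w i).
  have h1 : C1 c.1.1 r by exact: (field_along_C1 hp sc).
  have h2 := C1_div_field hn hm HS Hsp hp sL he i.
  exact: (C1M oU h1 h2).
have w0 i u : c.1.1 u -> ~ chart_support c u -> w i u = 0.
  by move=> Uu nK; rewrite /w r0// mul0r.
have sw i : supported_in c.1.1 (chart_support c) (fun u => 'D_(ei i) (w i) u).
  exact: (supported_in_derive oU cK (ei i) (cw i) (w0 i)).
have I0 : rV_integral (extend0 c.1.1 (fun u => \sum_i 'D_(ei i) (w i) u)) = 0.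
  rewrite (rV_integral_extend0_sum oU cK KU)//; apply: big1 => i _.
  exact: (rV_integral_extend0_derive oU cK KU _ (cw i) (w0 i)).
have E u : c.1.1 u -> \sum_i 'D_(ei i) (w i) u =
   -1 * (n.-1%:R * (c.2 (c.1.2 u) * killing_term (c.1.2 u) * density m c.1.2 u))
   + c.2 (c.1.2 u) * curvature_term (c.1.2 u) * density m c.1.2 u
   + c.2 (c.1.2 u) * connection_term (c.1.2 u) * density m c.1.2 u
   + slope c.2 (c.1.2 u) * density m c.1.2 u.
  move=> Uu.
  have D i : 'D_(ei i) (w i) u = 'D_(ei i) r u * div_field m c.1.2 L i u + r u * 'D_(ei i) (div_field m c.1.2 L i) u.
    exact: (@derive_val _ _ _ _ _ _ _ (is_derive_mul
      (C1_is_derive (ei i) (field_along_C1 hp sc) Uu)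
      (C1_is_derive (ei i) (C1_div_field hn hm HS Hsp hp sL he i) Uu))).
  have S1 : \sum_i 'D_(ei i) r u * div_field m c.1.2 L i u = slope c.2 (c.1.2 u) * density m c.1.2 u.
    rewrite (slope_chart hn hm HS Hsp hp L he Uu sc) mulr_suml; apply: eq_bigr => i _.
    rewrite /div_field; move: ('D_(ei i) r u) (field_coord _ _ _ _ _) (density _ _ _) => x y z.
    by rewrite [RHS]mulrAC [RHS]mulrC (mulrC z).
  have S2 := integrand_divergence hn hm HS Hsp hp sL nL he Uu.
  rewrite -/(killing_term (c.1.2 u)) -/(curvature_term (c.1.2 u)) -/(connection_term (c.1.2 u)) in S2.
  rewrite (eq_bigr _ (fun i _ => D i)) big_split -mulr_sumr /= S1 S2 /r.
  move: (slope _ _) (killing_term _) (curvature_term _) (connection_term _) (density _ _ _) (c.2 _).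
  by move=> s x y z t v; ring.
have sD : supported_in c.1.1 (chart_support c) (fun u => \sum_i 'D_(ei i) (w i) u).
  by apply: supported_in_sum.
rewrite /chart_integral.
set k := fun u => c.2 (c.1.2 u) * killing_term (c.1.2 u) * density m c.1.2 u.
set q := fun u => c.2 (c.1.2 u) * curvature_term (c.1.2 u) * density m c.1.2 u.
set l := fun u => c.2 (c.1.2 u) * connection_term (c.1.2 u) * density m c.1.2 u.
set s := fun u => slope c.2 (c.1.2 u) * density m c.1.2 u.
pose D u := \sum_i 'D_(ei i) (w i) u.
have -> : extend0 c.1.1 q = extend0 c.1.1 (fun u => D u + (n.-1%:R * k u + (-1 * l u + -1 * s u))).
  apply/funext => u; have [Uu|nUu] := pselect (c.1.1 u); last by rewrite !extend0_out.
  rewrite !extend0_in// /D (E u Uu) -/(k u) -/(q u) -/(l u) -/(s u).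
  by move: (k u) (q u) (l u) (s u) => x y z t; ring.
have cl := supported_inZ (-1) c3; have cs := supported_inZ (-1) c4.
have ck := supported_inZ n.-1%:R c1.
have cls : supported_in c.1.1 (chart_support c) (fun u => -1 * l u + -1 * s u).
  exact: supported_inD.
have ckls : supported_in c.1.1 (chart_support c) (fun u => n.-1%:R * k u + (-1 * l u + -1 * s u)).
  exact: supported_inD.
rewrite (rV_integral_extend0D oU cK KU sD ckls) I0.
rewrite (rV_integral_extend0D oU cK KU ck cls) (rV_integral_extend0D oU cK KU cl cs).
rewrite (rV_integral_extend0Z oU cK KU _ c1) (rV_integral_extend0Z oU cK KU _ c3) (rV_integral_extend0Z oU cK KU _ c4).
move: (rV_integral _) (rV_integral _) (rV_integral _) => x y z; ring.
Qed.

(** The integrand vanishes outside the intersection of the supports of rho_c and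
rho_d, which lies in the images of both charts. *)
Lemma slope_exchange c d : c \in Ps -> d \in Ps ->
  chart_integral c (fun p => d.2 p * slope c.2 p) = chart_integral d (fun p => d.2 p * slope c.2 p).
Proof.
move=> Pc Pd; have [hc _ sc] := patchP Pc; have [hd _ sd] := patchP Pd.
apply/esym.
have [+ _] := supported_slope Pc (f := d.2) (fun u Uu => bump_continuous Pd Pc Uu).
have [+ _] := supported_bump_mul Pd (f := slope c.2) (fun u Uu => slope_continuous Pc Pd Uu).
move=> cd cc'.
apply: (chart_change hn hm HS hc hd (C := support c `&` support d)) => //.
- apply: (subclosed_compact _ (compact_support Pc)); last by move=> p [].
  by apply: closedI; exact: closed_closure.
- by move=> p [/sc].
- by move=> p [_ /sd].
- move=> p Sp nC; have [cp|ncp] := pselect (support c p); last by rewrite (slope_eq0 Pc Sp ncp) mulr0.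
  by rewrite (out_support Sp (c := d)) ?mul0r// => dp; apply: nC.
Qed.

(** Read in the chart of d, this is the derivative of the constant sum of the rho_c. *)
Lemma sum_slope d u : d \in Ps -> d.1.1 u -> \sum_(c <- Ps) slope c.2 (d.1.2 u) = 0.
Proof.
move=> Pd Uu; have [hd _ _] := patchP Pd; have oU := param_open hd.
rewrite big_seq (eq_bigr (fun c => \sum_i field_coord m d.1.2 L i u * 'D_(ei i) (fun y => c.2 (d.1.2 y)) u)); last first.
  by move=> c Pc; have [_ sc _] := patchP Pc; exact: (slope_chart hn hm HS Hsp hd L he Uu sc).
rewrite exchange_big big1// => i _; rewrite -mulr_sumr -big_seq.
have -> : \sum_(c <- Ps) 'D_(ei i) (fun y => c.2 (d.1.2 y)) u = 0; last by rewrite mulr0.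
have h : is_derive u (ei i) (fun y => \sum_(c <- Ps) c.2 (d.1.2 y)) 0.
  apply: (is_derive_near oU Uu _ (is_derive_constant (1 : R) u (ei i))) => y Uy.
  exact: hPs.2 (param_in hd Uy).
apply: etrans (@derive_val _ _ _ _ _ _ _ h); rewrite [LHS](big_nth d) big_mkord; apply/esym.
have -> : (fun y => \sum_(c <- Ps) c.2 (d.1.2 y)) = (fun y => \sum_(j < size Ps) (nth d Ps j).2 (d.1.2 y)).
  by apply/funext => y; rewrite (big_nth d) big_mkord.
apply: (@derive_val _ _ _ _ _ _ _ (is_derive_bigsum (index_enum 'I_(size Ps)) _)) => j.
have [_ sj _] := patchP (mem_nth d (ltn_ord j)).
exact: C1_is_derive (field_along_C1 hd sj) Uu.
Qed.

Lemma chart_integral_slope c : c \in Ps ->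
  chart_integral c (slope c.2) = \sum_(d <- Ps) chart_integral c (fun p => d.2 p * slope c.2 p).
Proof.
move=> Pc; have [hp _ _] := patchP Pc.
have KU : chart_support c `<=` c.1.1 by move=> x [].
rewrite /chart_integral -(rV_integral_extend0_sum (param_open hp) (compact_chart_support Pc) KU); last first.
  by move=> d Pd; exact: (supported_slope Pc (fun u Uu => bump_continuous Pd Pc Uu)).
congr rV_integral; apply/funext => u; have [Uu|nUu] := pselect (c.1.1 u); last by rewrite !extend0_out.
by rewrite !extend0_in// -!mulr_suml (hPs.2 _ (param_in hp Uu)) mul1r.
Qed.

Lemma sum_chart_integral_slope d : d \in Ps ->
  \sum_(c <- Ps) chart_integral d (fun p => d.2 p * slope c.2 p) = 0.
Proof.
move=> Pd; have [hp _ _] := patchP Pd.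
have KU : chart_support d `<=` d.1.1 by move=> x [].
rewrite /chart_integral -(rV_integral_extend0_sum (param_open hp) (compact_chart_support Pd) KU); last first.
  by move=> c Pc; exact: (supported_bump_mul Pd (fun u Uu => slope_continuous Pc Pd Uu)).
rewrite -[RHS](bl0 (@rV_integral_bl R n.-1)); congr rV_integral; apply/funext => u.
have [Uu|nUu] := pselect (d.1.1 u); last by rewrite extend0_out.
by rewrite extend0_in// -mulr_suml -mulr_sumr (sum_slope Pd Uu) mulr0 mul0r.
Qed.

(** Insert the partition of unity, move every term to the chart of d, and sum over
c first. *)
Lemma sum_slope_integrals : \sum_(c <- Ps) chart_integral c (slope c.2) = 0.
Proof.
rewrite big_seq (eq_bigr _ (fun c Pc => chart_integral_slope Pc)) -big_seq.
rewrite exchange_big big_seq big1// => d Pd /=.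
apply: etrans (sum_chart_integral_slope Pd); rewrite [LHS]big_seq [RHS]big_seq.
by apply: eq_bigr => c Pc; exact: slope_exchange.
Qed.

Lemma volume_chart_integral c (f : 'rV[R]_n.+1 -> R) : c \in Ps ->
  rV_integral (fun u : 'rV[R]_n.-1 => if u \in c.1.1
    then c.2 (c.1.2 u) * f (c.1.2 u) * volume_density m c.1.2 u else 0) =
  chart_integral c (fun p => c.2 p * f p).
Proof.
move=> Pc; have [hp _ _] := patchP Pc; congr rV_integral; apply/funext => u.
have [Uu|nUu] := pselect (c.1.1 u); last by rewrite extend0_out// memNset.
by rewrite extend0_in// mem_set// (volume_densityE m hp Uu).
Qed.

Lemma divergence_identity :
  let vol (f : 'rV[R]_n.+1 -> R) := \sum_(c <- Ps) rV_integral (fun u : 'rV[R]_n.-1 =>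
    if u \in c.1.1 then c.2 (c.1.2 u) * f (c.1.2 u) * volume_density m c.1.2 u else 0) in
  - n.-1%:R * vol killing_term + vol curvature_term + vol connection_term = 0.
Proof.
move=> vol; have volE f : vol f = \sum_(c <- Ps) chart_integral c (fun p => c.2 p * f p).
  by rewrite /vol big_seq [RHS]big_seq; apply: eq_bigr => c; exact: volume_chart_integral.
rewrite !volE mulr_sumr -!big_split.
transitivity (\sum_(c <- Ps) - chart_integral c (slope c.2)).
  by rewrite [LHS]big_seq [RHS]big_seq; apply: eq_bigr => c Pc; exact: chart_divergence.
by rewrite sumrN sum_slope_integrals oppr0.
Qed.
End Global.

Theorem theoremA (R : realType) (n : nat) (m : R) (hn : (3 <= n)%N)
    (hm : 0 <= m)
    (Sigma : set 'rV[R]_n.+1)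
    (Sigma_sub : Sigma `<=` schwarzschild m)
    (Sigma_submanifold : is_submanifold n.-1 Sigma)
    (Sigma_closed : compact Sigma)
    (Sigma_spacelike : is_spacelike m Sigma)
    (oT : 'rV[R]_n.+1 -> set 'M[R]_(n.-1, n.+1))
    (Sigma_oriented : is_orientation Sigma (tangent n.-1 Sigma) oT)
    (oN : 'rV[R]_n.+1 -> set 'M[R]_(2, n.+1))
    (normal_bundle_oriented : is_orientation Sigma (normal m Sigma) oN)
    (L : 'rV[R]_n.+1 -> 'rV[R]_n.+1)
    (L_null_normal : is_null_normal_field m Sigma L)
    (* e p is a local frame around p *)
    (e : 'rV[R]_n.+1 -> 'I_n.-1 -> 'rV[R]_n.+1 -> 'rV[R]_n.+1)
    (e_frame : forall p, Sigma p -> is_oriented_frame m Sigma oT p (e p)) :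
  - n.-1%:R * volume_integral m Sigma oT (fun p => gbar m p ddt (L p))
  + volume_integral m Sigma oT
      (fun p => Qform p (mean_curvature m Sigma (e p) p) (L p))
  + volume_integral m Sigma oT
      (fun p => \sum_(a < n.-1)
         Qform p (e p a p) (perp m Sigma p (cov_along m Sigma L p (e p a p))))
  = 0.
Proof.
have [sL nL] := L_null_normal.
have he p : Sigma p -> exists W : set 'rV[R]_n.+1,
    [/\ open W, W p, forall a, smooth_on_subset (Sigma `&` W) (e p a) &
     forall q, Sigma q -> W q ->
     (forall a, tangent n.-1 Sigma q (e p a q)) /\
     (forall a b, gbar m q (e p a q) (e p b q) = (a == b)%:R)].
  move=> Sp; have [W [oW Wp sW h]] := e_frame p Sp; exists W; split => // q Sq Wq.
  by have [h1 h2 _] := h q Sq Wq.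
rewrite /volume_integral; set Ps := xget _ _.
have [[Q hQ]|nQ] := pselect (exists Q, is_partition_of_unity Sigma oT Q).
  have hPs : is_partition_of_unity Sigma oT Ps by exact: (xgetPex [::] (ex_intro _ Q hQ)).
  exact: (divergence_identity hn hm Sigma_sub Sigma_closed Sigma_submanifold
    Sigma_spacelike sL (fun p Sp => (nL p Sp).1) he hPs).
(* Without any partition of unity all three integrals are empty sums. *)
have -> : Ps = [::] by apply: xgetPN => Q hQ; apply: nQ; exists Q.
by rewrite !big_nil mulr0 !addr0.
Qed.
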